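(* Let $Q$ be a quiver of Dynkin type $ADE$. Then the multiplicative preprojective algebra $\Lambda^1(Q)$ over $\mathbb{C}$ is isomorphic, as a $\mathbb{C}$-algebra, to the usual preprojective algebra $\Pi(Q)$ over $\mathbb{C}$.
   Context: A quiver is of Dynkin type $ADE$ if its underlying graph is a Dynkin diagram of type $A_n$, $D_n$, $E_6$, $E_7$ or $E_8$. Let $Q$ be a finite quiver with vertex set $I$, and let $\overline{Q}$ be its double, obtained by adjoining a reverse arrow $a^*:j\to i$ for each arrow $a:i\to j$ of $Q$; put $(a^* )^*=a$, $\epsilon(a)=1$ and $\epsilon(a^* )=-1$ for $a\in Q$. Paths are composed like functions, so that $aa^*$ is a path from $h(a)$ to $h(a)$, where $h(a)$ is the head of $a$. The preprojective algebra is $\Pi(Q)=\mathbb{C}\overline{Q}/\bigl(\sum_{a\in Q}(aa^*-a^*a)\bigr)$. For $q\in(\mathbb{C}^\times)^I$, the multiplicative preprojective algebra $\Lambda^q(Q)$ is the quotient of the universal localization of the path algebra $\mathbb{C}\overline{Q}$ inverting $1+aa^*$ for all $a\in\overline{Q}$, by the relation $$\prod_{a\in\overline{Q}}(1+aa^* )^{\epsilon(a)}=\sum_{i\in I}q_ie_i,$$ where $e_i$ is the trivial path at $i$ and the product is taken in some fixed ordering of the arrows of $\overline{Q}$ (up to isomorphism the algebra does not depend on the ordering). $\Lambda^1(Q)$ denotes the case $q_i=1$ for all $i\in I$. *)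

(* Defs.v *)
From HB Require Import structures.
From mathcomp Require Import all_boot all_order all_algebra.
From mathcomp Require Import generic_quotient finmap.
From mathcomp Require Import boolp reals complex.
From mathcomp Require Import monalg.

Set Implicit Arguments.
Unset Strict Implicit.
Unset Printing Implicit Defensive.

Import GRing.Theory.
Local Open Scope ring_scope.
Local Open Scope quotient_scope.

(* Unital associative [k]-algebras, presented by the structure morphism from [k]
   to the centre, so that [c *: x] is [alg_scalar c * x].  Unlike in the library's
   [algType], [1 = 0] is allowed: a quotient of a path algebra may be zero. *)
HB.mixin Record PzRing_isAlg (k : pzRingType) A of GRing.PzRing A := {
  alg_scalar : k -> A;
  alg_scalar_zmod_morphism : zmod_morphism alg_scalar;
  alg_scalar_monoid_morphism : GRing.monoid_morphism alg_scalar;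
  alg_scalarC : forall (c : k) (x : A), alg_scalar c * x = x * alg_scalar c
}.

#[short(type="pzAlgType")]
HB.structure Definition PzAlg (k : pzRingType) :=
  {A of GRing.PzRing A & PzRing_isAlg k A}.

HB.instance Definition _ (k : pzRingType) (A : pzAlgType k) :=
  GRing.isZmodMorphism.Build k A alg_scalar alg_scalar_zmod_morphism.
HB.instance Definition _ (k : pzRingType) (A : pzAlgType k) :=
  GRing.isMonoidMorphism.Build k A alg_scalar alg_scalar_monoid_morphism.

Definition alg_morphism (k : pzRingType) (A B : pzAlgType k)
    (f : {rmorphism A -> B}) :=
  forall c : k, f (alg_scalar c) = alg_scalar c.

Definition alg_isomorphic (k : pzRingType) (A B : pzAlgType k) :=
  exists2 f : {rmorphism A -> B}, alg_morphism f & bijective f.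

Section TwoSidedQuotient.
Variables (k : fieldType) (A : pzAlgType k) (S : A -> Prop).

Inductive ideal_gen : A -> Prop :=
| ideal_gen_in x of S x : ideal_gen x
| ideal_gen0 : ideal_gen 0
| ideal_genB x y of ideal_gen x & ideal_gen y : ideal_gen (x - y)
| ideal_genMl a x of ideal_gen x : ideal_gen (a * x)
| ideal_genMr x a of ideal_gen x : ideal_gen (x * a).

Definition ideal_eqv : rel A := fun x y => `[< ideal_gen (x - y) >].

Lemma ideal_genN x : ideal_gen x -> ideal_gen (- x).
Proof. by move=> Ix; rewrite -sub0r; apply: ideal_genB => //; exact: ideal_gen0. Qed.

Lemma ideal_genD x y : ideal_gen x -> ideal_gen y -> ideal_gen (x + y).
Proof.
by move=> Ix Iy; rewrite -[y]opprK; apply: ideal_genB => //; exact: ideal_genN.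
Qed.

Lemma ideal_eqv_equiv : equiv_class_of ideal_eqv.
Proof.
split=> [x|x y|y x z].
- by apply/asboolP; rewrite subrr; exact: ideal_gen0.
- by apply/asboolP/asboolP => /ideal_genN; rewrite opprB.
- move=> /asboolP xy /asboolP yz; apply/asboolP.
  by rewrite -(subrKA y); exact: ideal_genD.
Qed.

Canonical ideal_eqv_equivRel := EquivRelPack ideal_eqv_equiv.

Definition quot_alg := {eq_quot ideal_eqv}.
HB.instance Definition _ : EqQuotient A ideal_eqv quot_alg :=
  EqQuotient.on quot_alg.
HB.instance Definition _ := Choice.on quot_alg.

Definition quot_pi (x : A) : quot_alg := \pi x.

Lemma quot_piP x y : quot_pi x = quot_pi y <-> ideal_gen (x - y).
Proof. by split => [/eqmodP/asboolP //|xy]; apply/eqmodP/asboolP. Qed.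

Lemma quot_pi_surj (u : quot_alg) : exists x, quot_pi x = u.
Proof. by exists (repr u); exact: reprK. Qed.

Definition quot_opp (u : quot_alg) := quot_pi (- repr u).
Definition quot_add (u v : quot_alg) := quot_pi (repr u + repr v).
Definition quot_mul (u v : quot_alg) := quot_pi (repr u * repr v).

Lemma repr_quot_pi x : ideal_gen (repr (quot_pi x) - x).
Proof. by apply/quot_piP; exact: reprK. Qed.

Lemma quot_oppE x : quot_opp (quot_pi x) = quot_pi (- x).
Proof.
by apply/quot_piP; rewrite -opprD; apply: ideal_genN; exact: repr_quot_pi.
Qed.

Lemma quot_addE x y : quot_add (quot_pi x) (quot_pi y) = quot_pi (x + y).
Proof.
by apply/quot_piP; rewrite opprD addrACA; apply: ideal_genD;
  exact: repr_quot_pi.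
Qed.

Lemma quot_mulE x y : quot_mul (quot_pi x) (quot_pi y) = quot_pi (x * y).
Proof.
apply/quot_piP; set x' := repr _; set y' := repr _.
rewrite -(subrKA (x' * y)) -mulrBr -mulrBl; apply: ideal_genD.
  by apply: ideal_genMl; exact: repr_quot_pi.
by apply: ideal_genMr; exact: repr_quot_pi.
Qed.

Let quotW (P : quot_alg -> Prop) : (forall x, P (quot_pi x)) -> forall u, P u.
Proof. by move=> HP u; have [x <-] := quot_pi_surj u. Qed.

Fact quot_addA : associative quot_add.
Proof.
by elim/quotW=> x; elim/quotW=> y; elim/quotW=> z; rewrite !quot_addE addrA.
Qed.
Fact quot_addC : commutative quot_add.
Proof. by elim/quotW=> x; elim/quotW=> y; rewrite !quot_addE addrC. Qed.
Fact quot_add0 : left_id (quot_pi 0) quot_add.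
Proof. by elim/quotW=> x; rewrite quot_addE add0r. Qed.
Fact quot_addN : left_inverse (quot_pi 0) quot_opp quot_add.
Proof. by elim/quotW=> x; rewrite quot_oppE quot_addE addNr. Qed.

HB.instance Definition _ := GRing.isZmodule.Build quot_alg
  quot_addA quot_addC quot_add0 quot_addN.

Let addQE (u v : quot_alg) : u + v = quot_add u v. Proof. by []. Qed.

Fact quot_mulA : associative quot_mul.
Proof.
by elim/quotW=> x; elim/quotW=> y; elim/quotW=> z; rewrite !quot_mulE mulrA.
Qed.
Fact quot_mul1 : left_id (quot_pi 1) quot_mul.
Proof. by elim/quotW=> x; rewrite quot_mulE mul1r. Qed.
Fact quot_mulr1 : right_id (quot_pi 1) quot_mul.
Proof. by elim/quotW=> x; rewrite quot_mulE mulr1. Qed.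
Fact quot_mulDl : left_distributive quot_mul +%R.
Proof.
elim/quotW=> x; elim/quotW=> y; elim/quotW=> z.
by rewrite !addQE !(quot_addE, quot_mulE) mulrDl.
Qed.
Fact quot_mulDr : right_distributive quot_mul +%R.
Proof.
elim/quotW=> x; elim/quotW=> y; elim/quotW=> z.
by rewrite !addQE !(quot_addE, quot_mulE) mulrDr.
Qed.

HB.instance Definition _ := GRing.Zmodule_isPzRing.Build quot_alg
  quot_mulA quot_mul1 quot_mulr1 quot_mulDl quot_mulDr.

Fact quot_pi_zmod_morphism : zmod_morphism quot_pi.
Proof.
move=> x y; apply: (addIr (quot_pi y)); rewrite subrK addQE quot_addE.
by rewrite subrK.
Qed.
Fact quot_pi_monoid_morphism : GRing.monoid_morphism quot_pi.
Proof. by split=> [|x y] //; rewrite [RHS]quot_mulE. Qed.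

HB.instance Definition _ :=
  GRing.isZmodMorphism.Build A quot_alg quot_pi quot_pi_zmod_morphism.
HB.instance Definition _ :=
  GRing.isMonoidMorphism.Build A quot_alg quot_pi quot_pi_monoid_morphism.

Definition quot_scalar (c : k) : quot_alg := quot_pi (alg_scalar c).

Fact quot_scalar_zmod_morphism : zmod_morphism quot_scalar.
Proof. by move=> c d; rewrite /quot_scalar !rmorphB. Qed.
Fact quot_scalar_monoid_morphism : GRing.monoid_morphism quot_scalar.
Proof. by split=> [|c d]; rewrite /quot_scalar ?rmorph1 ?rmorphM. Qed.
Fact quot_scalarC c u : quot_scalar c * u = u * quot_scalar c.
Proof.
by elim/quotW: u => x; rewrite /quot_scalar -!rmorphM alg_scalarC.
Qed.

HB.instance Definition _ := PzRing_isAlg.Build k quot_alg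
  quot_scalar_zmod_morphism quot_scalar_monoid_morphism quot_scalarC.

End TwoSidedQuotient.

Section UniversalLocalization.
Variables (k : fieldType) (A : pzAlgType k) (J : Type) (s : J -> A).

(* The universal localization of [A] inverting the elements [s j] is obtained
   from [A] by freely adjoining a two-sided inverse [LocInv j] of each [s j]:
   ring expressions over [A] and these new symbols, modulo the smallest
   congruence that makes them a ring, makes [LocBase] a ring morphism and makes
   [LocInv j] inverse to [s j].  The scalars, being central in [A], remain
   central. *)
Inductive loc_term :=
| LocBase of A
| LocInv of J
| LocAdd of loc_term & loc_term
| LocMul of loc_term & loc_term.

HB.instance Definition _ := gen_eqMixin loc_term.
HB.instance Definition _ := gen_choiceMixin loc_term.

Inductive loc_cong : loc_term -> loc_term -> Prop :=
| loc_refl t : loc_cong t t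
| loc_sym t u of loc_cong t u : loc_cong u t
| loc_trans t u v of loc_cong t u & loc_cong u v : loc_cong t v
| loc_congD t t' u u' of loc_cong t t' & loc_cong u u' :
    loc_cong (LocAdd t u) (LocAdd t' u')
| loc_congM t t' u u' of loc_cong t t' & loc_cong u u' :
    loc_cong (LocMul t u) (LocMul t' u')
| loc_addA t u v : loc_cong (LocAdd t (LocAdd u v)) (LocAdd (LocAdd t u) v)
| loc_addC t u : loc_cong (LocAdd t u) (LocAdd u t)
| loc_add0 t : loc_cong (LocAdd (LocBase 0) t) t
| loc_addN t : loc_cong (LocAdd (LocMul (LocBase (- 1)) t) t) (LocBase 0)
| loc_mulA t u v : loc_cong (LocMul t (LocMul u v)) (LocMul (LocMul t u) v)
| loc_mul1 t : loc_cong (LocMul (LocBase 1) t) t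
| loc_mulr1 t : loc_cong (LocMul t (LocBase 1)) t
| loc_mulDl t u v :
    loc_cong (LocMul (LocAdd t u) v) (LocAdd (LocMul t v) (LocMul u v))
| loc_mulDr t u v :
    loc_cong (LocMul t (LocAdd u v)) (LocAdd (LocMul t u) (LocMul t v))
| loc_baseD a b : loc_cong (LocBase (a + b)) (LocAdd (LocBase a) (LocBase b))
| loc_baseM a b : loc_cong (LocBase (a * b)) (LocMul (LocBase a) (LocBase b))
| loc_invl j : loc_cong (LocMul (LocInv j) (LocBase (s j))) (LocBase 1)
| loc_invr j : loc_cong (LocMul (LocBase (s j)) (LocInv j)) (LocBase 1).

Definition loc_eqv : rel loc_term := fun t u => `[< loc_cong t u >].

Lemma loc_eqv_equiv : equiv_class_of loc_eqv.
Proof.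
split=> [t|t u|u t v].
- by apply/asboolP; exact: loc_refl.
- by apply/asboolP/asboolP; exact: loc_sym.
- by move=> /asboolP tu /asboolP uv; apply/asboolP; exact: loc_trans tu uv.
Qed.

Canonical loc_eqv_equivRel := EquivRelPack loc_eqv_equiv.

Definition loc_alg := {eq_quot loc_eqv}.
HB.instance Definition _ : EqQuotient loc_term loc_eqv loc_alg :=
  EqQuotient.on loc_alg.
HB.instance Definition _ := Choice.on loc_alg.

Definition loc_pi (t : loc_term) : loc_alg := \pi t.

Lemma loc_piP t u : loc_pi t = loc_pi u <-> loc_cong t u.
Proof. by split => [/eqmodP/asboolP //|tu]; apply/eqmodP/asboolP. Qed.

Lemma loc_pi_surj (x : loc_alg) : exists t, loc_pi t = x.
Proof. by exists (repr x); exact: reprK. Qed.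

Definition loc_base (a : A) : loc_alg := loc_pi (LocBase a).
Definition loc_inv (j : J) : loc_alg := loc_pi (LocInv j).
Definition loc_add (x y : loc_alg) := loc_pi (LocAdd (repr x) (repr y)).
Definition loc_mul (x y : loc_alg) := loc_pi (LocMul (repr x) (repr y)).
Definition loc_opp (x : loc_alg) := loc_mul (loc_base (- 1)) x.

Lemma repr_loc_pi t : loc_cong (repr (loc_pi t)) t.
Proof. by apply/loc_piP; exact: reprK. Qed.

Lemma loc_addE t u : loc_add (loc_pi t) (loc_pi u) = loc_pi (LocAdd t u).
Proof. by apply/loc_piP; apply: loc_congD; exact: repr_loc_pi. Qed.

Lemma loc_mulE t u : loc_mul (loc_pi t) (loc_pi u) = loc_pi (LocMul t u).
Proof. by apply/loc_piP; apply: loc_congM; exact: repr_loc_pi. Qed.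

Let locW (P : loc_alg -> Prop) : (forall t, P (loc_pi t)) -> forall x, P x.
Proof. by move=> HP x; have [t <-] := loc_pi_surj x. Qed.

Let locE := (loc_addE, loc_mulE).

Fact loc_algDA : associative loc_add.
Proof.
elim/locW=> t; elim/locW=> u; elim/locW=> v.
by rewrite !locE; apply/loc_piP; exact: loc_addA.
Qed.
Fact loc_algDC : commutative loc_add.
Proof.
by elim/locW=> t; elim/locW=> u; rewrite !locE; apply/loc_piP; exact: loc_addC.
Qed.
Fact loc_algD0 : left_id (loc_base 0) loc_add.
Proof. by elim/locW=> t; rewrite !locE; apply/loc_piP; exact: loc_add0. Qed.
Fact loc_algDN : left_inverse (loc_base 0) loc_opp loc_add.
Proof.
by elim/locW=> t; rewrite /loc_opp loc_mulE loc_addE; apply/loc_piP; exact: loc_addN.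
Qed.

HB.instance Definition _ := GRing.isZmodule.Build loc_alg
  loc_algDA loc_algDC loc_algD0 loc_algDN.

Let addLE (x y : loc_alg) : x + y = loc_add x y. Proof. by []. Qed.

Fact loc_algMA : associative loc_mul.
Proof.
elim/locW=> t; elim/locW=> u; elim/locW=> v.
by rewrite !locE; apply/loc_piP; exact: loc_mulA.
Qed.
Fact loc_algM1 : left_id (loc_base 1) loc_mul.
Proof. by elim/locW=> t; rewrite !locE; apply/loc_piP; exact: loc_mul1. Qed.
Fact loc_algMr1 : right_id (loc_base 1) loc_mul.
Proof. by elim/locW=> t; rewrite !locE; apply/loc_piP; exact: loc_mulr1. Qed.
Fact loc_algMDl : left_distributive loc_mul +%R.
Proof.
elim/locW=> t; elim/locW=> u; elim/locW=> v.
by rewrite !addLE !locE; apply/loc_piP; exact: loc_mulDl.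
Qed.
Fact loc_algMDr : right_distributive loc_mul +%R.
Proof.
elim/locW=> t; elim/locW=> u; elim/locW=> v.
by rewrite !addLE !locE; apply/loc_piP; exact: loc_mulDr.
Qed.

HB.instance Definition _ := GRing.Zmodule_isPzRing.Build loc_alg
  loc_algMA loc_algM1 loc_algMr1 loc_algMDl loc_algMDr.

Fact loc_base_zmod_morphism : zmod_morphism loc_base.
Proof.
move=> a b; apply: (addIr (loc_base b)); rewrite subrK addLE locE.
by rewrite -[in RHS](subrK b a); apply/esym/loc_piP; exact: loc_baseD.
Qed.
Fact loc_base_monoid_morphism : GRing.monoid_morphism loc_base.
Proof.
by split=> // a b; rewrite [RHS]locE; apply/loc_piP; exact: loc_baseM.
Qed.

HB.instance Definition _ :=
  GRing.isZmodMorphism.Build A loc_alg loc_base loc_base_zmod_morphism.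
HB.instance Definition _ :=
  GRing.isMonoidMorphism.Build A loc_alg loc_base loc_base_monoid_morphism.

Lemma loc_mulVr j : loc_inv j * loc_base (s j) = 1.
Proof. by rewrite [LHS]locE; apply/loc_piP; exact: loc_invl. Qed.

Lemma loc_mulrV j : loc_base (s j) * loc_inv j = 1.
Proof. by rewrite [LHS]locE; apply/loc_piP; exact: loc_invr. Qed.

Lemma loc_ind (P : loc_alg -> Prop) :
    (forall a, P (loc_base a)) -> (forall j, P (loc_inv j)) ->
    (forall x y, P x -> P y -> P (x + y)) ->
    (forall x y, P x -> P y -> P (x * y)) ->
  forall x, P x.
Proof.
move=> Pbase Pinv PD PM; elim/locW; elim=> // t Pt u Pu.
- by rewrite -loc_addE; exact: PD.
- by rewrite -loc_mulE; exact: PM.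
Qed.

Definition loc_scalar (c : k) : loc_alg := loc_base (alg_scalar c).

Fact loc_scalar_zmod_morphism : zmod_morphism loc_scalar.
Proof. by move=> c d; rewrite /loc_scalar !rmorphB. Qed.
Fact loc_scalar_monoid_morphism : GRing.monoid_morphism loc_scalar.
Proof. by split=> [|c d]; rewrite /loc_scalar ?rmorph1 ?rmorphM. Qed.
Fact loc_scalarC c x : loc_scalar c * x = x * loc_scalar c.
Proof.
have baseC a : loc_scalar c * loc_base a = loc_base a * loc_scalar c.
  by rewrite /loc_scalar -!rmorphM alg_scalarC.
elim/loc_ind: x => [//|j|x y IHx IHy|x y IHx IHy].
- rewrite -[LHS]mul1r -(loc_mulVr j) -mulrA (mulrA (loc_base _)) -baseC.
  by rewrite -!mulrA loc_mulrV mulr1.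
- by rewrite mulrDl mulrDr IHx IHy.
- by rewrite mulrA IHx -!mulrA IHy.
Qed.

HB.instance Definition _ := PzRing_isAlg.Build k loc_alg
  loc_scalar_zmod_morphism loc_scalar_monoid_morphism loc_scalarC.

(* The universal property that characterizes the localization. *)
Lemma loc_universal (B : pzAlgType k) (f : {rmorphism A -> B}) (v : J -> B) :
    alg_morphism f -> (forall j, v j * f (s j) = 1 /\ f (s j) * v j = 1) ->
  exists g : {rmorphism loc_alg -> B},
    [/\ alg_morphism g, forall a, g (loc_base a) = f a
      & forall h : {rmorphism loc_alg -> B},
          (forall a, h (loc_base a) = f a) -> h =1 g].
Proof.
move=> fk vP.
pose ev := fix ev t := match t with
  | LocBase a => f a
  | LocInv j => v j
  | LocAdd t u => ev t + ev u
  | LocMul t u => ev t * ev u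
  end.
have ev_cong t u : loc_cong t u -> ev t = ev u.
  elim=> //= {t u}.
  - by move=> t u w _ -> _ ->.
  - by move=> t t' u u' _ -> _ ->.
  - by move=> t t' u u' _ -> _ ->.
  - by move=> t u w; rewrite addrA.
  - by move=> t u; rewrite addrC.
  - by move=> t; rewrite rmorph0 add0r.
  - by move=> t; rewrite rmorphN rmorph1 rmorph0 mulN1r addNr.
  - by move=> t u w; rewrite mulrA.
  - by move=> t; rewrite rmorph1 mul1r.
  - by move=> t; rewrite rmorph1 mulr1.
  - by move=> t u w; rewrite mulrDl.
  - by move=> t u w; rewrite mulrDr.
  - by move=> a b; rewrite rmorphD.
  - by move=> a b; rewrite rmorphM.
  - by move=> j; rewrite rmorph1 (vP j).1.
  - by move=> j; rewrite rmorph1 (vP j).2.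
pose g (x : loc_alg) := ev (repr x).
have gE t : g (loc_pi t) = ev t by apply: ev_cong; exact: repr_loc_pi.
have gb a : g (loc_base a) = f a by rewrite gE.
have gD x y : g (x + y) = g x + g y.
  by elim/locW: x => t; elim/locW: y => u; rewrite [X in g X]locE !gE.
have gM x y : g (x * y) = g x * g y.
  by elim/locW: x => t; elim/locW: y => u; rewrite [X in g X]locE !gE.
have gB : zmod_morphism g.
  by move=> x y; apply: (addIr (g y)); rewrite -gD !subrK.
have g1M : GRing.monoid_morphism g by split=> //; rewrite gb rmorph1.
pose gz := GRing.isZmodMorphism.Build loc_alg B g gB.
pose gm := GRing.isMonoidMorphism.Build loc_alg B g g1M.
pose gr : {rmorphism loc_alg -> B} := HB.pack g gz gm.
exists gr; split=> [c|//|h hb].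
  by rewrite -fk -gb.
elim/loc_ind=> [a|j|x y IHx IHy|x y IHx IHy].
- by rewrite hb -gb.
- have gj : gr (loc_inv j) = v j by exact: gE.
  rewrite gj -[LHS]mul1r -(vP j).1 -mulrA -hb -rmorphM loc_mulrV.
  by rewrite rmorph1 mulr1.
- by rewrite !rmorphD IHx IHy.
- by rewrite !rmorphM IHx IHy.
Qed.

End UniversalLocalization.

Record quiver := Quiver {
  vertex : finType;
  arrow : finType;
  qtail : arrow -> vertex;
  qhead : arrow -> vertex
}.

Section Paths.
Variable Q : quiver.

(* [composable i [:: a1; ...; an]]: the composite [a1 ... an], in which [an] is
   traversed first, is defined and ends at [i]. *)
Fixpoint composable (i : vertex Q) (w : seq (arrow Q)) : bool :=
  if w is a :: w' then (qhead a == i) && composable (qtail a) w' else true.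

(* A path is given by its final vertex together with its word of arrows; the
   trivial path at [i] is [(i, [::])]. *)
Record qpath := QPath {
  qpath_val : vertex Q * seq (arrow Q);
  qpath_valP : composable qpath_val.1 qpath_val.2
}.

HB.instance Definition _ := [isSub for qpath_val].
HB.instance Definition _ := [Choice of qpath by <:].

Definition path_target (p : qpath) : vertex Q := (val p).1.
Definition path_word (p : qpath) : seq (arrow Q) := (val p).2.

Fixpoint word_source (i : vertex Q) (w : seq (arrow Q)) : vertex Q :=
  if w is a :: w' then word_source (qtail a) w' else i.
Definition path_source (p : qpath) := word_source (path_target p) (path_word p).

Definition trivial_path (i : vertex Q) : qpath :=
  @QPath (i, [::]) isT.

Fact arrow_path_subproof (a : arrow Q) : composable (qhead a) [:: a].
Proof. by rewrite /= eqxx. Qed.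
Definition arrow_path (a : arrow Q) : qpath :=
  @QPath (qhead a, [:: a]) (arrow_path_subproof a).

(* The composite of [p] after [q]. *)
Definition path_comp (p q : qpath) : option qpath :=
  if path_source p == path_target q
  then insub (path_target p, path_word p ++ path_word q) else None.

Lemma composable_cat i w1 w2 :
  composable i (w1 ++ w2) = composable i w1 && composable (word_source i w1) w2.
Proof. by elim: w1 i => //= a w IH i; rewrite IH andbA. Qed.

Lemma word_source_cat i w1 w2 :
  word_source i (w1 ++ w2) = word_source (word_source i w1) w2.
Proof. by elim: w1 i => //=. Qed.

Lemma path_comp_some p q : path_source p = path_target q ->
  exists2 r, path_comp p q = Some r &
    val r = (path_target p, path_word p ++ path_word q).
Proof.
move=> pq; rewrite /path_comp pq eqxx.
case: insubP => [r _ rE|/negP[]]; first by exists r.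
rewrite composable_cat -/(path_source p) pq.
by rewrite (valP p) (valP q).
Qed.

Lemma path_compA p q r :
  obind (path_comp p) (path_comp q r) = obind (path_comp^~ r) (path_comp p q).
Proof.
have [pq|/eqP/negPf pq] := path_source p =P path_target q; last first.
  rewrite [path_comp p q]/path_comp pq /=.
  have [qr|/eqP/negPf qr] := path_source q =P path_target r.
    have [u -> uE /=] := path_comp_some qr.
    by rewrite /path_comp /path_target uE /= -/(path_target q) pq.
  by rewrite /path_comp qr.
have [v vS vE] := path_comp_some pq; rewrite vS /=.
have vs : path_source v = path_source q.
  rewrite /path_source /path_target /path_word vE /= word_source_cat.
  by rewrite -/(path_source p) pq.
have [qr|/eqP/negPf qr] := path_source q =P path_target r; last first.
  by rewrite /path_comp vs qr.
have [u -> uE /=] := path_comp_some qr.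
have pu : path_source p = path_target u by rewrite pq /path_target uE.
have [x -> xE] := path_comp_some pu.
rewrite -vs in qr; have [y -> yE] := path_comp_some qr.
congr Some; apply: val_inj; rewrite xE yE.
by rewrite /path_target /path_word uE vE /= catA.
Qed.

Lemma trivial_path_comp i p :
  path_comp (trivial_path i) p = if i == path_target p then Some p else None.
Proof.
rewrite /path_comp /path_source /path_word /=.
case: eqP => // ip.
by rewrite ip /path_target -surjective_pairing valK.
Qed.

Lemma comp_trivial_path p i :
  path_comp p (trivial_path i) = if path_source p == i then Some p else None.
Proof.
rewrite /path_comp /path_word /path_target /=.
by case: eqP => // ip; rewrite cats0 -surjective_pairing valK.
Qed.

End Paths.

Section BilinearOnBasis.
Variables (k : fieldType) (V : lmodType k) (I : Type) (e : I -> V).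
Variable mul : V -> V -> V.
Hypothesis e_ind : forall P : V -> Prop,
  P 0 -> (forall c i x, P x -> P (c *: e i + x)) -> forall x, P x.
Hypothesis mulDl : left_distributive mul +%R.
Hypothesis mulDr : right_distributive mul +%R.
Hypothesis mulZl : forall c x y, mul (c *: x) y = c *: mul x y.
Hypothesis mulZr : forall c x y, mul x (c *: y) = c *: mul x y.

Let mul0l y : mul 0 y = 0. Proof. by rewrite -(scale0r 0) mulZl !scale0r. Qed.
Let mul0r x : mul x 0 = 0. Proof. by rewrite -(scale0r 0) mulZr !scale0r. Qed.

Lemma basis_mulA :
    (forall i j l, mul (e i) (mul (e j) (e l)) = mul (mul (e i) (e j)) (e l)) ->
  associative mul.
Proof.
move=> eA x y z; elim/e_ind: x => [|c i x IHx]; first by rewrite !mul0l.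
rewrite !mulDl !mulZl IHx; congr (_ *: _ + _) => {x IHx}.
elim/e_ind: y => [|d j y IHy]; first by rewrite !(mul0l, mul0r).
rewrite !(mulDl, mulDr, mulZl, mulZr) IHy; congr (_ *: _ + _) => {y IHy}.
elim/e_ind: z => [|b l z IHz]; first by rewrite !mul0r.
by rewrite !(mulDr, mulZr) IHz eA.
Qed.

Lemma basis_mul1 u : (forall i, mul u (e i) = e i) -> left_id u mul.
Proof.
move=> eu; elim/e_ind=> [|c i x IHx]; first exact: mul0r.
by rewrite mulDr mulZr IHx eu.
Qed.

Lemma basis_mulr1 u : (forall i, mul (e i) u = e i) -> right_id u mul.
Proof.
move=> eu; elim/e_ind=> [|c i x IHx]; first exact: mul0l.
by rewrite mulDl mulZl IHx eu.
Qed.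

End BilinearOnBasis.

Section PathAlgebra.
Variables (k : fieldType) (Q : quiver).

(* Finitely supported functions from paths to [k], with product the bilinear
   extension of composition of paths. *)
Definition path_alg := {malg k[qpath Q]}.
HB.instance Definition _ := GRing.Lmodule.on path_alg.

Definition path_elt (p : qpath Q) : path_alg := << p >>.

Definition lin_ext (V : lmodType k) (h : qpath Q -> V) (x : path_alg) : V :=
  \sum_(p <- msupp x) x@_p *: h p.

Definition path_mul_basis (p q : qpath Q) : path_alg :=
  oapp path_elt 0 (path_comp p q).

Definition path_alg_mul (x y : path_alg) : path_alg :=
  lin_ext (fun p => lin_ext (path_mul_basis p) y) x.

Definition path_alg_one : path_alg := \sum_(i : vertex Q) path_elt (trivial_path i).

Section LinExt.
Variables (V : lmodType k) (h : qpath Q -> V).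

Lemma lin_extEw (d : {fset qpath Q}) (x : path_alg) : (msupp x `<=` d)%fset ->
  lin_ext h x = \sum_(p <- d) x@_p *: h p.
Proof.
move=> xd; rewrite /lin_ext; apply/big_fset_incl => // p _.
by move/mcoeff_outdom ->; rewrite scale0r.
Qed.

Lemma lin_ext_is_linear : linear (lin_ext h).
Proof.
move=> c x y; pose d := (msupp x `|` msupp y)%fset.
have xd : (msupp x `<=` d)%fset by exact: fsubsetUl.
have yd : (msupp y `<=` d)%fset by exact: fsubsetUr.
have xyd : (msupp (c *: x + y) `<=` d)%fset.
  apply: fsubset_trans (msuppD_le _ _) _; rewrite fsubUset yd andbT.
  exact: fsubset_trans (msuppZ_le _ _) xd.
rewrite (lin_extEw xd) (lin_extEw yd) (lin_extEw xyd).
rewrite scaler_sumr -big_split /=; apply: eq_bigr => p _.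
by rewrite mcoeffD mcoeffZ scalerDl scalerA.
Qed.

HB.instance Definition _ :=
  GRing.isLinear.Build k path_alg V *:%R (lin_ext h) lin_ext_is_linear.

Lemma lin_ext_elt p : lin_ext h (path_elt p) = h p.
Proof.
rewrite (@lin_extEw [fset p]%fset) ?msuppU_le //.
by rewrite big_seq_fset1 /path_elt mcoeffUU scale1r.
Qed.

End LinExt.

Lemma path_algE (x : path_alg) : x = \sum_(p <- msupp x) x@_p *: path_elt p.
Proof.
rewrite [LHS]monalgE; apply: eq_bigr => p _; apply/malgP => q.
by rewrite mcoeffZ !mcoeffU mulr_natr.
Qed.

Lemma path_alg_ind (P : path_alg -> Prop) :
    P 0 -> (forall c p x, P x -> P (c *: path_elt p + x)) ->
  forall x, P x.
Proof.
move=> P0 PS x; rewrite (path_algE x).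
by elim/big_rec: _ => // p y _; exact: PS.
Qed.

Lemma path_alg_mul_linearr x : linear (path_alg_mul x).
Proof.
move=> c y z; rewrite /path_alg_mul /lin_ext scaler_sumr -big_split /=.
apply: eq_bigr => p _; rewrite -!/(lin_ext _ _) linearP scalerDr.
by rewrite !scalerA mulrC.
Qed.

Lemma path_alg_mul_linearl y : linear (path_alg_mul^~ y).
Proof. by move=> c x z; rewrite /path_alg_mul linearP. Qed.

HB.instance Definition _ x :=
  GRing.isLinear.Build k path_alg path_alg *:%R (path_alg_mul x)
    (path_alg_mul_linearr x).

Lemma path_alg_mulDl : left_distributive path_alg_mul +%R.
Proof. by move=> x y z; rewrite /path_alg_mul linearD. Qed.
Lemma path_alg_mulDr : right_distributive path_alg_mul +%R.
Proof. by move=> x y z; rewrite linearD. Qed.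
Lemma path_alg_mulZl c x y : path_alg_mul (c *: x) y = c *: path_alg_mul x y.
Proof. by rewrite /path_alg_mul linearZ. Qed.
Lemma path_alg_mulZr c x y : path_alg_mul x (c *: y) = c *: path_alg_mul x y.
Proof. by rewrite linearZ. Qed.
Lemma path_alg_mul0l y : path_alg_mul 0 y = 0.
Proof. by rewrite /path_alg_mul linear0. Qed.
Lemma path_alg_mul0r x : path_alg_mul x 0 = 0.
Proof. by rewrite linear0. Qed.

Lemma path_alg_mul_elt p q :
  path_alg_mul (path_elt p) (path_elt q) = oapp path_elt 0 (path_comp p q).
Proof. by rewrite /path_alg_mul !lin_ext_elt. Qed.

Fact path_alg_mulA : associative path_alg_mul.
Proof.
apply: (basis_mulA path_alg_ind path_alg_mulDl path_alg_mulDr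
          path_alg_mulZl path_alg_mulZr) => p q r.
rewrite (path_alg_mul_elt q r) (path_alg_mul_elt p q).
have := path_compA p q r.
case: (path_comp q r) (path_comp p q) => [u|] [v|] /= E.
- by apply: etrans (path_alg_mul_elt p u) _; rewrite E -path_alg_mul_elt.
- by apply: etrans (path_alg_mul_elt p u) _; rewrite E; exact/esym/path_alg_mul0l.
- apply: etrans (path_alg_mul0r _) _; apply: esym.
  by apply: etrans (path_alg_mul_elt v r) _; rewrite -E.
- by apply: etrans (path_alg_mul0r _) _; exact/esym/path_alg_mul0l.
Qed.

Fact path_alg_mul1 : left_id path_alg_one path_alg_mul.
Proof.
apply: (basis_mul1 path_alg_ind path_alg_mulDr path_alg_mulZr) => p.
rewrite /path_alg_mul /path_alg_one [LHS]linear_sum /=.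
rewrite (bigD1 (path_target p)) //= big1 => [|i ip].
  rewrite addr0; apply: etrans (path_alg_mul_elt _ _) _.
  by rewrite trivial_path_comp eqxx.
by apply: etrans (path_alg_mul_elt _ _) _; rewrite trivial_path_comp (negPf ip).
Qed.

Fact path_alg_mulr1 : right_id path_alg_one path_alg_mul.
Proof.
apply: (basis_mulr1 path_alg_ind path_alg_mulDl path_alg_mulZl) => p.
rewrite /path_alg_one [LHS]linear_sum /=.
rewrite (bigD1 (path_source p)) //= big1 => [|i ip].
  by rewrite addr0 path_alg_mul_elt comp_trivial_path eqxx.
by rewrite path_alg_mul_elt comp_trivial_path eq_sym (negPf ip).
Qed.

HB.instance Definition _ := GRing.Zmodule_isPzRing.Build path_alg
  path_alg_mulA path_alg_mul1 path_alg_mulr1 path_alg_mulDl path_alg_mulDr.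

Definition path_alg_scalar (c : k) : path_alg := c *: (1 : path_alg).

Lemma path_alg_scalar_mul c (x : path_alg) : path_alg_scalar c * x = c *: x.
Proof. by rewrite -[LHS]/(path_alg_mul _ _) path_alg_mulZl path_alg_mul1. Qed.

Fact path_alg_scalar_zmod_morphism : zmod_morphism path_alg_scalar.
Proof. by move=> c d; rewrite /path_alg_scalar scalerBl. Qed.
Fact path_alg_scalar_monoid_morphism : GRing.monoid_morphism path_alg_scalar.
Proof.
split=> [|c d]; first exact: scale1r.
by rewrite path_alg_scalar_mul /path_alg_scalar scalerA.
Qed.
Fact path_alg_scalarC c (x : path_alg) :
  path_alg_scalar c * x = x * path_alg_scalar c.
Proof.
rewrite path_alg_scalar_mul -[RHS]/(path_alg_mul _ _) path_alg_mulZr.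
by rewrite path_alg_mulr1.
Qed.

HB.instance Definition _ := PzRing_isAlg.Build k path_alg
  path_alg_scalar_zmod_morphism path_alg_scalar_monoid_morphism path_alg_scalarC.

Definition vertex_idem (i : vertex Q) : path_alg := path_elt (trivial_path i).
Definition arrow_elt (a : arrow Q) : path_alg := path_elt (arrow_path a).

End PathAlgebra.

(* The arrows of the double are [inl a], which is [a] itself, and [inr a], which
   is the reverse arrow of [a]. *)
Definition double_quiver (Q : quiver) : quiver :=
  @Quiver (vertex Q) (arrow Q + arrow Q)%type
    (fun b => match b with inl a => qtail a | inr a => qhead a end)
    (fun b => match b with inl a => qhead a | inr a => qtail a end).

Definition qstar (Q : quiver) (b : arrow (double_quiver Q)) : arrow (double_quiver Q) :=
  match b with inl a => inr a | inr a => inl a end.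

Definition preproj_rel (k : fieldType) (Q : quiver) : path_alg k (double_quiver Q) :=
  let x (b : arrow (double_quiver Q)) := arrow_elt k b in
  \sum_(a : arrow Q) (x (inl a) * x (inr a) - x (inr a) * x (inl a)).

Definition preproj (k : fieldType) (Q : quiver) : pzAlgType k :=
  quot_alg (fun x => x = preproj_rel k Q).

Section MultiplicativePreprojective.
Variables (k : fieldType) (Q : quiver).

Definition one_plus (b : arrow (double_quiver Q)) : path_alg k (double_quiver Q) :=
  1 + arrow_elt k b * arrow_elt k (qstar b).

Definition path_alg_loc : pzAlgType k := loc_alg one_plus.

(* [(1 + b b^star)^epsilon(b)], where [epsilon] is [1] on [inl] and [-1] on
   [inr]. *)
Definition mult_factor (b : arrow (double_quiver Q)) : path_alg_loc :=
  match b with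
  | inl _ => loc_base one_plus (one_plus b)
  | inr _ => loc_inv one_plus b
  end.

(* The list [s] is meant to enumerate the arrows of the double, without
   repetition, in the order in which the product is taken. *)
Definition mult_preproj_rel (q : vertex Q -> k) (s : seq (arrow (double_quiver Q))) :
    path_alg_loc :=
  \prod_(b <- s) mult_factor b
  - \sum_(i : vertex Q) alg_scalar (q i) *
      loc_base one_plus (vertex_idem k (i : vertex (double_quiver Q))).

Definition mult_preproj (q : vertex Q -> k) (s : seq (arrow (double_quiver Q))) :
    pzAlgType k :=
  quot_alg (fun x => x = mult_preproj_rel q s).

End MultiplicativePreprojective.

(* For [i = j] this counts the loops at [i]. *)
Definition edge_mult (Q : quiver) (i j : vertex Q) : nat :=
  #|[set a : arrow Q | (qtail a == i) && (qhead a == j)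
                       || (qtail a == j) && (qhead a == i)]|.

Definition underlying_graph_iso (Q : quiver) (n : nat) (adj : rel nat) : Prop :=
  exists2 f : vertex Q -> 'I_n, bijective f &
    forall i j : vertex Q, edge_mult i j = adj (f i) (f j) :> nat.

(* The chain [0 - 1 - ... - (n-1)]. *)
Definition chain_adj : rel nat := fun i j => (i.+1 == j) || (j.+1 == i).

(* The chain [0 - 1 - ... - (n-2)] with one more vertex [n-1] joined to [b]. *)
Definition branched_adj (n b : nat) : rel nat := fun i j =>
  [|| chain_adj i j && (maxn i j < n.-1)%N,
      (i == b) && (j == n.-1) | (j == b) && (i == n.-1)].

Definition dynkin_ADE (Q : quiver) : Prop :=
  [\/ exists2 n, (0 < n)%N & underlying_graph_iso Q n chain_adj,
      exists2 n, (3 < n)%N & underlying_graph_iso Q n (branched_adj n (n - 3))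
    | exists2 n, n \in [:: 6; 7; 8] & underlying_graph_iso Q n (branched_adj n 2)].

(* Main.v *)
Require Import Defs.
From HB Require Import structures.
From mathcomp Require Import all_boot all_order all_algebra.
From mathcomp Require Import generic_quotient boolp reals complex zify.

Set Implicit Arguments.
Unset Strict Implicit.
Unset Printing Implicit Defensive.

Import GRing.Theory.
Local Open Scope ring_scope.

(** Write [J] for the ideal generated by the arrows, [rho] for the additive
    relation [sum_a (a a^star - a^star a)] and [M] for the product of the
    factors [(1 + b b^star)^epsilon(b)].  The proof has two independent halves:
    for Dynkin quivers [J] is nilpotent in both algebras, and whenever this is
    so and the characteristic is [0] the two algebras are isomorphic.

    For the second half one looks for elements [beta b] of the additive algebra,
    congruent to the arrows [b] modulo [J^2], that satisfy the multiplicative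
    relation [M = 1].  They are found degree by degree ([improve]).  If
    [M - 1] lies in [J^n], consider the logarithmic derivative [M^-1 E(M)] for
    the Euler derivation [E]: modulo commutators it is additive in the factors
    of [M], and [1 + a a^star] and [1 + a^star a] contribute the same, so it is a
    sum of commutators ([mprod_logder]).  Its leading term is [n (M - 1)], hence
    in characteristic [0] the leading term of [M - 1] is a sum of commutators,
    which can be written [sum_b [b, delta_b]] over the arrows of the double
    ([error_form]).  Adding [delta_(a^star)] to [a] and [- delta_a] to [a^star]
    cancels it.  The solution defines a homomorphism from the multiplicative
    algebra to the additive one that is the identity to leading order.  It is
    onto by successive approximation ([f_surj]).  It is injective because the
    additive relation [rho] holds in the multiplicative algebra up to longer
    words, so that the associated graded algebra of the multiplicative one is a
    quotient of the additive one ([f_inj]).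

    For the first half the diagram is rooted at its branching vertex.  On an arm
    the relation at a vertex identifies the loops [c c^star] and [b^star b] of
    its two edges up to units, both in the additive and in the multiplicative
    case.  Thus the loop at the root of an arm of length [l] satisfies
    [z^(l+1) = 0] ([arm_nilp]), and a path that turns around on an arm can be
    pushed towards the root ([ann_descend]).  It remains to see that long words
    in the three root loops vanish.  In suitable generators these satisfy
    [x^2 = 0], [y^q = 0] and [d^p = 0] with [d = x + y + kappa x y], where
    [kappa] is [0] in the additive and [1] in the multiplicative case
    ([root_normal_form]).  If [d] kills an element modulo a left ideal, then so
    do all words of length [2] (for [q = 2], type D) or [11] (for [q = 3] and
    [p <= 5], type E), by an explicit computation in a module with two,
    respectively twelve, generators, whose outcome does not depend on [kappa]
    ([dihedral_reach], [icosahedral_reach]).  Filtering by the kernels of the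
    powers of [d] finishes the argument ([words_vanish]). *)

(** * Universal properties *)

Section QuotientMaps.
Variables (k : fieldType) (A : pzAlgType k) (S : A -> Prop).

Lemma quot_pi_eq0 x : quot_pi S x = 0 <-> ideal_gen S x.
Proof.
by rewrite -[0](raddf0 (quot_pi S)) quot_piP subr0.
Qed.

Lemma quot_lift (B : pzAlgType k) (f : {rmorphism A -> B}) :
    alg_morphism f -> (forall x, S x -> f x = 0) ->
  exists2 g : {rmorphism quot_alg S -> B},
    alg_morphism g & forall x, g (quot_pi S x) = f x.
Proof.
move=> fk fS.
have fI x : ideal_gen S x -> f x = 0.
  elim=> {x} [x /fS //||x y _ fx _ fy|a x _ fx|x a _ fx].
  - exact: rmorph0.
  - by rewrite rmorphB fx fy subrr.
  - by rewrite rmorphM fx mulr0.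
  - by rewrite rmorphM fx mul0r.
pose g (u : quot_alg S) := f (repr u).
have gE x : g (quot_pi S x) = f x.
  by apply/eqP; rewrite -subr_eq0 -rmorphB fI //; exact: repr_quot_pi.
have gB : zmod_morphism g.
  move=> u v; have [x <-] := quot_pi_surj u; have [y <-] := quot_pi_surj v.
  by rewrite -rmorphB !gE rmorphB.
have gM : GRing.monoid_morphism g.
  split=> [|u v]; first by rewrite -[1](rmorph1 (quot_pi S)) gE rmorph1.
  have [x <-] := quot_pi_surj u; have [y <-] := quot_pi_surj v.
  by rewrite -rmorphM !gE rmorphM.
pose gz := GRing.isZmodMorphism.Build (quot_alg S) B g gB.
pose gm := GRing.isMonoidMorphism.Build (quot_alg S) B g gM.
pose gr : {rmorphism quot_alg S -> B} := HB.pack g gz gm.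
by exists gr => [c|//]; rewrite -fk -gE.
Qed.

End QuotientMaps.

(** The left module that underlies an algebra: linear extension from paths
    requires a scaling operation on the target. *)
Definition alg_lmod (k : fieldType) (A : pzAlgType k) : Type := A.

Section AlgLmod.
Variables (k : fieldType) (A : pzAlgType k).
HB.instance Definition _ := GRing.Zmodule.on (alg_lmod A).

Definition alg_scale (c : k) (x : alg_lmod A) : alg_lmod A := alg_scalar c * (x : A).

Fact alg_scaleA c d x : alg_scale c (alg_scale d x) = alg_scale (c * d) x.
Proof. by rewrite /alg_scale mulrA -rmorphM. Qed.
Fact alg_scale1 : left_id 1 alg_scale.
Proof. by move=> x; rewrite /alg_scale rmorph1 mul1r. Qed.
Fact alg_scaleDr : right_distributive alg_scale +%R.
Proof. by move=> c x y; rewrite /alg_scale mulrDr. Qed.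
Fact alg_scaleDl x : {morph alg_scale^~ x : c d / c + d}.
Proof. by move=> c d; rewrite /alg_scale rmorphD mulrDl. Qed.

HB.instance Definition _ := GRing.Zmodule_isLmodule.Build k (alg_lmod A)
  alg_scaleA alg_scale1 alg_scaleDr alg_scaleDl.
End AlgLmod.

Section PathAlgebraMaps.
Variables (k : fieldType) (Q : quiver).
Local Notation P := (path_alg k Q).

Lemma scale_scalar c (x : P) : c *: x = alg_scalar c * x.
Proof. by rewrite -path_alg_scalar_mul. Qed.

Lemma path_elt_mul (p q : qpath Q) :
  path_elt k p * path_elt k q = oapp (@path_elt k Q) 0 (path_comp p q).
Proof. exact: path_alg_mul_elt. Qed.

Lemma sum_vertex_idem : \sum_(i : vertex Q) vertex_idem k i = 1 :> P.
Proof. by []. Qed.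

Lemma idem_arrow (a : arrow Q) :
  vertex_idem k (qhead a) * arrow_elt k a = arrow_elt k a.
Proof.
apply: etrans (path_elt_mul (trivial_path _) (arrow_path a)) _.
by rewrite trivial_path_comp eqxx.
Qed.

Lemma arrow_idem (a : arrow Q) :
  arrow_elt k a * vertex_idem k (qtail a) = arrow_elt k a.
Proof.
apply: etrans (path_elt_mul (arrow_path a) (trivial_path _)) _.
by rewrite comp_trivial_path eqxx.
Qed.

Lemma idemM (i j : vertex Q) :
  vertex_idem k i * vertex_idem k j = if i == j then vertex_idem k i else 0.
Proof.
apply: etrans (path_elt_mul (trivial_path _) (trivial_path _)) _.
by rewrite trivial_path_comp /path_target /= eq_sym; case: eqP => [->|].
Qed.

Lemma path_eltE (p : qpath Q) :
  path_elt k p =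
  vertex_idem k (path_target p) * \prod_(a <- path_word p) arrow_elt k a.
Proof.
case: p => -[i w] wP; rewrite /path_target /path_word /=.
elim: w i wP => [|a w IH] i wP /=.
  by rewrite big_nil mulr1; congr path_elt; exact: val_inj.
have /= /andP[/eqP ai wa] := wP; rewrite big_cons mulrA.
apply: esym.
have -> : vertex_idem k i * arrow_elt k a = arrow_elt k a by rewrite -ai idem_arrow.
apply: etrans (congr1 (fun z => z * _) (esym (arrow_idem a))) _.
apply: etrans (esym (mulrA _ _ _)) _.
apply: etrans (congr1 ( *%R (arrow_elt k a)) (esym (IH _ wa))) _.
apply: etrans (path_elt_mul (arrow_path a) (@QPath Q (qtail a, w) wa)) _.
have [|r -> rE] := @path_comp_some _ (arrow_path a) (@QPath Q (qtail a, w) wa).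
  by [].
by congr path_elt; apply: val_inj; rewrite rE /= -ai.
Qed.

Section Lift.
Variables (A : pzAlgType k) (eps : vertex Q -> A) (alpha : arrow Q -> A).
Hypothesis eps_sum : \sum_i eps i = 1.
Hypothesis eps_mul : forall i j, eps i * eps j = if i == j then eps i else 0.
Hypothesis eps_alpha : forall a, eps (qhead a) * alpha a = alpha a.
Hypothesis alpha_eps : forall a, alpha a * eps (qtail a) = alpha a.

Let pval (p : qpath Q) : alg_lmod A :=
  eps (path_target p) * \prod_(a <- path_word p) alpha a.

Let word_eps i w : composable i w ->
  eps i * \prod_(a <- w) alpha a = (\prod_(a <- w) alpha a) * eps (word_source i w)
   :> A \/ w = [::].
Proof.
elim: w i => [|a w IH] i /=; first by right.
move=> /andP[/eqP <- /IH]; case=> [E|->]; left.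
- by rewrite big_cons mulrA eps_alpha -{1}(alpha_eps a) -mulrA E mulrA.
- by rewrite big_seq1 eps_alpha /= alpha_eps.
Qed.

Let word_epsE i w : composable i w ->
  eps i * \prod_(a <- w) alpha a
  = eps i * (\prod_(a <- w) alpha a) * eps (word_source i w).
Proof.
move=> /word_eps[E|->]; last by rewrite big_nil !mulr1 /= eps_mul eqxx.
by rewrite E -!mulrA eps_mul eqxx.
Qed.

Let pval_comp p q :
  oapp pval 0 (path_comp p q) = (pval p : A) * (pval q : A) :> A.
Proof.
rewrite /pval (word_epsE (valP p)) -[word_source _ _]/(path_source p).
rewrite -!mulrA [eps (path_source p) * _]mulrA eps_mul.
have [pq|pq] := path_source p =P path_target q; last first.
  by rewrite /path_comp (negPf (introN eqP pq)) !(mul0r, mulr0).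
have [r -> rE] := path_comp_some pq; rewrite /= /path_target /path_word rE /=.
rewrite big_cat /= !mulrA; congr (_ * _).
by rewrite [RHS]/= -mulrA mulrA -word_epsE //; exact: (valP p).
Qed.

Lemma path_alg_lift : exists f : {rmorphism P -> A},
  [/\ alg_morphism f, forall i, f (vertex_idem k i) = eps i
    & forall a, f (arrow_elt k a) = alpha a].
Proof.
pose f (x : P) : A := lin_ext pval x.
have fD x y : f (x + y) = f x + f y by rewrite /f linearD.
have fZ c x : f (c *: x) = alg_scalar c * f x by rewrite /f linearZ.
have f0 : f 0 = 0 by rewrite /f linear0.
have fE p : f (path_elt k p) = pval p by rewrite /f lin_ext_elt.
have fL c x y : f (c *: x + y) = alg_scalar c * f x + f y.
  by apply: etrans (fD _ _) _; congr (_ + _); exact: fZ.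
(* Both sides of multiplicativity are linear in each factor. *)
have linP (g h : P -> A) :
    (forall c x y, g (c *: x + y) = alg_scalar c * g x + g y) ->
    (forall c x y, h (c *: x + y) = alg_scalar c * h x + h y) ->
    (forall p, g (path_elt k p) = h (path_elt k p)) -> forall x, g x = h x.
  move=> gL hL gh; apply: path_alg_ind => [|c p x IHx].
    have g0 (g' : P -> A) :
        (forall c x y, g' (c *: x + y) = alg_scalar c * g' x + g' y) -> g' 0 = 0.
      move=> L; have := L 1 0 0; rewrite scale1r addr0 rmorph1 mul1r => /esym/eqP.
      by rewrite -subr_eq0 addrK => /eqP.
    by rewrite (g0 g) ?(g0 h).
  by rewrite gL hL IHx gh.
have fM x y : f (path_alg_mul x y) = f x * f y.
  apply: (linP (fun x => f (path_alg_mul x y)) (fun x => f x * f y)) x.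
  - move=> c x z /=; rewrite path_alg_mulDl path_alg_mulZl; exact: fL.
  - by move=> c x z /=; rewrite fL mulrDl mulrA.
  move=> p; apply: (linP (fun y => f (path_alg_mul (path_elt k p) y))
                         (fun y => f (path_elt k p) * f y)) y.
  - move=> c x z /=; rewrite path_alg_mulDr path_alg_mulZr; exact: fL.
  - by move=> c x z /=; rewrite fL mulrDr mulrA -alg_scalarC mulrA.
  move=> q /=; rewrite path_alg_mul_elt !fE -pval_comp.
  by case: (path_comp p q) => [r|] /=; [exact: fE | exact: f0].
have fidem i : f (vertex_idem k i) = eps i.
  by rewrite fE /pval /path_target /path_word /= big_nil mulr1.
have f1 : f 1 = 1.
  rewrite -sum_vertex_idem -eps_sum.
  by rewrite (big_morph f fD f0); apply: eq_bigr.
have fB : zmod_morphism f by move=> x y; apply: (addIr (f y)); rewrite -fD !subrK.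
pose fz := GRing.isZmodMorphism.Build P A f fB.
have fmon : GRing.monoid_morphism f by [].
pose fm := GRing.isMonoidMorphism.Build P A f fmon.
pose fr : {rmorphism P -> A} := HB.pack f fz fm.
exists fr; split=> [c|//|a].
  have -> : alg_scalar c = c *: (1 : P) :> P by [].
  by rewrite [LHS]fZ f1 mulr1.
rewrite [LHS]fE /pval /path_target /path_word /= big_seq1; exact: eps_alpha.
Qed.

End Lift.
End PathAlgebraMaps.

(** * Algebras graded by the length of paths *)

(** What the argument uses of a path algebra: idempotents and arrows whose words
    span, and for every [phi : nat -> nat] the operator [gwt phi] that multiplies
    a word of length [m] by [phi m].  This covers at once the projections onto
    the words of a given length, the truncations and the Euler derivation.
    Working with these abstract data keeps the concrete model of finitely
    supported functions out of sight. *)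
Record path_grading (k : fieldType) (Q : quiver) (P : pzAlgType k) := PathGrading {
  gidem : vertex Q -> P;
  garr : arrow Q -> P;
  gwt : (nat -> nat) -> P -> P;
  gidem_sum : \sum_i gidem i = 1;
  gidemM : forall i j, gidem i * gidem j = if i == j then gidem i else 0;
  gidem_arr : forall a, gidem (qhead a) * garr a = garr a;
  garr_idem : forall a, garr a * gidem (qtail a) = garr a;
  gspan : forall C : P -> Prop, C 0 ->
    (forall c i w x, C x ->
       C (alg_scalar c * (gidem i * \prod_(a <- w) garr a) + x)) ->
    forall x, C x;
  gwt_zmod : forall phi, zmod_morphism (gwt phi);
  gwtE : forall phi c i w,
    gwt phi (alg_scalar c * (gidem i * \prod_(a <- w) garr a))
    = alg_scalar c * (gidem i * \prod_(a <- w) garr a) *+ phi (size w)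
}.

Section PathAlgGrading.
Variables (k : fieldType) (Q : quiver).
Local Notation P := (path_alg k Q).

Lemma idem_arrowN (i : vertex Q) (a : arrow Q) : i != qhead a ->
  vertex_idem k i * arrow_elt k a = 0 :> P.
Proof.
move=> ia; apply: etrans (path_elt_mul k (trivial_path i) (arrow_path a)) _.
by rewrite trivial_path_comp (negPf ia).
Qed.

Lemma word_noncomposable (i : vertex Q) (w : seq (arrow Q)) : ~~ composable i w ->
  vertex_idem k i * \prod_(a <- w) arrow_elt k a = 0 :> P.
Proof.
elim: w i => [//|a w IH] i /=; rewrite negb_and => aw.
rewrite big_cons mulrA.
case: (qhead a =P i) aw => [<- /= aw|/eqP ai _]; last first.
  by rewrite idem_arrowN ?mul0r // eq_sym.
rewrite idem_arrow.
apply: etrans (congr1 (fun z => z * _) (esym (arrow_idem k a))) _.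
apply: etrans (esym (mulrA _ _ _)) _.
by apply: etrans (congr1 ( *%R (arrow_elt k a)) (IH _ aw)) _; exact: mulr0.
Qed.

Definition path_wt (phi : nat -> nat) : P -> P :=
  lin_ext (fun p => path_elt k p *+ phi (size (path_word p))).

Lemma path_wt_zmod phi : zmod_morphism (path_wt phi).
Proof. by move=> x y; exact: (raddfB (lin_ext _)). Qed.

Lemma path_wtE phi c (i : vertex Q) (w : seq (arrow Q)) :
  let x : P := alg_scalar c * (vertex_idem k i * \prod_(a <- w) arrow_elt k a) in
  path_wt phi x = x *+ phi (size w).
Proof.
move=> x; have [iw|/word_noncomposable x0] := boolP (composable i w); last first.
  have -> : x = 0 by rewrite /x x0 mulr0.
  by rewrite mul0rn; exact: linear0 (lin_ext _).
have -> : x = c *: path_elt k (@QPath Q (i, w) iw).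
  by rewrite scale_scalar (path_eltE k (@QPath Q (i, w) iw)).
by rewrite /path_wt linearZ /= lin_ext_elt scalerMnr.
Qed.

Lemma path_alg_span (C : P -> Prop) : C 0 ->
    (forall c i w x, C x ->
       C (alg_scalar c * (vertex_idem k i * \prod_(a <- w) arrow_elt k a) + x)) ->
  forall x, C x.
Proof.
move=> C0 CS; apply: path_alg_ind => // c p x Cx.
by rewrite scale_scalar path_eltE; exact: CS.
Qed.

Definition path_alg_grading : path_grading Q P :=
  PathGrading (sum_vertex_idem k Q) (@idemM k Q) (@idem_arrow k Q)
    (@arrow_idem k Q) path_alg_span path_wt_zmod path_wtE.
End PathAlgGrading.

Section GradingTheory.
Variables (k : fieldType) (Q : quiver) (P : pzAlgType k) (G : path_grading Q P).

Local Notation e := (gidem G).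
Local Notation X := (garr G).
Implicit Types (x y : P) (w : seq (arrow Q)) (phi psi : nat -> nat).

HB.instance Definition _ phi :=
  GRing.isZmodMorphism.Build P P (gwt G phi) (gwt_zmod G phi).

(** The path with target [i] and word [w], or [0] if there is none. *)
Definition gpath i w : P := e i * \prod_(a <- w) X a.

Lemma gpath_nil i : gpath i [::] = e i.
Proof. by rewrite /gpath big_nil mulr1. Qed.

Lemma gpath_arr a : gpath (qhead a) [:: a] = X a.
Proof. by rewrite /gpath big_seq1 gidem_arr. Qed.

Lemma gpath_src i w : gpath i w = gpath i w * e (word_source i w).
Proof.
elim: w i => [|a w IH] i; first by rewrite gpath_nil /= gidemM eqxx.
have -> : gpath i (a :: w) = e i * X a * gpath (qtail a) w.
  by rewrite /gpath big_cons -{1}garr_idem !mulrA.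
by rewrite {1}IH mulrA.
Qed.

Lemma gpathM i w j v :
  gpath i w * gpath j v = if word_source i w == j then gpath i (w ++ v) else 0.
Proof.
have -> : gpath j v = e j * gpath j v by rewrite /gpath mulrA gidemM eqxx.
rewrite {1}gpath_src mulrA -(mulrA (gpath i w)) gidemM.
have [<-|_] := eqVneq; last by rewrite mulr0 mul0r.
rewrite -gpath_src [gpath (word_source _ _) v]/gpath mulrA -gpath_src.
by rewrite /gpath big_cat /= mulrA.
Qed.

Lemma gwt_path phi i w : gwt G phi (gpath i w) = gpath i w *+ phi (size w).
Proof. by have := gwtE G phi 1 i w; rewrite rmorph1 !mul1r. Qed.

Lemma gwt_spath phi c i w :
  gwt G phi (alg_scalar c * gpath i w) = alg_scalar c * gpath i w *+ phi (size w).
Proof. exact: gwtE. Qed.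

Lemma gspan' (C : P -> Prop) : C 0 ->
    (forall c i w x, C x -> C (alg_scalar c * gpath i w + x)) -> forall x, C x.
Proof. exact: (@gspan _ _ _ G). Qed.

Lemma eq_gwt phi psi x : phi =1 psi -> gwt G phi x = gwt G psi x.
Proof.
move=> E; elim/gspan': x => [|c i w x IH]; first by rewrite !raddf0.
by rewrite !raddfD /= IH !gwt_spath E.
Qed.

Lemma gwt_scalar phi c x : gwt G phi (alg_scalar c * x) = alg_scalar c * gwt G phi x.
Proof.
elim/gspan': x => [|d i w x IH]; first by rewrite mulr0 raddf0 mulr0.
rewrite mulrDr !raddfD /= mulrDr IH [_ * (_ * gpath _ _)]mulrA -rmorphM.
by rewrite !gwt_spath rmorphM mulrnAr mulrA.
Qed.

Lemma gwt_comp phi psi x :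
  gwt G phi (gwt G psi x) = gwt G (fun m => phi m * psi m)%N x.
Proof.
elim/gspan': x => [|c i w x IH]; first by rewrite !raddf0.
by rewrite !raddfD /= IH !gwt_spath raddfMn /= gwt_spath mulrnA.
Qed.

Lemma gwt1 x : gwt G (fun=> 1%N) x = x.
Proof.
by elim/gspan': x => [|c i w x IH]; rewrite ?raddf0 // raddfD /= IH gwt_spath.
Qed.

Lemma gwt0 x : gwt G (fun=> 0%N) x = 0.
Proof.
elim/gspan': x => [|c i w x IH]; rewrite ?raddf0 // raddfD /= IH gwt_spath.
by rewrite mulr0n addr0.
Qed.

Lemma gwtD phi psi x : gwt G (fun m => phi m + psi m)%N x = gwt G phi x + gwt G psi x.
Proof.
elim/gspan': x => [|c i w x IH]; first by rewrite !raddf0 addr0.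
by rewrite !raddfD /= IH !gwt_spath mulrnDr addrACA.
Qed.

Lemma gwtMn phi n x : gwt G (fun m => phi m * n)%N x = gwt G phi x *+ n.
Proof.
elim/gspan': x => [|c i w x IH]; first by rewrite !raddf0 mul0rn.
by rewrite !raddfD /= IH !gwt_spath mulrnDl mulrnA.
Qed.

Lemma gwt_pathl phi i w x :
  gwt G phi (gpath i w * x) = gpath i w * gwt G (fun m => phi (size w + m)%N) x.
Proof.
elim/gspan': x => [|c j v x IH]; first by rewrite mulr0 !raddf0 mulr0.
rewrite mulrDr !raddfD /= mulrDr IH; congr (_ + _).
rewrite [LHS](_ : _ = alg_scalar c * gwt G phi (gpath i w * gpath j v)); last first.
  by rewrite mulrA -alg_scalarC -mulrA gwt_scalar.
rewrite gwt_scalar [RHS]mulrA -alg_scalarC -[RHS]mulrA.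
congr (_ * _).
rewrite gwt_path mulrnAr gpathM; case: eqP => _; last by rewrite raddf0 mul0rn.
by rewrite gwt_path size_cat.
Qed.

Lemma gwt_pathr phi i w x :
  gwt G phi (x * gpath i w) = gwt G (fun m => phi (m + size w)%N) x * gpath i w.
Proof.
elim/gspan': x => [|c j v x IH]; first by rewrite mul0r !raddf0 mul0r.
rewrite mulrDl !raddfD /= mulrDl IH; congr (_ + _).
rewrite -mulrA !gwt_scalar -mulrA; congr (_ * _).
rewrite gwt_path mulrnAl gpathM; case: eqP => _; last by rewrite raddf0 mul0rn.
by rewrite gwt_path size_cat.
Qed.

Definition geuler := gwt G id.
HB.instance Definition _ := GRing.Additive.on geuler.

Lemma geulerM x y : geuler (x * y) = geuler x * y + x * geuler y.
Proof.
elim/gspan': x => [|c i w x IH]; first by rewrite mul0r !raddf0 !mul0r addr0.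
rewrite mulrDl !raddfD /= IH !mulrDl [RHS]addrACA; congr (_ + _).
rewrite -[alg_scalar c * gpath i w * y]mulrA /geuler !gwt_scalar.
rewrite -[X in _ = X + _]mulrA -[X in _ = _ + X]mulrA -mulrDr; congr (_ * _).
rewrite gwt_pathl gwt_path gwtD mulrDr mulrnAl; congr (_ + _).
rewrite -mulrnAr -[in RHS](gwt1 y) -gwtMn; congr (_ * _).
by apply: eq_gwt => m; rewrite mul1n.
Qed.

(** Only words of length at least [n] occur in [x]. *)
Definition gord n x := gwt G (fun m => n <= m : nat)%N x = x.

Lemma gord_gwt n phi x : gord n x -> gord n (gwt G phi x).
Proof.
move=> xn; rewrite /gord -{2}xn !gwt_comp; apply: eq_gwt => m; exact: mulnC.
Qed.

Lemma gord_span n (C : P -> Prop) : C 0 ->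
    (forall c i w x, (n <= size w)%N -> C x -> C (alg_scalar c * gpath i w + x)) ->
  forall x, gord n x -> C x.
Proof.
move=> C0 CS x <-; elim/gspan': x => [|c i w x IH]; first by rewrite raddf0.
rewrite raddfD /= gwt_spath; case: leqP => nw; first by rewrite mulr1n; exact: CS.
by rewrite mulr0n add0r.
Qed.

Lemma gord_path n c i w : (n <= size w)%N -> gord n (alg_scalar c * gpath i w).
Proof. by move=> nw; rewrite /gord gwt_spath nw. Qed.

Lemma gord_any x : gord 0 x.
Proof. by rewrite /gord -[RHS]gwt1; exact: eq_gwt. Qed.

Lemma gord0 n : gord n 0.
Proof. exact: raddf0. Qed.

Lemma gordB n x y : gord n x -> gord n y -> gord n (x - y).
Proof. by move=> xn yn; rewrite /gord raddfB /= xn yn. Qed.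

Lemma gordD n x y : gord n x -> gord n y -> gord n (x + y).
Proof. by move=> xn yn; rewrite /gord raddfD /= xn yn. Qed.

Lemma gord_le m n x : (m <= n)%N -> gord n x -> gord m x.
Proof.
move=> mn xn; rewrite /gord -xn gwt_comp; apply: eq_gwt => l.
case: (leqP n l) => nl; last by rewrite muln0.
by rewrite (leq_trans mn nl).
Qed.

Lemma gordM m n x y : gord m x -> gord n y -> gord (m + n) (x * y).
Proof.
move=> xm yn; elim/gord_span: xm => [|c i w {}x mw IH].
  by rewrite mul0r; exact: gord0.
rewrite mulrDl; apply: gordD => // {IH}; rewrite -mulrA /gord gwt_scalar; congr (_ * _).
rewrite gwt_pathl; congr (_ * _).
rewrite -{2}yn -[in LHS]yn gwt_comp; apply: eq_gwt => l.
by case: (leqP n l) => nl; rewrite ?muln0 // leq_add.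
Qed.

End GradingTheory.

(** * Filtrations and inverses *)

Section Filtration.
Variables (k : fieldType) (Q : quiver) (P : pzAlgType k) (G : path_grading Q P).
Variables (A : pzAlgType k) (h : {rmorphism P -> A}).

(** When [h] is onto, the [n]-th power of the ideal of [A] generated by the
    arrows. *)
Definition Jf n (u : A) := exists2 x, gord G n x & h x = u.

Lemma Jf0 n : Jf n 0.
Proof. by exists 0; [exact: gord0 | exact: rmorph0]. Qed.

Lemma JfB n u v : Jf n u -> Jf n v -> Jf n (u - v).
Proof.
move=> [x xn <-] [y yn <-]; exists (x - y); [exact: gordB | exact: rmorphB].
Qed.

Lemma JfN n u : Jf n u -> Jf n (- u).
Proof. by move=> un; rewrite -sub0r; apply: JfB => //; exact: Jf0. Qed.

Lemma JfD n u v : Jf n u -> Jf n v -> Jf n (u + v).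
Proof. by move=> un vn; rewrite -[v]opprK; apply: JfB => //; exact: JfN. Qed.

Lemma Jf_le m n u : (m <= n)%N -> Jf n u -> Jf m u.
Proof. by move=> mn [x xn <-]; exists x => //; exact: gord_le xn. Qed.

Lemma JfM m n u v : Jf m u -> Jf n v -> Jf (m + n) (u * v).
Proof.
move=> [x xn <-] [y yn <-]; exists (x * y); [exact: gordM | exact: rmorphM].
Qed.

Lemma JfX n u : Jf 1 u -> Jf n (u ^+ n).
Proof.
move=> u1; elim: n => [|n IH].
  by rewrite expr0; exists 1; [exact: gord_any | exact: rmorph1].
by rewrite exprS; exact: (JfM u1 IH).
Qed.

Lemma Jf_sum n (T : Type) (s : seq T) (p : pred T) (F : T -> A) :
  (forall i, p i -> Jf n (F i)) -> Jf n (\sum_(i <- s | p i) F i).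
Proof. by move=> Fn; elim/big_ind: _ => //; [exact: Jf0 | exact: JfD]. Qed.

Lemma Jf_im x : Jf 0 (h x).
Proof. by exists x => //; exact: gord_any. Qed.

Lemma Jf_arr a : Jf 1 (h (garr G a)).
Proof.
exists (garr G a) => //; rewrite -gpath_arr -[gpath _ _ _]mul1r.
by rewrite -(rmorph1 (@alg_scalar k P)); exact: gord_path.
Qed.

Lemma JfMl n u v : (forall a, Jf 0 a) -> Jf n u -> Jf n (v * u).
Proof. by move=> hs un; exact: (JfM (hs v) un). Qed.

Lemma JfMr n u v : (forall a, Jf 0 a) -> Jf n u -> Jf n (u * v).
Proof. by move=> hs un; rewrite -(addn0 n); exact: (JfM un (hs v)). Qed.

End Filtration.

Section GeometricInverse.
Variable R : pzRingType.
Implicit Types x : R.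

(** The inverse of [1 + x] when [x ^+ n = 0]. *)
Definition geo n x : R := \sum_(i < n) (- x) ^+ i.

Lemma geoS n x : geo n.+1 x = 1 + (- x) * geo n x.
Proof.
rewrite /geo big_ord_recl expr0; congr (_ + _); rewrite mulr_sumr.
by apply: eq_bigr => i _; rewrite -exprS.
Qed.

Lemma geo_mul n x : (1 + x) * geo n x = 1 - (- x) ^+ n.
Proof.
elim: n => [|n IH]; first by rewrite /geo big_ord0 mulr0 expr0 subrr.
rewrite /geo big_ord_recr mulrDr -/(geo n x) IH /= mulrDl mul1r exprS mulNr.
by rewrite addrA subrK opprK.
Qed.

Lemma geo_comm n x : geo n x * (1 + x) = (1 + x) * geo n x.
Proof.
rewrite /geo mulr_suml mulr_sumr; apply: eq_bigr => i _.
apply: commr_sym; apply: commrX; apply: commrN.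
by rewrite /GRing.comm mulrDl mulrDr mul1r mulr1.
Qed.

Lemma geoV n x : x ^+ n = 0 -> (1 + x) * geo n x = 1 /\ geo n x * (1 + x) = 1.
Proof.
move=> xn; have E : (1 + x) * geo n x = 1.
  by rewrite geo_mul exprNn xn mulr0 subr0.
by rewrite geo_comm.
Qed.

Lemma invl_uniq (g u v : R) : u * g = 1 -> g * v = 1 -> u = v.
Proof. by move=> ug gv; rewrite -[u]mulr1 -gv mulrA ug mul1r. Qed.

End GeometricInverse.

(** * Logarithmic derivatives modulo commutators *)

Section LogDerivative.
Variables (R : pzRingType) (E : {additive R -> R}) (K : R -> Prop).
Hypothesis EM : forall x y, E (x * y) = E x * y + x * E y.
Hypothesis K0 : K 0.
Hypothesis KD : forall x y, K x -> K y -> K (x + y).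
Hypothesis Kcomm : forall x y, K (x * y - y * x).

Lemma derivation1 : E 1 = 0.
Proof.
have := EM 1 1; rewrite !mulr1 mul1r => /eqP.
by rewrite -subr_eq0 opprD addrA subrr sub0r oppr_eq0 => /eqP.
Qed.

(** [d log] turns products into sums, up to the commutator
    [h^-1 (g^-1 E g) h - g^-1 E g]. *)
Lemma logder_prod (T : Type) (s : seq T) (g g' : T -> R) :
    (forall b, g' b * g b = 1 /\ g b * g' b = 1) ->
  exists M', [/\ M' * (\prod_(b <- s) g b) = 1, (\prod_(b <- s) g b) * M' = 1
    & K (M' * E (\prod_(b <- s) g b) - \sum_(b <- s) g' b * E (g b))].
Proof.
move=> gV; elim: s => [|b s [M' [M'l M'r KM]]].
  by exists 1; rewrite !big_nil derivation1 mulr0 subr0 mulr1.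
have [gl gr] := gV b; rewrite !big_cons; set M := \prod_(j <- s) g j in M'l M'r KM *.
exists (M' * g' b); split.
- by rewrite mulrA -(mulrA M') gl mulr1.
- by rewrite mulrA -(mulrA (g b)) M'r mulr1.
rewrite EM mulrDr; set z := g' b * E (g b).
have -> : M' * g' b * (E (g b) * M) = M' * (z * M) by rewrite /z !mulrA.
have -> : M' * g' b * (g b * E M) = M' * E M by rewrite mulrA -(mulrA M') gl mulr1.
rewrite opprD addrACA; apply: KD => //.
have {2}-> : z = z * M * M' by rewrite -mulrA M'r mulr1.
exact: Kcomm.
Qed.

(** As [v] is the inverse of [1 + b a], the second summand is minus the
    logarithmic derivative of [1 + b a], with the factors in the other order.
    Since [u a = a v] and [b u = v b], moving a factor around cyclically turns
    one logarithmic derivative into the other. *)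
Lemma logder_swap a b u v :
    (1 + a * b) * u = 1 -> u * (1 + a * b) = 1 ->
    (1 + b * a) * v = 1 -> v * (1 + b * a) = 1 ->
  K (u * E (1 + a * b) + (1 + b * a) * E v).
Proof.
move=> ur ul vr vl.
have uav : u * a = a * v.
  have E1 : (1 + a * b) * a = a * (1 + b * a).
    by rewrite mulrDl mulrDr mul1r mulr1 mulrA.
  by rewrite -[u * a]mulr1 -vr mulrA -(mulrA u) -E1 mulrA ul mul1r.
have bu : b * u = v * b.
  have E1 : (1 + b * a) * b = b * (1 + a * b).
    by rewrite mulrDl mulrDr mul1r mulr1 mulrA.
  by rewrite -[b * u]mul1r -vl -mulrA (mulrA _ b) E1 -(mulrA b) ur mulr1.
have -> : (1 + b * a) * E v = - (E (b * a) * v).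
  apply/eqP; rewrite -addr_eq0 addrC; apply/eqP.
  have := EM (1 + b * a) v; rewrite vr derivation1 raddfD derivation1 add0r.
  by move/esym.
rewrite raddfD derivation1 add0r !EM mulrDr mulrDl opprD.
rewrite [- _ - _]addrC addrACA; apply: KD.
  have := KD (Kcomm (u * E a) b) (Kcomm v (b * E a)).
  by rewrite (mulrA b) bu -(mulrA v) addrA subrK -(mulrA u).
by rewrite mulrA uav -(mulrA (E b)); exact: Kcomm.
Qed.

End LogDerivative.

(** * The cyclic part of an algebra generated by arrows *)

Section Commutators.
Variables (k : fieldType) (Q : quiver) (P : pzAlgType k) (G : path_grading Q P).
Variables (A : pzAlgType k) (h : {rmorphism P -> A}).
Hypotheses (hk : alg_morphism h) (hsurj : forall u, exists x, h x = u).

Local Notation e i := (h (gidem G i)).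
Local Notation X a := (h (garr G a)).

Definition diag_part (u : A) : A := \sum_i e i * u * e i.

(** A sum of commutators can be brought to the form [\sum_b [b, delta_b]], with
    [delta_b] running opposite to [b], up to a part off the diagonal. *)
Definition arrow_commutators (u : A) := exists2 delta : arrow Q -> A,
  forall a, e (qtail a) * delta a * e (qhead a) = delta a
  & diag_part u = \sum_a (X a * delta a - delta a * X a).

Local Notation K := arrow_commutators.

Lemma him_sum : \sum_i e i = 1.
Proof. by rewrite -rmorph_sum gidem_sum rmorph1. Qed.

Lemma himM i j : e i * e j = if i == j then e i else 0.
Proof. by rewrite -rmorphM gidemM; case: eqP => // _; exact: rmorph0. Qed.

Lemma him_arr a : e (qhead a) * X a = X a.
Proof. by rewrite -rmorphM gidem_arr. Qed.

Lemma harr_im a : X a * e (qtail a) = X a.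
Proof. by rewrite -rmorphM garr_idem. Qed.

Lemma him_arrN i a : i != qhead a -> e i * X a = 0.
Proof. by move=> ia; rewrite -him_arr mulrA himM (negPf ia) mul0r. Qed.

Lemma harr_imN i a : i != qtail a -> X a * e i = 0.
Proof. by move=> ia; rewrite -harr_im -mulrA himM eq_sym (negPf ia) mulr0. Qed.

Lemma diag_partB u v : diag_part (u - v) = diag_part u - diag_part v.
Proof. by rewrite /diag_part -sumrB; apply: eq_bigr => i _; rewrite mulrBr mulrBl. Qed.
HB.instance Definition _ := GRing.isZmodMorphism.Build A A diag_part diag_partB.

Lemma diag_part_scalar c u : diag_part (alg_scalar c * u) = alg_scalar c * diag_part u.
Proof.
rewrite /diag_part mulr_sumr; apply: eq_bigr => i _.
by rewrite (mulrA (e i)) -alg_scalarC !mulrA.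
Qed.

Lemma diag_part_arrl a u : diag_part (X a * u) = X a * (e (qtail a) * u * e (qhead a)).
Proof.
rewrite /diag_part (bigD1 (qhead a)) //= big1 ?addr0 => [|i ia].
  by rewrite !mulrA him_arr harr_im.
by rewrite mulrA him_arrN // !mul0r.
Qed.

Lemma diag_part_arrr a u : diag_part (u * X a) = (e (qtail a) * u * e (qhead a)) * X a.
Proof.
rewrite /diag_part (bigD1 (qtail a)) //= big1 ?addr0 => [|i ia].
  by rewrite -!mulrA him_arr harr_im.
by rewrite -!mulrA harr_imN // !mulr0.
Qed.

Lemma arrow_commutators0 : K 0.
Proof.
exists (fun=> 0) => [a|]; first by rewrite mulr0 mul0r.
by rewrite raddf0 big1 // => a _; rewrite mulr0 mul0r subrr.
Qed.

Lemma arrow_commutatorsD u v : K u -> K v -> K (u + v).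
Proof.
move=> [d dP ud] [d' dP' vd]; exists (fun a => d a + d' a) => [a|].
  by rewrite mulrDr mulrDl dP dP'.
rewrite raddfD /= ud vd -big_split /=; apply: eq_bigr => a _.
by rewrite mulrDr mulrDl opprD addrACA.
Qed.

Lemma arrow_commutatorsZ c u : K u -> K (alg_scalar c * u).
Proof.
move=> [d dP ud]; exists (fun a => alg_scalar c * d a) => [a|].
  by rewrite mulrA -alg_scalarC -!mulrA (mulrA (e _)) dP.
rewrite diag_part_scalar ud mulr_sumr; apply: eq_bigr => a _.
by rewrite mulrBr !mulrA -alg_scalarC.
Qed.

Lemma arrow_commutators_arr a u : K (X a * u - u * X a).
Proof.
pose d := e (qtail a) * u * e (qhead a).
exists (fun b => if b == a then d else 0) => [b|].
  case: eqP => [->|_]; last by rewrite mulr0 mul0r.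
  by rewrite /d !mulrA himM eqxx -!mulrA himM eqxx.
rewrite raddfB /= diag_part_arrl diag_part_arrr -/d.
rewrite (bigD1 a) //= eqxx big1 ?addr0 // => b /negPf->.
by rewrite mulr0 mul0r subrr.
Qed.

Lemma arrow_commutators_idem i u : K (e i * u - u * e i).
Proof.
exists (fun=> 0) => [a|]; first by rewrite mulr0 mul0r.
rewrite [RHS]big1 => [|a _]; last by rewrite mulr0 mul0r subrr.
rewrite /diag_part big1 // => j _; rewrite mulrBr mulrBl.
rewrite !mulrA himM -[_ * e i * e j]mulrA himM.
case: (j =P i) => [->|/eqP ji]; rewrite ?eqxx ?subrr // eq_sym (negPf ji).
by rewrite mulr0 !mul0r subrr.
Qed.

(** By [[b w, u] = [b, w u] + [w, u b]], commutators with words reduce to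
    commutators with arrows. *)
Lemma arrow_commutators_comm u v : K (u * v - v * u).
Proof.
have mulK w z : (forall t, K (w * t - t * w)) -> (forall t, K (z * t - t * z)) ->
    forall t, K (w * z * t - t * (w * z)).
  move=> Kw Kz t; have := arrow_commutatorsD (Kw (z * t)) (Kz (t * w)).
  by rewrite !mulrA addrA subrK.
have [x <-] := hsurj u; elim/(gspan' (G := G)): x v => [|c i w x IH] v.
  by rewrite rmorph0 mul0r mulr0 subrr; exact: arrow_commutators0.
rewrite rmorphD rmorphM hk mulrDl mulrDr opprD addrACA; apply: arrow_commutatorsD => //.
rewrite -mulrA (mulrA v) -alg_scalarC -mulrA -mulrBr; apply: arrow_commutatorsZ.
rewrite /gpath rmorphM; apply: (mulK _ _) => [t|]; first exact: arrow_commutators_idem.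
rewrite rmorph_prod; elim: w => [|a w IHw] t.
  by rewrite big_nil mul1r mulr1 subrr; exact: arrow_commutators0.
by rewrite big_cons; apply: (mulK _ _) => // s; exact: arrow_commutators_arr.
Qed.

End Commutators.

(** * The multiplicative moment map *)

Section MomentMap.
Variables (k : fieldType) (Q : quiver) (P : pzAlgType k).
Variables (G : path_grading (double_quiver Q) P).
Variables (A : pzAlgType k) (h : {rmorphism P -> A}) (N : nat).
Hypotheses (hs : forall u, Jf G h 0 u) (nil : forall u, Jf G h N.+1 u -> u = 0).

Local Notation J := (Jf G h).
Local Notation darrow := (arrow (double_quiver Q)).
Implicit Types (beta : darrow -> A) (b : darrow).

Definition loop_at beta b : A := beta b * beta (qstar b).

(** The factor [(1 + b b^star)^epsilon(b)], the inverse being a geometric sum. *)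
Definition mfac beta b : A :=
  match b with inl _ => 1 + loop_at beta b | inr _ => geo N.+1 (loop_at beta b) end.
Definition mfac_inv beta b : A :=
  match b with inl _ => geo N.+1 (loop_at beta b) | inr _ => 1 + loop_at beta b end.

Definition signed b (u : A) : A := match b with inl _ => u | inr _ => - u end.

Lemma J_inv g g' : J 1 (g - 1) -> g' * g = 1 -> J 1 (g' - 1).
Proof.
move=> g1 gV; have -> : g' - 1 = - (g' * (g - 1)) by rewrite mulrBr gV mulr1 opprB.
by apply: JfN; exact: JfMl.
Qed.

Lemma J_nilp u : J 1 u -> u ^+ N.+1 = 0.
Proof. by move=> /(JfX N.+1)/nil. Qed.

Section Factors.
Variable beta : darrow -> A.
Hypothesis beta1 : forall b, J 1 (beta b).

Lemma J_loop b : J 2 (loop_at beta b).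
Proof. exact: JfM (beta1 b) (beta1 _). Qed.

Lemma loopV b : (1 + loop_at beta b) * geo N.+1 (loop_at beta b) = 1 /\
  geo N.+1 (loop_at beta b) * (1 + loop_at beta b) = 1.
Proof. by apply: geoV; apply: J_nilp; apply: Jf_le (J_loop b). Qed.

Lemma mfacV b : mfac_inv beta b * mfac beta b = 1 /\ mfac beta b * mfac_inv beta b = 1.
Proof. by case: b (loopV b) => a [l r]. Qed.

Lemma J_loop1 b : J 1 (1 + loop_at beta b - 1).
Proof. by rewrite addrC addKr; apply: Jf_le (J_loop b). Qed.

Lemma J_mfac b : J 1 (mfac beta b - 1).
Proof.
case: b (J_loop1 b) (loopV b) => a //= a1 [_ gV]; exact: J_inv gV.
Qed.

End Factors.

Lemma inv_approx n g g' f f' :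
    J 1 (g - 1) -> J 1 (f - 1) -> g' * g = 1 -> g * g' = 1 -> f * f' = 1 ->
    f' * f = 1 -> J n (g - f) ->
  J n.+1 (g' - f' + (g - f)).
Proof.
move=> g1 f1 gl gr fr fl gf.
have -> : g' - f' = - (g' * (g - f) * f').
  by rewrite mulrBr mulrBl gl mul1r -mulrA fr mulr1 opprB.
move: (g - f) gf => c gf.
have -> : - (g' * c * f') + c = - ((g' - 1) * c * f') - c * (f' - 1).
  rewrite !mulrBl mul1r mulrBr mulr1 !opprB [RHS]addrC subrKA.
  exact: addrC.
apply: JfB; first apply: JfN.
  by apply: JfMr => //; exact: (JfM (J_inv g1 gl) gf).
by rewrite -addn1; apply: (JfM gf); exact: J_inv f1 fl.
Qed.

(** For the inverse factors this is [g^-1 - f^-1 = - g^-1 (g - f) f^-1],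
    whose outer factors are [1] modulo the arrows. *)
Lemma mfac_approx n beta beta' b :
    (forall b, J 1 (beta b)) -> (forall b, J 1 (beta' b)) ->
    J n (loop_at beta' b - loop_at beta b) ->
  J n.+1 (mfac beta' b - mfac beta b
          - signed b (loop_at beta' b - loop_at beta b)).
Proof.
move=> b1 b1'; have [l r] := loopV b1 b; have [l' r'] := loopV b1' b.
have a1 := J_loop1 b1 b; have a1' := J_loop1 b1' b.
case: b l r l' r' a1 a1' => a l r l' r' a1 a1' ab /=.
  by rewrite [1 + _]addrC addrKA subrr; exact: Jf0.
rewrite opprK; have := @inv_approx n _ _ _ _ a1' a1 r' l' l r.
rewrite [1 + _]addrC addrKA; exact.
Qed.

Lemma prod_approx n (T : Type) (s : seq T) (f f' c : T -> A) :
    (forall i, J 1 (f i - 1)) -> (forall i, J 1 (f' i - 1)) ->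
    (forall i, J n (c i)) -> (forall i, J n.+1 (f' i - f i - c i)) ->
  J n.+1 (\prod_(b <- s) f' b - \prod_(b <- s) f b - \sum_(b <- s) c b).
Proof.
move=> f1 f1' cn ffc.
have prod1 r : J 1 (\prod_(b <- r) f' b - 1).
  elim: r => [|b r IH]; first by rewrite big_nil subrr; exact: Jf0.
  rewrite big_cons -[_ * _ - 1](subrKA (\prod_(j <- r) f' j)); apply: JfD => //.
  by rewrite -[X in _ - X]mul1r -mulrBl; exact: JfMr.
elim: s => [|b s IH]; first by rewrite !big_nil !subrr; exact: Jf0.
rewrite !big_cons; set F' := \prod_(j <- s) _ in IH *.
set F := \prod_(j <- s) _ in IH *; set C := \sum_(j <- s) _ in IH *.
have Cn : J n C by apply: Jf_sum.
have -> : f' b * F' - f b * F - (c b + C)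
    = (f' b - f b - c b) * F' + f b * (F' - F - C)
      + (c b * (F' - 1) + (f b - 1) * C).
  rewrite !mulrBl !mulrBr mulr1 mul1r.
  set p := f' b * F'; set q := f b * F'; set r := c b * F'.
  rewrite [RHS](AC (3*3*(2*2)) ((1*5)*(8*10)*((2*4)*(3*7)*(6*9)))).
  by rewrite /= !addNr !addr0 opprD.
apply: JfD; first exact: (JfD (JfMr _ hs (ffc b)) (JfMl _ hs IH)).
apply: JfD; first by rewrite -addn1; exact: (JfM (cn b) (prod1 s)).
exact: (JfM (f1 b) Cn).
Qed.

Lemma mprod_approx n beta beta' (s : seq darrow) :
    (forall b, J 1 (beta b)) -> (forall b, J 1 (beta' b)) ->
    (forall b, J n (loop_at beta' b - loop_at beta b)) ->
  J n.+1 (\prod_(b <- s) mfac beta' b - \prod_(b <- s) mfac beta b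
          - \sum_(b <- s) signed b (loop_at beta' b - loop_at beta b)).
Proof.
move=> b1 b1' bn; apply: prod_approx.
- by move=> b; exact: J_mfac.
- by move=> b; exact: J_mfac.
- by case=> a; rewrite /=; [|apply: JfN]; exact: bn.
- by move=> b; exact: mfac_approx.
Qed.

Lemma signed_sum (s : seq darrow) (F : darrow -> A) : perm_eq s (enum darrow) ->
  \sum_(b <- s) signed b (F b) = \sum_(a : arrow Q) (F (inl a) - F (inr a)).
Proof.
by move=> hs'; rewrite (perm_big _ hs') big_enum big_sumType /= sumrN sumrB.
Qed.

Definition harr b : A := h (garr G b).

(** The first-order comparison with the family [0], all of whose factors are
    [1]: the multiplicative relation starts with the additive one. *)
Lemma mprod_arrows (s : seq darrow) : perm_eq s (enum darrow) ->
  J 3 (\prod_(b <- s) mfac harr b - 1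
       - \sum_(a : arrow Q) (loop_at harr (inl a) - loop_at harr (inr a))).
Proof.
move=> hs'; pose o : darrow -> A := fun=> 0.
have o1 b : J 1 (o b) by exact: Jf0.
have x1 b : J 1 (harr b) by exact: Jf_arr.
have o0 b : loop_at o b = 0 by exact: mulr0.
have := @mprod_approx 2 o harr s o1 x1.
have -> : \prod_(b <- s) mfac o b = 1.
  rewrite big1 // => b _; have := loopV o1 b.
  by case: b => a; rewrite /mfac o0 ?addr0 // mul1r; case.
rewrite [X in _ - X](eq_bigr (fun b => signed b (loop_at harr b))) => [|b _];
  last by rewrite o0 subr0.
by rewrite signed_sum //; apply=> b; rewrite o0 subr0; exact: J_loop.
Qed.

End MomentMap.

(** * Solving the multiplicative relation in the additive algebra *)

Section AdditiveRelation.
Variables (k : fieldType) (Q : quiver) (P : pzAlgType k).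
Variables (G : path_grading (double_quiver Q) P).

Definition additive_rel : P :=
  \sum_(a : arrow Q) (garr G (inl a) * garr G (inr a) - garr G (inr a) * garr G (inl a)).

Local Notation S := (fun x : P => x = additive_rel).

Lemma gwt_additive_rel phi : gwt G phi additive_rel = additive_rel *+ phi 2.
Proof.
have gwt2 b c : gwt G phi (garr G b * garr G c) = garr G b * garr G c *+ phi 2.
  rewrite -!gpath_arr gpathM; case: eqP => _; last by rewrite raddf0 mul0rn.
  by rewrite gwt_path.
rewrite /additive_rel raddf_sum -sumrMnl; apply: eq_bigr => a _.
by rewrite raddfB /= !gwt2 mulrnBl.
Qed.

(** The additive relation being homogeneous, so is its ideal. *)
Lemma gwt_ideal phi x : ideal_gen S x -> ideal_gen S (gwt G phi x).
Proof.
have IMn y n : ideal_gen S y -> ideal_gen S (y *+ n).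
  move=> Iy; elim: n => [|n IH]; first by rewrite mulr0n; exact: ideal_gen0.
  by rewrite mulrS; exact: ideal_genD.
move=> Ix; elim: Ix phi => {x} [x ->|| x y _ IHx _ IHy|a x _ IH|x a _ IH] phi.
- by rewrite gwt_additive_rel; apply: IMn; exact: ideal_gen_in.
- by rewrite raddf0; exact: ideal_gen0.
- by rewrite raddfB; apply: ideal_genB; [exact: IHx | exact: IHy].
- elim/(gspan' (G := G)): a => [|c i w a IHa].
    by rewrite mul0r raddf0; exact: ideal_gen0.
  rewrite mulrDl raddfD; apply: ideal_genD => //=.
  rewrite -mulrA gwt_scalar gwt_pathl mulrA; apply: ideal_genMl; exact: IH.
- elim/(gspan' (G := G)): a => [|c i w a IHa].
    by rewrite mulr0 raddf0; exact: ideal_gen0.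
  rewrite mulrDr raddfD; apply: ideal_genD => //=.
  rewrite mulrA -alg_scalarC -mulrA gwt_scalar gwt_pathr; apply: ideal_genMl.
  apply: ideal_genMr; exact: IH.
Qed.

Variables (A : pzAlgType k) (pi : {rmorphism P -> A}).
Hypotheses (pi_scalar : alg_morphism pi) (pi_surj : forall u, exists y, pi y = u).
Hypothesis pi_ker : forall y, pi y = 0 <-> ideal_gen S y.

Local Notation J := (Jf G pi).
Local Notation darrow := (arrow (double_quiver Q)).
Local Notation x := (harr G pi).
Local Notation e i := (pi (gidem G i)).

(** By homogeneity the operators [gwt phi] pass to the quotient. *)
Definition qwt phi (u : A) : A := pi (gwt G phi (projT1 (cid (pi_surj u)))).

Lemma qwtE phi y : qwt phi (pi y) = pi (gwt G phi y).
Proof.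
rewrite /qwt; case: cid => z /= zy; apply/eqP; rewrite -subr_eq0 -rmorphB -raddfB.
by apply/eqP/pi_ker/gwt_ideal/pi_ker; rewrite rmorphB zy subrr.
Qed.

Lemma qwt_zmod phi : zmod_morphism (qwt phi).
Proof.
move=> u v; have [y <-] := pi_surj u; have [z <-] := pi_surj v.
by rewrite -rmorphB !qwtE raddfB rmorphB.
Qed.
HB.instance Definition _ phi := GRing.isZmodMorphism.Build A A (qwt phi) (qwt_zmod phi).

Lemma pi_J0 u : J 0 u.
Proof. by have [y <-] := pi_surj u; exact: Jf_im. Qed.

Lemma qwt_arrl phi b u : qwt phi (x b * u) = x b * qwt (fun m => phi m.+1) u.
Proof.
have [y <-] := pi_surj u.
by rewrite qwtE -rmorphM qwtE -rmorphM -gpath_arr gwt_pathl.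
Qed.

Lemma qwt_arrr phi b u : qwt phi (u * x b) = qwt (fun m => phi m.+1) u * x b.
Proof.
have [y <-] := pi_surj u.
rewrite qwtE -rmorphM qwtE -rmorphM -gpath_arr gwt_pathr; congr (pi (_ * _)).
by apply: eq_gwt => m; rewrite addn1.
Qed.

Lemma qwt_idem phi i j u : qwt phi (e i * u * e j) = e i * qwt phi u * e j.
Proof.
have [y <-] := pi_surj u.
rewrite [in RHS]qwtE -!rmorphM qwtE -!(gpath_nil G) gwt_pathr gwt_pathl.
by congr (pi (_ * _ * _)); apply: eq_gwt => m; rewrite addn0.
Qed.

Lemma qwt_derivation u v : qwt id (u * v) = qwt id u * v + u * qwt id v.
Proof.
have [y <-] := pi_surj u; have [z <-] := pi_surj v.
by rewrite -rmorphM !qwtE [gwt G id (y * z)]geulerM rmorphD !rmorphM.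
Qed.

Lemma qwt_J n phi u : J n u -> J n (qwt phi u).
Proof. by move=> [y yn <-]; rewrite qwtE; exists (gwt G phi y) => //; exact: gord_gwt. Qed.

Lemma qwt_J0 n phi u : J n u -> (forall m, (n <= m)%N -> phi m = 0%N) -> qwt phi u = 0.
Proof.
move=> [y yn <-] phi0; rewrite qwtE -yn gwt_comp.
rewrite -[RHS](rmorph0 pi) -(gwt0 G y); congr (pi _); apply: eq_gwt => m.
by case: leqP => nm; rewrite ?muln0 // phi0.
Qed.

Lemma qwt_lead n phi c u : J n u -> phi n = c -> J n.+1 (qwt phi u - u *+ c).
Proof.
move=> [y yn <-] phin; rewrite qwtE -rmorphMn -rmorphB.
exists (gwt G phi y - y *+ c) => //; rewrite -phin.
elim/gord_span: yn => [|d i w {}y nw IH].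
  by rewrite raddf0 mul0rn subrr; exact: gord0.
rewrite raddfD mulrnDl opprD addrACA; apply: gordD => //= {IH}.
rewrite gwt_spath; move: nw; rewrite leq_eqVlt => /predU1P[<-|nw].
  by rewrite subrr; exact: gord0.
have gMn z m : gord G n.+1 z -> gord G n.+1 (z *+ m).
  by move=> zn; rewrite /gord raddfMn /= zn.
by apply: gordB; apply: gMn; exact: gord_path.
Qed.

Section Lifting.
Variable N : nat.
Hypothesis nil : forall u, Jf G pi N.+1 u -> u = 0.
Hypothesis char0 : forall n, n.+1%:R != 0 :> k.
Variable s : seq (arrow (double_quiver Q)).
Hypothesis s_enum : perm_eq s (enum (arrow (double_quiver Q))).

Local Notation K := (arrow_commutators G pi).
Local Notation mfac := (mfac N).
Local Notation mprod beta := (\prod_(b <- s) mfac beta b).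
Implicit Types (beta delta : darrow -> A) (u v : A).

Lemma qwt_supp n phi u : (forall m, (m < n)%N -> phi m = 0%N) -> J n (qwt phi u).
Proof.
move=> phi0; have [y <-] := pi_surj u; rewrite qwtE; exists (gwt G phi y) => //.
rewrite /gord gwt_comp; apply: eq_gwt => m.
by case: (leqP n m) => [_|/phi0->] //; exact: mul1n.
Qed.

(** Candidates for the images of the arrows. *)
Definition admissible beta := forall b,
  [/\ e (qhead b) * beta b = beta b, beta b * e (qtail b) = beta b
    & J 2 (beta b - x b)].

Section Admissible.
Variable beta : darrow -> A.
Hypothesis adm : admissible beta.

Lemma admissible_J b : J 1 (beta b).
Proof.
have [_ _ b2] := adm b; rewrite -(subrK (x b) (beta b)); apply: JfD; last exact: Jf_arr.
exact: Jf_le b2.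
Qed.

Lemma mprod_inv : J 1 (mprod beta - 1).
Proof.
elim: s => [|b r IH]; first by rewrite big_nil subrr; exact: Jf0.
rewrite big_cons -[_ * _ - 1](subrKA (\prod_(j <- r) mfac beta j)); apply: JfD => //.
rewrite -[X in _ - X]mul1r -mulrBl; exact: (JfMr _ pi_J0 (J_mfac pi_J0 nil admissible_J b)).
Qed.

Lemma mfac_idem i b : e i * mfac beta b = mfac beta b * e i.
Proof.
have loopC c : GRing.comm (e i) (loop_at beta c).
  rewrite /GRing.comm /loop_at.
  have [h1 t1 _] := adm c; have [h2 t2 _] := adm (qstar c).
  have hc : qtail (qstar c) = qhead c by case: (c).
  have l1 : e (qhead c) * (beta c * beta (qstar c)) = beta c * beta (qstar c).
    by rewrite mulrA h1.
  have l2 : beta c * beta (qstar c) * e (qhead c) = beta c * beta (qstar c).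
    by rewrite -mulrA -hc t2.
  have [->|/eqP/negPf ic] := i =P qhead c; first by rewrite l1 l2.
  by rewrite -{1}l1 -l2 mulrA -[RHS]mulrA !himM ic eq_sym ic mul0r mulr0.
have oneC c : GRing.comm (e i) (1 + loop_at beta c).
  by rewrite /GRing.comm mulrDl mulrDr mul1r mulr1 loopC.
case: b => a; first exact: oneC.
have [ur ul] := loopV nil admissible_J (inr a : darrow).
rewrite /= -/(loop_at beta (inr a)); set g := 1 + _ in ur ul; set u := geo _ _ in ur ul *.
rewrite -[LHS]mul1r -ul -mulrA (mulrA g) -(oneC (inr a : darrow)).
by rewrite -!mulrA ur mulr1.
Qed.

Lemma mprod_diag : diag_part G pi (mprod beta - 1) = mprod beta - 1.
Proof.
have C i : e i * mprod beta = mprod beta * e i.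
  elim: s => [|b r IH]; first by rewrite big_nil mulr1 mul1r.
  by rewrite big_cons mulrA mfac_idem -mulrA IH mulrA.
move: (mprod beta) C => M C; rewrite /diag_part.
rewrite (eq_bigr (fun i => (M - 1) * e i)) => [|i _].
  by rewrite -mulr_sumr him_sum mulr1.
by rewrite mulrBr mulr1 C -[X in _ - X]mul1r -mulrBl -mulrA himM eqxx.
Qed.

(** The factors of [a] and [a^star] have opposite logarithmic derivatives modulo
    commutators, hence that of the product vanishes. *)
Lemma mprod_logder : exists M', [/\ M' * mprod beta = 1, mprod beta * M' = 1
  & K (M' * qwt id (mprod beta))].
Proof.
have KD := @arrow_commutatorsD _ _ _ G _ pi.
have K0 := arrow_commutators0 G pi.
have KC := arrow_commutators_comm G pi_scalar pi_surj.
have [|M' [Ml Mr KM]] := @logder_prod A (qwt id) K qwt_derivation K0 KD KC _ s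
    (mfac beta) (mfac_inv N beta).
  by move=> b; exact: (mfacV nil admissible_J b).
exists M'; split=> //.
rewrite -(subrK (\sum_(b <- s) mfac_inv N beta b * qwt id (mfac beta b)) (M' * _)).
apply: (KD _ _ KM); rewrite (perm_big _ s_enum) big_enum big_sumType /= -big_split /=.
elim/big_ind: _ => // a _.
have [ur ul] := loopV nil admissible_J (inl a : darrow).
have [vr vl] := loopV nil admissible_J (inr a : darrow).
exact: (@logder_swap A (qwt id) K qwt_derivation KD KC _ _ _ _ ur ul vr vl).
Qed.

(** The logarithmic derivative of the product is a sum of commutators and
    starts with [n (M - 1)].  Its part of degree [n] only involves commutators of
    arrows with elements of degree [n - 1], and division by [n] is allowed. *)
Lemma error_form n : (0 < n)%N -> J n (mprod beta - 1) ->
  exists delta : darrow -> A,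
    [/\ forall b, e (qtail b) * delta b * e (qhead b) = delta b,
        forall b, J n.-1 (delta b)
      & J n.+1 (mprod beta - 1 - \sum_b (x b * delta b - delta b * x b))].
Proof.
move=> n0; set c := mprod beta - 1 => cn.
have [M' [Ml Mr [d dP dE]]] := mprod_logder.
pose pr := qwt (fun m => m == n : nat); pose pr' := qwt (fun m => m.+1 == n : nat).
have M1 : J 1 (M' - 1) by exact: (J_inv pi_J0 mprod_inv Ml).
have Ec : qwt id (mprod beta) = qwt id c.
  rewrite -[mprod beta](subrK 1) -/c raddfD /=.
  by rewrite (derivation1 (E := qwt id) qwt_derivation) addr0.
pose r := M' * qwt id (mprod beta) - c *+ n.
have rn : J n.+1 r.
  rewrite /r Ec -[M' in M' * _](subrK 1) mulrDl mul1r -addrA; apply: JfD.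
    exact: (JfM M1 (qwt_J _ cn)).
  exact: qwt_lead.
have pr_r : pr r = 0.
  by apply: (qwt_J0 rn) => m; case: eqP => // ->; rewrite ltnn.
have prD u : pr (diag_part G pi u) = diag_part G pi (pr u).
  by rewrite /diag_part /pr raddf_sum; apply: eq_bigr => i _; exact: qwt_idem.
have prE : diag_part G pi (pr c) *+ n = \sum_b (x b * pr' (d b) - pr' (d b) * x b).
  rewrite -raddfMn /=.
  have <- : pr (M' * qwt id (mprod beta)) = pr c *+ n.
    by rewrite -[M' * _](subrK (c *+ n)) -/r /pr raddfD raddfMn /= -/(pr r) pr_r add0r.
  rewrite -prD dE /pr raddf_sum; apply: eq_bigr => b _.
  by rewrite raddfB /= qwt_arrl qwt_arrr.
have nV u : alg_scalar (n%:R^-1) * (u *+ n) = u :> A.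
  rewrite -[u *+ n]mulr_natl mulrA -(rmorph_nat (@alg_scalar k A)) -rmorphM.
  rewrite mulVf ?rmorph1 ?mul1r //.
  by move: n0 (char0 n.-1) => /prednK->.
have diagJ m u : J m u -> J m (diag_part G pi u).
  move=> um; apply: Jf_sum => i _.
  exact: (JfMr _ pi_J0 (JfMl _ pi_J0 um)).
exists (fun b => alg_scalar (n%:R^-1) * pr' (d b)); split=> [b|b|].
- rewrite mulrA -alg_scalarC -!mulrA (mulrA (e _)); congr (_ * _).
  by rewrite /pr' -qwt_idem dP.
- by apply: (JfMl _ pi_J0); apply: qwt_supp => m; case: eqP => // <-; rewrite ltnn.
- rewrite (eq_bigr (fun b => alg_scalar (n%:R^-1) *
    (x b * pr' (d b) - pr' (d b) * x b))) => [|b _]; last first.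
    by rewrite mulrBr !mulrA -(alg_scalarC _ (x b)).
  rewrite -mulr_sumr -prE nV -[c in c - _]mprod_diag -/c -raddfB /=; apply: diagJ.
  rewrite -opprB; apply: JfN; rewrite -[c in _ - c]mulr1n; apply: qwt_lead => //.
  by rewrite eqxx.
Qed.

End Admissible.

(** For an arrow [a] of the quiver add [delta_(a^star)] to [a] and subtract
    [delta_a] from [a^star]: to leading order this changes the signed sum of the
    loops by [- sum_b [b, delta_b]].  The terms quadratic in the change have
    degree [2 (n - 1)], which exceeds [n] once [2 < n]. *)
Lemma improve n beta : (2 < n)%N -> admissible beta -> J n (mprod beta - 1) ->
  exists2 beta', admissible beta' & J n.+1 (mprod beta' - 1).
Proof.
move=> n2 adm cn; have [d [dP dn dE]] := error_form adm (ltnW (ltnW n2)) cn.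
have n1 : n = n.-1.+1 by rewrite prednK // (ltn_trans _ n2).
pose eta b := signed b (d (qstar b)).
have etaJ b : J n.-1 (eta b).
  by case: b => a; rewrite /eta /=; [|apply: JfN]; exact: dn.
have starK (b : darrow) : qstar (qstar b) = b by case: b.
have head_star (b : darrow) : qhead (qstar b) = qtail b by case: b.
have tail_star (b : darrow) : qtail (qstar b) = qhead b by case: b.
have etaP b : e (qhead b) * eta b = eta b /\ eta b * e (qtail b) = eta b.
  have := dP (qstar b); rewrite tail_star head_star => dP'.
  have [l r] : e (qhead b) * d (qstar b) = d (qstar b) /\
      d (qstar b) * e (qtail b) = d (qstar b).
    by split; rewrite -dP' ?mulrA ?himM ?eqxx // -mulrA himM eqxx.
  by rewrite /eta; case: b l r {dP'} => a /= l r; rewrite ?mulrN ?mulNr l r.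
pose beta' b := beta b + eta b.
have adm' : admissible beta'.
  move=> b; have [l r b2] := adm b; have [l' r'] := etaP b.
  rewrite /beta' mulrDr mulrDl l r l' r'; split=> //.
  rewrite addrAC; apply: JfD => //; apply: Jf_le (etaJ b).
  by rewrite -ltnS -n1.
exists beta' => //.
pose lin b := eta b * x (qstar b) + x b * eta (qstar b).
pose D b := loop_at beta' b - loop_at beta b.
have DE b : J n.+1 (D b - lin b).
  have -> : D b - lin b = eta b * (beta (qstar b) - x (qstar b))
      + (beta b - x b) * eta (qstar b) + eta b * eta (qstar b).
    rewrite /D /lin /loop_at /beta' !(mulrBl, mulrBr, mulrDl, mulrDr) opprD.
    by rewrite [LHS](AC (2*2*1*2) ((3*6)*(2*7)*4*(1*5))) /= subrr addr0.
  have [_ _ b2] := adm b; have [_ _ b2'] := adm (qstar b).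
  apply: JfD; last first.
    apply: Jf_le (JfM (etaJ b) (etaJ (qstar b))).
    by rewrite -!subn1; lia.
  rewrite n1; apply: JfD.
    by rewrite -[_.+2]addn2; exact: (JfM (etaJ b) b2').
  by rewrite -[_.+2]add2n; exact: (JfM b2 (etaJ _)).
have Dn b : J n (D b).
  rewrite -(subrK (lin b) (D b)); apply: JfD; first exact: Jf_le (DE b).
  rewrite n1; apply: JfD.
    by rewrite -addn1; exact: (JfM (etaJ b) (Jf_arr _ _ _)).
  by rewrite -add1n; exact: (JfM (Jf_arr _ _ _) (etaJ _)).
have := mprod_approx pi_J0 nil s (admissible_J adm) (admissible_J adm') Dn.
rewrite (signed_sum _ s_enum) => ME.
set C := \sum_b _ in dE.
rewrite -[mprod beta' - 1](subrKA (mprod beta)).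
rewrite -[mprod beta' - _](subrK (\sum_(a : arrow Q) (D (inl a) - D (inr a)))).
rewrite -[mprod beta - 1](subrK C) [X in J _ X](AC (2*2) ((1*3)*(2*4))) /=.
apply: JfD; first exact: JfD.
rewrite /C big_sumType /= -!big_split /=; apply: Jf_sum => a _.
have -> : D (inl a) - D (inr a) +
    (x (inl a) * d (inl a) - d (inl a) * x (inl a)
     + (x (inr a) * d (inr a) - d (inr a) * x (inr a)))
    = (D (inl a) - lin (inl a)) - (D (inr a) - lin (inr a)).
  rewrite /lin /eta /= !(mulrN, mulNr) !(opprB, opprD, opprK).
  by rewrite [LHS](AC (2*(2*2)) (1*(3*6)*((4*5)*2))).
by apply: JfB; exact: DE.
Qed.

(** The arrows themselves are correct up to [J 3], because the additive relation
    holds; finitely many improvements reach [J N.+1 = 0]. *)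
Lemma exists_solution : exists2 beta, admissible beta & mprod beta = 1.
Proof.
have start : J 3 (mprod x - 1).
  have := mprod_arrows pi_J0 nil s_enum.
  have rel0 : pi (additive_rel) = 0 by apply/pi_ker; exact: ideal_gen_in.
  suff -> : \sum_(a : arrow Q) (loop_at x (inl a) - loop_at x (inr a)) = 0.
    by rewrite subr0.
  apply: etrans rel0; rewrite /additive_rel rmorph_sum; apply: eq_bigr => a _.
  by rewrite rmorphB !rmorphM.
have adm : admissible x.
  move=> b; split; [exact: him_arr | exact: harr_im|].
  by rewrite subrr; exact: Jf0.
have approx m : exists2 beta, admissible beta & J (m + 3) (mprod beta - 1).
  elim: m => [|m [beta bP bm]]; first by exists x.
  by apply: (improve _ bP bm); rewrite addn3.
have [beta bP bN] := approx N; exists beta => //.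
apply/eqP; rewrite -subr_eq0; apply/eqP/nil; apply: Jf_le bN.
by rewrite -addn1 leq_add2l.
Qed.

End Lifting.
End AdditiveRelation.

(** * Comparing the two algebras *)

Section Comparison.
Variables (k : fieldType) (Q : quiver) (P : pzAlgType k).
Variables (G : path_grading (double_quiver Q) P).
Variables (A : pzAlgType k) (pi : {rmorphism P -> A}).
Hypotheses (pi_scalar : alg_morphism pi) (pi_surj : forall u, exists y, pi y = u).
Hypothesis pi_ker : forall y, pi y = 0 <-> ideal_gen (fun z => z = additive_rel G) y.
Variables (B : pzAlgType k) (iota : {rmorphism P -> B}).
Hypotheses (iota_scalar : alg_morphism iota) (iota_surj : forall u, exists y, iota y = u).
Variable N : nat.
Hypothesis nilA : forall u, Jf G pi N.+1 u -> u = 0.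
Hypothesis nilB : forall u, Jf G iota N.+1 u -> u = 0.
Variable s : seq (arrow (double_quiver Q)).
Hypothesis s_enum : perm_eq s (enum (arrow (double_quiver Q))).
Hypothesis relB : \prod_(b <- s) mfac N (harr G iota) b = 1.
Variables (beta : arrow (double_quiver Q) -> A) (f : {rmorphism B -> A}).
Hypothesis adm : admissible G pi beta.
Hypothesis f_idem : forall i, f (iota (gidem G i)) = pi (gidem G i).
Hypothesis f_arr : forall b, f (iota (garr G b)) = beta b.
Hypothesis f_scalar : alg_morphism f.

Local Notation JA := (Jf G pi).
Local Notation JB := (Jf G iota).
Local Notation proj n := (gwt G (fun m => m == n : nat)).

Let A0 u : JA 0 u. Proof. exact: pi_J0. Qed.
Let B0 u : JB 0 u. Proof. exact: pi_J0. Qed.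

Lemma prod_J (r : seq (arrow (double_quiver Q))) :
  JA (size r) (\prod_(b <- r) pi (garr G b)).
Proof.
elim: r => [|b r IH]; first by rewrite big_nil; exact: A0.
by rewrite big_cons [size _]/= -add1n; exact: (JfM (Jf_arr G pi b) IH).
Qed.

(** A word in the [beta b] differs from the same word in the arrows by longer
    words. *)
Lemma f_approx n x : gord G n x -> JA n.+1 (pi x - f (iota x)).
Proof.
elim/gord_span => [|c i w {}x nw IH]; first by rewrite !rmorph0 subrr; exact: Jf0.
rewrite !rmorphD opprD addrACA; apply: JfD => // {IH}.
rewrite !rmorphM iota_scalar f_scalar pi_scalar -mulrBr; apply: (JfMl _ A0).
rewrite f_idem -mulrBr; apply: (JfMl _ A0).
rewrite !rmorph_prod; apply: (@Jf_le _ _ _ _ _ _ _ (size w).+1) => // {nw}.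
elim: w => [|b w IH]; first by rewrite !big_nil subrr; exact: Jf0.
rewrite !big_cons f_arr; set X := \prod_(j <- w) _ in IH *.
set Y := \prod_(j <- w) _ in IH *.
have -> : pi (garr G b) * X - beta b * Y
    = - ((beta b - pi (garr G b)) * X) + beta b * (X - Y).
  by rewrite mulrBl opprB mulrBr subrKA.
have [_ _ b2] := adm b; apply: JfD.
  by apply: JfN; rewrite -add2n; exact: (JfM b2 (prod_J w)).
by rewrite -add1n; exact: (JfM (admissible_J adm b) IH).
Qed.

(** Successive approximation: the error of [f_approx] is lifted in turn, and
    vanishes from length [N.+1] on. *)
Lemma f_surj u : exists v, f v = u.
Proof.
have [x <-] := pi_surj u.
have H m y : gord G (N.+1 - m) y -> exists v, f v = pi y.
  elim: m y => [|m IH] y yn.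
    by exists 0; rewrite rmorph0 [RHS]nilA //; exists y => //; rewrite -[N.+1]subn0.
  have [z zn zE] := f_approx yn.
  have [|v vE] := IH z; first by apply: gord_le zn; rewrite subSS; lia.
  by exists (v + iota y); rewrite rmorphD vE zE subrK.
by apply: (H N.+1); rewrite subnn; exact: gord_any.
Qed.

(** In [B] the additive relation is a sum of longer words, so every homogeneous
    element of the ideal it generates can be rewritten in longer words. *)
Lemma ideal_raise n y : ideal_gen (fun z => z = additive_rel G) y ->
  JB n.+1 (iota (proj n y)).
Proof.
move=> Iy; elim: Iy n => {y} [y ->|| y z _ IHy _ IHz|a y _ IH|y a _ IH] n.
- rewrite gwt_additive_rel; case: eqP => [<-|_]; last first.
    by rewrite mulr0n rmorph0; exact: Jf0.
  have := mprod_arrows B0 nilB s_enum; rewrite relB subrr sub0r => /JfN.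
  rewrite opprK (_ : \sum_a _ = iota (additive_rel G)) //.
  rewrite rmorph_sum; apply: eq_bigr => a _; by rewrite rmorphB !rmorphM.
- by rewrite raddf0 rmorph0; exact: Jf0.
- by rewrite raddfB rmorphB; exact: JfB.
- elim/(gspan' (G := G)): a => [|c i w a IHa].
    by rewrite mul0r raddf0 rmorph0; exact: Jf0.
  rewrite mulrDl raddfD rmorphD; apply: JfD => //=.
  rewrite -mulrA gwt_scalar gwt_pathl rmorphM; apply: (JfMl _ B0).
  have [wn|wn] := leqP (size w) n; last first.
    rewrite (eq_gwt _ _ (psi := fun=> 0%N)).
      by rewrite gwt0 mulr0 rmorph0; exact: Jf0.
    by move=> m; case: eqP => //; lia.
  rewrite (eq_gwt _ _ (psi := fun m => m == (n - size w)%N : nat)).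
    rewrite rmorphM (_ : n.+1 = size w + (n - size w).+1)%N; last by lia.
    apply: JfM (IH _); exists (gpath G i w) => //.
    by rewrite -[gpath _ _ _]mul1r -(rmorph1 (@alg_scalar k P)); exact: gord_path.
  by move=> m; congr nat_of_bool; lia.
- elim/(gspan' (G := G)): a => [|c i w a IHa].
    by rewrite mulr0 raddf0 rmorph0; exact: Jf0.
  rewrite mulrDr raddfD rmorphD; apply: JfD => //=.
  rewrite mulrA -alg_scalarC -mulrA gwt_scalar gwt_pathr rmorphM; apply: (JfMl _ B0).
  have [wn|wn] := leqP (size w) n; last first.
    rewrite (eq_gwt _ _ (psi := fun=> 0%N)).
      by rewrite gwt0 mul0r rmorph0; exact: Jf0.
    by move=> m; case: eqP => //; lia.
  rewrite (eq_gwt _ _ (psi := fun m => m == (n - size w)%N : nat)).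
    rewrite rmorphM (_ : n.+1 = (n - size w).+1 + size w)%N; last by lia.
    apply: JfM (IH _) _; exists (gpath G i w) => //.
    by rewrite -[gpath _ _ _]mul1r -(rmorph1 (@alg_scalar k P)); exact: gord_path.
  by move=> m; congr nat_of_bool; lia.
Qed.

(** If [y] starts in degree [n] and [f] kills its image, then by [f_approx] its
    part of degree [n] lies in the ideal of the additive relation, and
    [ideal_raise] replaces [y] by an element that starts in degree [n + 1]. *)
Lemma f_inj v : f v = 0 -> v = 0.
Proof.
have [x <-] := iota_surj v.
have H m y : gord G (N.+1 - m) y -> f (iota y) = 0 -> iota y = 0.
  elim: m y => [|m IH] y yn fy.
    by apply: nilB; exists y => //; rewrite -[N.+1]subn0.
  set n := (N.+1 - m.+1)%N in yn.
  have [z zn] := f_approx yn; rewrite fy subr0 => zE.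
  have I : ideal_gen (fun z => z = additive_rel G) (y - z).
    by apply/pi_ker; rewrite rmorphB zE subrr.
  have [t tn tE] := ideal_raise n I.
  have projz : proj n z = 0.
    rewrite -zn gwt_comp -[RHS](gwt0 G z); apply: eq_gwt => l.
    by case: eqP => // ->; rewrite ltnn.
  have yt : iota y = iota (t + (y - proj n y)).
    by rewrite rmorphD tE raddfB /= projz subr0 rmorphB addrC subrK.
  rewrite yt; apply: IH; last by rewrite -yt.
  apply: gordD; first by apply: gord_le tn; rewrite /n; lia.
  apply: (@gord_le _ _ _ _ _ n.+1); first by rewrite /n; lia.
  elim/gord_span: yn {fy yt I zE tE} => [|d i w {}y nw IHy].
    by rewrite raddf0 subrr; exact: gord0.
  rewrite raddfD opprD addrACA; apply: gordD => //= {IHy}.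
  rewrite gwt_spath; move: nw; rewrite leq_eqVlt => /predU1P[<-|nw].
    by rewrite eqxx subrr; exact: gord0.
  by rewrite gtn_eqF // mulr0n subr0; exact: gord_path.
by apply: (H N.+1); rewrite subnn; exact: gord_any.
Qed.

Lemma f_bij : bijective f.
Proof.
exists (fun u => projT1 (cid (f_surj u))) => [v|u].
  case: cid => w /= wE; apply/eqP; rewrite -subr_eq0; apply/eqP/f_inj.
  by rewrite rmorphB wE subrr.
by case: cid.
Qed.

End Comparison.

Section Isomorphism.
Variables (k : fieldType) (Q : quiver) (s : seq (arrow (double_quiver Q))).
Local Notation P := (path_alg k (double_quiver Q)).
Local Notation G := (path_alg_grading k (double_quiver Q)).
Local Notation L := (path_alg_loc k Q).
Local Notation relL := (fun x => x = mult_preproj_rel (fun=> 1 : k) s).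
Local Notation Lambda := (mult_preproj (fun=> 1 : k) s).

Definition add_proj : {rmorphism P -> preproj k Q} :=
  quot_pi (fun x => x = preproj_rel k Q).

Definition mult_proj : {rmorphism P -> Lambda} :=
  (quot_pi relL : {rmorphism L -> Lambda}) \o
    (loc_base (@one_plus k Q) : {rmorphism P -> L}).

Lemma mult_proj_scalar : alg_morphism mult_proj.
Proof. by []. Qed.

(** The universal inverse of [1 + b b^star] in the multiplicative algebra. *)
Definition minv b : Lambda := quot_pi relL (loc_inv (@one_plus k Q) b).

Lemma minvV b :
  (1 + loop_at (harr G mult_proj) b) * minv b = 1 /\
  minv b * (1 + loop_at (harr G mult_proj) b) = 1.
Proof.
have E : 1 + loop_at (harr G mult_proj) b
    = quot_pi relL (loc_base (@one_plus k Q) (one_plus k b)).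
  have -> : quot_pi relL (loc_base (@one_plus k Q) (one_plus k b)) = mult_proj (one_plus k b).
    by [].
  by rewrite /one_plus rmorphD rmorph1 rmorphM.
rewrite E /minv; split; apply: etrans (esym (rmorphM (quot_pi relL) _ _)) _.
  by rewrite loc_mulrV rmorph1.
by rewrite loc_mulVr rmorph1.
Qed.

Definition mult_fac b : Lambda :=
  match b with inl _ => 1 + loop_at (harr G mult_proj) b | inr _ => minv b end.

Lemma mult_fac_prod : \prod_(b <- s) mult_fac b = 1.
Proof.
have E b : mult_fac b = quot_pi relL (mult_factor k b).
  case: b => a //=; apply: etrans (_ : mult_proj (one_plus k (inl a)) = _) => //.
  by rewrite /one_plus rmorphD rmorph1 rmorphM.
have R : quot_pi relL (\prod_(b <- s) mult_factor k b - 1) = 0.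
  apply/quot_pi_eq0; apply: ideal_gen_in; rewrite /mult_preproj_rel; congr (_ - _).
  rewrite -[LHS](rmorph1 (loc_base (@one_plus k Q))) -(sum_vertex_idem k (double_quiver Q)).
  by rewrite rmorph_sum; apply: eq_bigr => i _; rewrite rmorph1 mul1r.
move: R; rewrite rmorphB rmorph1 rmorph_prod => /eqP; rewrite subr_eq0 => /eqP R.
by rewrite (eq_bigr _ (fun b _ => E b)); exact: R.
Qed.

Lemma add_proj_surj u : exists y, add_proj y = u.
Proof. exact: quot_pi_surj. Qed.

Lemma add_proj_ker y : add_proj y = 0 <-> ideal_gen (fun z => z = additive_rel G) y.
Proof. exact: quot_pi_eq0. Qed.

Lemma mult_proj_surj_inv : (forall b, exists y, mult_proj y = minv b) ->
  forall u, exists y, mult_proj y = u.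
Proof.
move=> inv u; have [v <-] := quot_pi_surj u.
elim/loc_ind: v => [a|j|v w [y yv] [z zw]|v w [y yv] [z zw]].
- by exists a.
- exact: inv.
- by exists (y + z); rewrite rmorphD yv zw [RHS]rmorphD.
- by exists (y * z); rewrite rmorphM yv zw [RHS]rmorphM.
Qed.

Variable N : nat.
Hypothesis char0 : forall n, n.+1%:R != 0 :> k.
Hypothesis s_enum : perm_eq s (enum (arrow (double_quiver Q))).
Hypothesis mult_surj : forall u, exists y, mult_proj y = u.
Hypothesis nilA : forall u, Jf G add_proj N.+1 u -> u = 0.
Hypothesis nilB : forall u, Jf G mult_proj N.+1 u -> u = 0.

(** A solution of the multiplicative relation in the additive algebra defines a
    map on the path algebra, which extends to the localization since its values
    on [1 + b b^star] are units, and then to the quotient. *)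
Theorem nilpotent_isomorphic : alg_isomorphic Lambda (preproj k Q).
Proof.
have add_scalar : alg_morphism add_proj by [].
have [beta adm betaM] :=
  exists_solution add_scalar add_proj_surj add_proj_ker nilA char0 s_enum.
have beta1 := admissible_J adm.
have [phi [phik phi_idem phi_arr]] : exists phi : {rmorphism P -> preproj k Q},
    [/\ alg_morphism phi, forall i, phi (vertex_idem k i) = add_proj (vertex_idem k i)
      & forall b, phi (arrow_elt k b) = beta b].
  apply: path_alg_lift => [|i j|b|b].
  - exact: (him_sum G add_proj).
  - exact: (himM G add_proj).
  - by case: (adm b) => l _ _; exact: l.
  - by case: (adm b) => _ l _; exact: l.
have phi_one b : phi (one_plus k b) = 1 + loop_at beta b.
  by rewrite /one_plus rmorphD rmorph1 rmorphM; congr (_ + _ * _); exact: phi_arr.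
have [|g [gk gb gU]] := loc_universal (s := @one_plus k Q)
    (v := fun b => geo N.+1 (loop_at beta b)) phik.
  by move=> b; rewrite phi_one; have [l r] := loopV nilA beta1 b.
have g_fac b : g (mult_factor k b) = mfac N beta b.
  case: b => a /=; first by rewrite gb phi_one.
  have [l r] := loopV nilA beta1 (inr a : arrow (double_quiver Q)).
  apply: invl_uniq l; rewrite -phi_one -gb -rmorphM loc_mulVr; exact: rmorph1.
have g_rel x : x = mult_preproj_rel (fun=> 1 : k) s -> g x = 0.
  move=> ->; rewrite /mult_preproj_rel rmorphB rmorph_prod.
  rewrite (eq_bigr (mfac N beta)) => [|b _]; last exact: g_fac.
  rewrite betaM rmorph_sum (eq_bigr (fun i => add_proj (vertex_idem k i))).
    by rewrite (him_sum G add_proj) subrr.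
  by move=> i _; rewrite rmorphM gk !rmorph1 mul1r gb phi_idem.
have [f fk fE] := quot_lift gk g_rel.
exists f => //.
have relB : \prod_(b <- s) mfac N (harr G mult_proj) b = 1.
  rewrite -[RHS]mult_fac_prod; apply: eq_bigr => b _; case: b => a //=.
  have x1 b : Jf G mult_proj 1 (harr G mult_proj b) by exact: Jf_arr.
  have [l r] := loopV nilB x1 (inr a : arrow (double_quiver Q)).
  by apply: invl_uniq r _; have [] := minvV (inr a).
apply: (@f_bij _ _ _ G _ add_proj add_scalar add_proj_surj add_proj_ker _ mult_proj
  mult_proj_scalar mult_surj N nilA nilB s s_enum relB beta f adm _ _ fk) => [i|b].
- have -> : f (mult_proj (gidem G i)) = g (loc_base (@one_plus k Q) (vertex_idem k i)) := fE _.
  by rewrite gb phi_idem.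
- have -> : f (mult_proj (garr G b)) = g (loc_base (@one_plus k Q) (arrow_elt k b)) := fE _.
  by rewrite gb phi_arr.
Qed.

End Isomorphism.

(** * Nilpotency on rooted trees *)

Section Domination.
Variable R : pzRingType.
Implicit Types a b c : R.

(** The two consequences of [b = w a], with [w] commuting with [a], that are
    used.  Unlike the equation itself they can be composed along a chain. *)
Definition dominates a b := (exists w, b = w * a) /\ (forall m, a ^+ m = 0 -> b ^+ m = 0).

Lemma dominates_comm a b w : b = w * a -> w * a = a * w -> dominates a b.
Proof.
move=> -> wa; split; first by exists w.
by move=> m am; rewrite exprMn_comm // am mulr0.
Qed.

Lemma expr0_le a m n : (m <= n)%N -> a ^+ m = 0 -> a ^+ n = 0.
Proof. by move=> /subnKC <- am; rewrite exprD am mul0r. Qed.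

Lemma expr_swap0 a b m : (b * a) ^+ m = 0 -> (a * b) ^+ m.+1 = 0.
Proof.
move=> ba; suff -> : (a * b) ^+ m.+1 = a * (b * a) ^+ m * b by rewrite ba mulr0 mul0r.
elim: m {ba} => [|m IH]; first by rewrite expr1 expr0 mulr1.
by rewrite exprSr IH exprSr !mulrA.
Qed.

End Domination.

Section Tree.
Variables (k : fieldType) (Q : quiver) (P : pzAlgType k).
Variables (G : path_grading (double_quiver Q) P).
Variables (A : pzAlgType k) (h : {rmorphism P -> A}).
Local Notation darrow := (arrow (double_quiver Q)).
Local Notation V := (vertex (double_quiver Q)).
Local Notation X b := (h (garr G b)).
Local Notation e i := (h (gidem G i)).
Local Notation loop b := (loop_at (harr G h) b).

Variables (r : V) (par : V -> V) (ht : V -> nat).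

Definition upward (b : darrow) := (qtail b != r) && (qhead b == par (qtail b)).

(** A rooted tree that branches only at the root. *)
Record star_tree : Prop := StarTree {
  upward_total : forall b, upward b || upward (qstar b);
  upward_uniq : forall b c, upward b -> upward c -> qtail b = qtail c -> b = c;
  upward_ex : forall v, v != r -> exists2 b, upward b & qtail b = v;
  upward_ht : forall b c, upward b -> upward c -> qhead c = qtail b ->
    (ht (qtail c) < ht (qtail b))%N;
  upward_arm : forall b c c', upward b -> upward c -> upward c' ->
    qhead c = qtail b -> qhead c' = qtail b -> c = c';
  ht_gt0 : forall v, v != r -> (0 < ht v)%N;
  ht_root : forall v, v != r -> (ht v < ht r)%N;
  ht_par : forall b, upward b -> (ht (qtail b) < ht (qhead b))%N
}.

Hypothesis T : star_tree.

Let starK (b : darrow) : qstar (qstar b) = b. Proof. by case: b. Qed.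
Let head_star (b : darrow) : qhead (qstar b) = qtail b. Proof. by case: b. Qed.
Let tail_star (b : darrow) : qtail (qstar b) = qhead b. Proof. by case: b. Qed.

Section ArmNilpotency.
Variable z : darrow -> A.
Hypothesis z_loop : forall b, dominates (z b) (loop b).
Hypothesis loop_z : forall b, dominates (loop b) (z b).
Hypothesis z_leaf : forall b, upward b ->
  (forall c, upward c -> qhead c != qtail b) -> z (qstar b) = 0.
Hypothesis z_arm : forall b c, upward b -> upward c -> qhead c = qtail b ->
  dominates (z c) (z (qstar b)) /\ dominates (z (qstar b)) (z c).

(** Along an arm nilpotency is transported from the leaf, where the loop is [0],
    gaining one power at each edge. *)
Lemma arm_nilp b : upward b -> loop b ^+ (ht (qtail b)).+1 = 0.
Proof.
have [n] := ubnP (ht (qtail b)); elim: n b => // n IH b bn ub.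
rewrite /loop_at; apply: expr_swap0; rewrite -{2}[b]starK.
suff : z (qstar b) ^+ ht (qtail b) = 0 by have [_] := z_loop (qstar b); apply.
have [c /andP[uc /eqP cb]|none] := pickP (fun c => upward c && (qhead c == qtail b)).
  have [[_ zz] _] := z_arm ub uc cb; apply: zz.
  have hcb := upward_ht T ub uc cb; apply: (expr0_le hcb).
  have [_ lz] := loop_z c; apply: lz; apply: IH => //; exact: leq_trans hcb _.
rewrite z_leaf // => [|c uc].
  by rewrite expr0n; case/andP: ub => /(ht_gt0 T); case: (ht _).
by have := none c; rewrite uc /= => ->.
Qed.

Lemma arm_factor b c : upward b -> upward c -> qhead c = qtail b ->
  exists w, loop c = w * X b.
Proof.
move=> ub uc cb; have [_ [[w2 zE] _]] := z_arm ub uc cb.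
have [[w1 lE] _] := z_loop c; have [[w3 sE] _] := loop_z (qstar b).
exists (w1 * w2 * w3 * X (qstar b)).
by rewrite lE zE sE /loop_at starK !mulrA.
Qed.

Lemma loop_nilp b : loop b ^+ (ht r).+1 = 0.
Proof.
have ltr c : upward c -> (ht (qtail c) < ht r)%N by case/andP=> /(ht_root T).
have [ub|ub] := orP (upward_total T b).
  apply: expr0_le (arm_nilp ub); rewrite ltnS; exact: ltnW (ltr _ ub).
rewrite /loop_at; apply: expr_swap0; rewrite -{2}[b]starK.
exact: expr0_le (ltr _ ub) (arm_nilp ub).
Qed.

End ArmNilpotency.

Section Annihilation.
Hypotheses (hk : alg_morphism h) (hsurj : forall u, exists x, h x = u).

Definition ann n (y : A) := forall w, size w = n -> (\prod_(b <- w) X b) * y = 0.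

Lemma annS n y : (forall b, ann n (X b * y)) -> ann n.+1 y.
Proof.
move=> H w; elim/last_ind: w => // w b _; rewrite size_rcons => -[wn].
by rewrite -cats1 big_cat big_seq1 -mulrA H.
Qed.

Lemma ann_arr n y b : ann n.+1 y -> ann n (X b * y).
Proof.
move=> H w wn; rewrite mulrA; have := H (rcons w b).
by rewrite size_rcons wn -cats1 big_cat big_seq1; apply.
Qed.

Lemma ann_le m n y : (m <= n)%N -> ann m y -> ann n y.
Proof.
move=> mn H w wn; rewrite -(cat_take_drop (n - m) w) big_cat -mulrA H ?mulr0 //.
by rewrite size_drop wn subKn.
Qed.

Lemma ann0 n : ann n 0. Proof. by move=> w _; rewrite mulr0. Qed.

Lemma annD n y z : ann n y -> ann n z -> ann n (y + z).
Proof. by move=> yn zn w wn; rewrite mulrDr yn // zn // addr0. Qed.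

Lemma annMr n y a : ann n y -> ann n (y * a).
Proof. by move=> yn w wn; rewrite mulrA yn // mul0r. Qed.

Lemma ann_idem n i y : ann n y -> ann n (e i * y).
Proof.
case: n => [|n] yn.
  by have := yn [::] erefl; rewrite big_nil mul1r => ->; rewrite mulr0; exact: ann0.
apply: annS => b; rewrite mulrA.
have [->|/eqP ib] := i =P qtail b; first by rewrite harr_im; exact: ann_arr.
by rewrite harr_imN // mul0r; exact: ann0.
Qed.

Lemma annMl n a y : ann n y -> ann n (a * y).
Proof.
move=> yn; have [x <-] := hsurj a.
elim/(gspan' (G := G)): x => [|c i w x IH]; first by rewrite rmorph0 mul0r; exact: ann0.
rewrite rmorphD mulrDl; apply: annD => // {IH}; rewrite rmorphM hk -mulrA.
suff H : ann n (h (gpath G i w) * y).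
  by move=> v vn; rewrite mulrA -alg_scalarC -mulrA H // mulr0.
rewrite rmorphM rmorph_prod -mulrA; apply: ann_idem.
elim: w => [|b w IH]; first by rewrite big_nil mul1r.
by rewrite big_cons -mulrA; apply: ann_arr; exact: ann_le IH.
Qed.

Hypothesis arm : forall b c, upward b -> upward c -> qhead c = qtail b ->
  exists w, loop c = w * X b.

(** A path that starts at a vertex [v] of an arm and never leaves towards the
    root must go outwards all the time: turning back after [c^star] gives
    [c c^star], which the relation moves across [v] and starts with the upward
    arrow [b]. *)
Lemma ann_descend b n y : upward b -> ann n (X b * y) ->
  ann (n + ht (qtail b)).+1 (e (qtail b) * y).
Proof.
have [m] := ubnP (ht (qtail b)); elim: m b y => // m IH b y bm ub yn.
apply: annS => b'; rewrite mulrA.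
have [tb|/eqP tb] := qtail b =P qtail b'; last by rewrite harr_imN // mul0r; exact: ann0.
rewrite tb harr_im; have [ub'|ub'] := orP (upward_total T b').
  by rewrite -(upward_uniq T ub ub' tb); apply: ann_le yn; exact: leq_addr.
set c := qstar b' in ub'; have cb : qhead c = qtail b by rewrite head_star.
have hcb := upward_ht T ub ub' cb.
have cy : e (qtail c) * (X b' * y) = X b' * y by rewrite mulrA tail_star him_arr.
apply: (@ann_le (n + ht (qtail c)).+1); first by rewrite -addnS -tb leq_add2l.
rewrite -cy; apply: IH => //; first exact: leq_trans hcb bm.
rewrite mulrA.
have [w] := arm ub ub' cb; rewrite /loop_at /harr /c starK => ->.
by rewrite -mulrA; exact: annMl.
Qed.

Lemma ann_root n y :
  (forall c, upward c -> qhead c = r -> ann n (loop c * y)) ->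
  ann (n + ht r).+1 (e r * y).
Proof.
move=> yn; apply: annS => b'; rewrite mulrA.
have [tb|/eqP tb] := r =P qtail b'; last by rewrite harr_imN // mul0r; exact: ann0.
have [/andP[]|ub'] := orP (upward_total T b'); first by rewrite -tb eqxx.
rewrite tb harr_im -tb; set c := qstar b' in ub'.
have cr : qhead c = r by rewrite head_star.
have cy : e (qtail c) * (X b' * y) = X b' * y by rewrite mulrA tail_star him_arr.
apply: (@ann_le (n + ht (qtail c)).+1).
  by rewrite -addnS leq_add2l; apply: (ht_root T); case/andP: ub'.
rewrite -cy; apply: ann_descend => //; rewrite mulrA; have := yn c ub' cr.
by rewrite /loop_at /harr /c starK.
Qed.

Variables (x y : A) (L : nat).
Hypothesis xyL : forall w : seq bool, size w = L ->
  \prod_(t <- w) (if t then x else y) = 0.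
Hypotheses (ex : e r * x = x) (xe : x * e r = x) (ey : e r * y = y) (ye : y * e r = y).
Hypothesis root_loop : forall c, upward c -> qhead c = r ->
  exists u v, loop c = u * x + v * y.

(** By [ann_root] a path that starts at the root is controlled by the loops it
    runs through there, and these are combinations of [x] and [y]. *)
Lemma root_ann : exists n, ann n (e r).
Proof.
exists (L * (ht r).+1)%N.
have H j (w : seq bool) : (size w + j = L)%N ->
    ann (j * (ht r).+1) (e r * \prod_(t <- w) (if t then x else y)).
  elim: j w => [|j IH] w wL.
    by rewrite xyL ?mulr0; [exact: ann0 | rewrite -wL addn0].
  have -> : (j.+1 * (ht r).+1 = (j * (ht r).+1 + ht r).+1)%N by lia.
  apply: ann_root => c uc cr.
  have [u [v ->]] := root_loop uc cr; rewrite mulrDl -!mulrA.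
  have Hx t : ann (j * (ht r).+1)
      ((if t then x else y) * \prod_(t <- w) (if t then x else y)).
    have := IH (t :: w); rewrite big_cons mulrA.
    have -> : e r * (if t then x else y) = if t then x else y by case: t.
    by apply; rewrite /= addSnnS.
  by apply: annD; apply: annMl; [exact: (Hx true) | exact: (Hx false)].
have := H L [::]; rewrite big_nil mulr1; exact.
Qed.

(** From a vertex to the one below it, [ann_descend] bounds the paths by those
    that start one step closer to the root. *)
Lemma tree_ann : exists n, forall v, ann n (e v).
Proof.
have [n0 an0] := root_ann.
have H d : exists n, forall v, (ht r <= ht v + d)%N -> ann n (e v).
  elim: d => [|d [n IH]].
    exists n0 => v; rewrite addn0; have [->//|/(ht_root T)] := eqVneq v r.
    by rewrite ltnNge => /negPf->.
  exists (n0 + n + ht r).+1 => v vd.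
  have [->|vr] := eqVneq v r; first by apply: ann_le an0; lia.
  have [b ub bv] := upward_ex T vr.
  have := @ann_descend b n 1 ub; rewrite !mulr1 bv => D.
  apply: (@ann_le (n + ht v).+1); first by have := ht_root T vr; lia.
  apply: D; rewrite -him_arr; apply: annMr; apply: IH.
  by have := ht_par T ub; rewrite bv; lia.
by have [n nH] := H (ht r); exists n => v; apply: nH; exact: leq_addl.
Qed.

Theorem tree_nilp : exists n, forall m, (n <= m)%N -> forall u, Jf G h m u -> u = 0.
Proof.
have [n H] := tree_ann; exists n => m nm u [t tm <-].
have {}H : ann n 1.
  rewrite -(him_sum G h) => w wn; rewrite mulr_sumr big1 // => i _; exact: H.
elim/gord_span: tm => [|c i w {}t mw IH]; first exact: rmorph0.
rewrite rmorphD IH addr0 !rmorphM rmorph_prod.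
have := ann_le (leq_trans nm mw) H; move/(_ w erefl); rewrite mulr1 => ->.
by rewrite !mulr0.
Qed.

End Annihilation.
End Tree.

(** * Words at the branching vertex *)

Section RootWords.
Variables (R : pzRingType) (x y : R).
Implicit Types (N : R -> Prop) (p u w : R).

Local Notation letter := (fun t : bool => if t then x else y).

(** A left ideal for the subring generated by [x] and [y]. *)
Record stable N : Prop := Stable {
  stableB : forall u w, N u -> N w -> N (u - w);
  stablex : forall u, N u -> N (x * u);
  stabley : forall u, N u -> N (y * u)
}.

Definition lifted N u := N (x * u) /\ N (y * u).

Section StableTheory.
Variable N : R -> Prop.
Hypothesis Ns : stable N.

Lemma stable_lifted : stable (lifted N).
Proof.
have := Ns => -[NB Nx Ny]; split=> [u w [ux uy] [wx wy]|u [ux uy]|u [ux uy]]; split.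
- by rewrite mulrBr; exact: NB.
- by rewrite mulrBr; exact: NB.
- exact: Nx.
- exact: Ny.
- exact: Nx.
- exact: Ny.
Qed.

Lemma lifted_sub u : N u -> lifted N u.
Proof. by move=> Nu; split; [exact: stablex | exact: stabley]. Qed.

Lemma stable0 u : N u -> N 0.
Proof. by move=> Nu; rewrite -(subrr u); exact: stableB. Qed.

Lemma stableN u : N u -> N (- u).
Proof. by move=> Nu; rewrite -sub0r; apply: (stableB Ns) => //; exact: stable0 Nu. Qed.

Lemma stableD u w : N u -> N w -> N (u + w).
Proof. by move=> Nu Nw; rewrite -[w]opprK; apply: (stableB Ns) => //; exact: stableN. Qed.

Lemma stableMn u n : N u -> N (u *+ n).
Proof.
move=> Nu; elim: n => [|n IH]; first by rewrite mulr0n; exact: stable0 Nu.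
by rewrite mulrS; exact: stableD.
Qed.

(** To be used as rewriting a member of [N] modulo another one. *)
Lemma stable_cong u w : N (u - w) -> N u <-> N w.
Proof.
move=> uw; split=> [Nu|Nw]; last by rewrite -(subrK w u); exact: stableD.
by rewrite -(subKr u w); exact: stableB.
Qed.

End StableTheory.

(** Satisfied by the elements of the subring generated by [x] and [y]. *)
Definition preserving a := forall N, stable N -> forall u, N u -> N (a * u).

Lemma preserving_x : preserving x. Proof. by move=> N Ns u; exact: stablex. Qed.
Lemma preserving_y : preserving y. Proof. by move=> N Ns u; exact: stabley. Qed.
Lemma preserving1 : preserving 1. Proof. by move=> N Ns u; rewrite mul1r. Qed.

Lemma preservingD a b : preserving a -> preserving b -> preserving (a + b).
Proof.
by move=> ap bp N Ns u Nu; rewrite mulrDl; apply: (stableD Ns); [exact: ap | exact: bp].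
Qed.

Lemma preservingM a b : preserving a -> preserving b -> preserving (a * b).
Proof.
by move=> ap bp N Ns u Nu; rewrite -mulrA; apply: ap => //; exact: bp.
Qed.

Lemma preservingMn a n : preserving a -> preserving (a *+ n).
Proof.
by move=> ap N Ns u Nu; rewrite mulrnAl; apply: (stableMn Ns); exact: ap.
Qed.

Lemma preservingN a : preserving a -> preserving (- a).
Proof. by move=> ap N Ns u Nu; rewrite mulNr; apply: (stableN Ns); exact: ap. Qed.

Lemma preserving_geo n a : preserving a -> preserving (geo n a).
Proof.
move=> /preservingN ap; elim: n => [|n IH] N Ns u Nu.
  by rewrite /geo big_ord0 mul0r; exact: stable0 Nu.
rewrite geoS; move: N Ns u Nu; apply: preservingD; first exact: preserving1.
exact: preservingM.
Qed.

(** The inverse of [1 + a] is a polynomial in [a]. *)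
Lemma preserving_cancel n a N u : preserving a -> a ^+ n = 0 -> stable N ->
  N ((1 + a) * u) -> N u.
Proof.
move=> ap an Ns Nu; have [_ gl] := geoV an.
by rewrite -[u]mul1r -gl -mulrA; exact: preserving_geo.
Qed.

Definition wann n u := forall t, size t = n -> (\prod_(i <- t) letter i) * u = 0.

Lemma wannS n u : wann n.+1 u <-> lifted (wann n) u.
Proof.
split=> [H|[Hx Hy] t].
  have H' b : wann n (letter b * u).
    move=> t tn; rewrite mulrA; have := H (rcons t b).
    by rewrite size_rcons tn -cats1 big_cat big_seq1; apply.
  by split; [exact: (H' true) | exact: (H' false)].
elim/last_ind: t => // t b _; rewrite size_rcons => -[tn].
rewrite -cats1 big_cat big_seq1 -mulrA.
by case: b; [exact: Hx | exact: Hy].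
Qed.

Lemma stable_wann n : stable (wann n).
Proof.
elim: n => [|n IH]; last first.
  have := stable_lifted IH => -[NB Nx Ny].
  split=> [u w /wannS un /wannS wn|u /wannS un|u /wannS un]; apply/wannS.
  - exact: NB.
  - exact: Nx.
  - exact: Ny.
have w0 u : wann 0 u <-> u = 0.
  split=> [H|-> t _]; last by rewrite mulr0.
  by have := H [::] erefl; rewrite big_nil mul1r.
split=> [u w /w0 -> /w0 ->|u /w0 ->|u /w0 ->]; apply/w0.
- exact: subrr.
- exact: mulr0.
- exact: mulr0.
Qed.

(** The kernels of the powers of [d] filter the ring.  If [d^(j+1)] kills [p],
    then by induction [d p], hence its multiple [D p], is killed by words of length
    [j * m]; applied to the stable predicate of being so killed, the first
    hypothesis shows that the next step costs [m] more letters. *)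
Lemma words_vanish (d D g : R) (m j : nat) :
    (forall N, stable N -> forall p, N (D * p) -> iter m lifted N p) ->
    D = g * d -> preserving g -> d ^+ j = 0 ->
  forall t, size t = (j * m)%N -> \prod_(i <- t) letter i = 0.
Proof.
move=> reach Dg gp dj; suff H p : d ^+ j * p = 0 -> wann (j * m) p.
  by move=> t tn; have := H 1; rewrite dj mul0r => /(_ erefl t tn); rewrite mulr1.
elim: j p {dj} => [|j IH] p.
  by rewrite expr0 mul1r => -> t _; rewrite mulr0.
rewrite exprSr -mulrA => /IH dp.
have Dp : wann (j * m) (D * p).
  by rewrite Dg -mulrA; exact: (gp _ (stable_wann _) _ dp).
have := reach _ (stable_wann _) p Dp; rewrite mulSn.
move: (j * m)%N => l; elim: m p {dp Dp reach IH} => [//|n IHn] p [px py].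
by rewrite addSn; apply/wannS; split; exact: IHn.
Qed.

End RootWords.

Section BranchWords.
Variables (R : pzRingType) (x y : R) (kappa : nat).
Hypothesis xx : x ^+ 2 = 0.

(** For [kappa = 0] and [kappa = 1] these are [x + y] and
    [(1 + x) (1 + y) - 1]. *)
Definition twist : R := (1 + x *+ kappa) * (x + y).

Lemma twistE : twist = x + y + (x * y) *+ kappa.
Proof. by rewrite /twist mulrDl mul1r mulrnAl mulrDr -expr2 xx add0r. Qed.

Lemma untwist : x + y = (1 - x *+ kappa) * twist.
Proof.
have xk : (x *+ kappa) * (x *+ kappa) = 0 by rewrite mulrnAl mulrnAr -expr2 xx !mul0rn.
have uV : (1 - x *+ kappa) * (1 + x *+ kappa) = 1.
  by rewrite mulrBl mul1r mulrDr mulr1 xk addr0 addrK.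
by rewrite /twist mulrA uV mul1r.
Qed.

Lemma preserving_untwist : preserving x y (1 - x *+ kappa).
Proof.
apply: preservingD; first exact: preserving1.
by apply: preservingN; apply: preservingMn; exact: preserving_x.
Qed.

Let xx0 w : x * (x * w) = 0. Proof. by rewrite mulrA -expr2 xx mul0r. Qed.

(** Two square-zero letters (dihedral case): [y p = - x p] modulo [N], hence
    [x] and [y] both kill [x p]. *)
Lemma dihedral_reach N p : y ^+ 2 = 0 -> stable x y N -> N ((x + y) * p) ->
  iter 2 (lifted x y) N p.
Proof.
move=> yy Ns; rewrite mulrDl => Np.
have yy0 w : y * (y * w) = 0 by rewrite mulrA -expr2 yy mul0r.
have N0 : N 0 by exact: (stable0 Ns Np).
split; split; rewrite ?xx0 ?yy0 //.
- by have := stabley Ns Np; rewrite mulrDr yy0 addr0.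
- by have := stablex Ns Np; rewrite mulrDr xx0 add0r.
Qed.

Hypothesis yyy : y ^+ 3 = 0.
Hypothesis d5 : twist ^+ 5 = 0.

Let yyy0 w : y * (y * (y * w)) = 0.
Proof. by rewrite !mulrA -!expr2 -exprSr yyy mul0r. Qed.

(** The icosahedral case.  Put [q = x p], [r = y q], [s = x r], [t = y s],
    [a = x t], [b = y t], [m = y a], [n = y m], [o = x n], [f = y o], [g = y f].
    Modulo [N] the letters act on these twelve elements as in the definitions,
    by [y p = - q], [x b = - m] and [x f = - g], and by [0] otherwise, so that
    each letter moves one step along a chain of length [11].  All but two of
    these rules follow from [x^2 = y^3 = 0].  For the others write [d] for
    [twist]: the fifth power of [d] kills [d q = (1 + kappa d) r], so [d^4 r = 0]
    modulo [N], which after cancelling units says [x b + kappa x m + m = 0],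
    hence [x m = 0] and [x b = - m].  In the same way [d^5 a = 0] and
    [d^2 a = (1 + kappa d) n] give [d^3 n = 0], which says [x f = - g]. *)
Lemma icosahedral_reach N p : stable x y N -> N ((x + y) * p) ->
  iter 11 (lifted x y) N p.
Proof.
move=> Ns; rewrite mulrDl => Np.
have N0 : N 0 by exact: (stable0 Ns Np).
pose u := 1 + x *+ kappa; pose D := x + y; pose d := twist.
have uE w : u * w = w + (x * w) *+ kappa by rewrite /u mulrDl mul1r mulrnAl.
have DE w : D * w = x * w + y * w by rewrite /D mulrDl.
have dE w : d * w = u * (D * w) by rewrite /d /twist -mulrA.
have xu w : x * (u * w) = x * w by rewrite uE mulrDr mulrnAr xx0 mul0rn addr0.
have ux w : u * (x * w) = x * w by rewrite uE xx0 mul0rn addr0.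
have u_pres : preserving x y u.
  by apply: preservingD; [exact: preserving1 | apply: preservingMn; exact: preserving_x].
have d_pres : preserving x y d.
  apply: preservingM => //; apply: preservingD; [exact: preserving_x | exact: preserving_y].
have x_canc w : N (u * w) -> N w.
  apply: (@preserving_cancel _ x y 2 (x *+ kappa)) => //.
    by apply: preservingMn; exact: preserving_x.
  by rewrite exprMn_n xx mul0rn.
have y_canc w : N (w + (y * w) *+ kappa) -> N w.
  move=> H; apply: (@preserving_cancel _ x y 3 (y *+ kappa)) => //.
  - by apply: preservingMn; exact: preserving_y.
  - by rewrite exprMn_n yyy mul0rn.
  - by rewrite mulrDl mul1r mulrnAl.
have d_canc w : N (w + (d * w) *+ kappa) -> N w.
  move=> H; apply: (@preserving_cancel _ x y 5 (d *+ kappa)) => //.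
  - exact: preservingMn.
  - by rewrite exprMn_n d5 mul0rn.
  - by rewrite mulrDl mul1r mulrnAl.
have dN w : N w -> N (d * w) by exact: d_pres.
have dd5 : d ^+ 5 = 0 by [].
clearbody u D d.
have dNk j w : N w -> N (d ^+ j * w).
  move=> Nw; elim: j => [|j IH]; first by rewrite expr0 mul1r.
  by rewrite exprS -mulrA; exact: dN.
have dk j v z : N (v - (z + (d * z) *+ kappa)) -> N (d ^+ j * v) -> N (d ^+ j * z).
  move=> H Hv; apply: d_canc.
  have -> : d ^+ j * z + (d * (d ^+ j * z)) *+ kappa = d ^+ j * (z + (d * z) *+ kappa).
    by rewrite mulrDr mulrnAr !mulrA -exprS -exprSr.
  have := dNk j _ H; rewrite mulrBr => H'; exact: ((stable_cong Ns H').1 Hv).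
have d3E w : d ^+ 3 * w = d * (d * (d * w)) by rewrite !exprS expr0 mulr1 !mulrA.
set q := x * p in Np; set r := y * q; set s := x * r; set t := y * s.
set a := x * t; set b := y * t; set m := y * a.
have yr : N (y * r).
  by have := stabley Ns (stabley Ns Np); rewrite !mulrDr yyy0 addr0.
have dr : N (d * r - s).
  by rewrite dE DE mulrDr ux addrC addKr; exact: u_pres.
have W : N (m + x * b + (x * m) *+ kappa).
  apply: y_canc.
  pose z := a + b + (x * b) *+ kappa + (u * m) *+ kappa.
  have ds : d * s = t + a *+ kappa by rewrite dE DE xx0 add0r uE.
  have dt : d * t = a + b + (x * b) *+ kappa by rewrite dE DE uE mulrDr xx0 add0r.
  have dau : d * a = u * m by rewrite dE DE xx0 add0r.
  have zE : d * (d * s) = z by rewrite ds mulrDr mulrnAr dt dau.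
  have Da : D * a = m by rewrite DE xx0 add0r.
  have Db : D * b = x * b by rewrite DE yyy0 addr0.
  have Dxb : D * (x * b) = y * (x * b) by rewrite DE xx0 add0r.
  have Dum : D * (u * m) = x * m + y * (u * m) by rewrite DE xu.
  have Dz : D * z = m + x * b + (x * m) *+ kappa
                   + (y * (m + x * b + (x * m) *+ kappa)) *+ kappa.
    rewrite /z !mulrDr !mulrnAr Da Db Dxb Dum uE mulrDr mulrnAr !mulrnDl.
    by rewrite [LHS](AC (3*(1*2)) (1*2*4*(5*3*6))).
  rewrite -Dz; apply: x_canc; rewrite -dE -zE.
  have d4r : N (d ^+ 4 * r).
    apply: (dk _ (d * q)); last by rewrite mulrA -exprSr dd5 mul0r.
    rewrite dE DE xx0 add0r -/r uE -/s opprD addrACA subrr add0r.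
    by rewrite -mulrnBl; apply: (stableMn Ns); rewrite -opprB; exact: (stableN Ns dr).
  have := dNk 3%N _ dr; rewrite -d3E mulrBr => H; apply: (stable_cong Ns H).1.
  by rewrite mulrA -exprSr.
have xm : N (x * m).
  by have := stablex Ns W; rewrite !mulrDr mulrnAr !xx0 mul0rn !addr0.
have xb : N (x * b + m).
  have := stableB Ns W (stableMn Ns kappa xm); by rewrite addrK addrC.
set n := y * m; set o := x * n; set f := y * o; set g := y * f.
have da : N (d * a - m).
  rewrite dE DE xx0 add0r -/m uE addrC addKr; exact: (stableMn Ns _ xm).
have dm : N (d * m - (n + o *+ kappa)).
  have -> : n + o *+ kappa = u * n by rewrite uE.
  by rewrite dE DE -/n mulrDr addrK; exact: u_pres.
have dn : d * n = o.
  by rewrite dE DE yyy0 addr0 ux.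
have xf : N (x * f + g).
  have d_o : d * o = u * f by rewrite dE DE xx0 add0r.
  have d3n : N (d ^+ 3 * n).
    apply: (dk _ (d * (d * a))); last by rewrite mulrA -exprSr mulrA -exprSr dd5 mul0r.
    rewrite dn -(subrKA (d * m)) -mulrBr; apply: (stableD Ns) => //; exact: dN.
  have Df : D * (u * f) = x * f + g + (y * (x * f + g)) *+ kappa.
    by rewrite DE xu uE !mulrDr mulrnAr yyy0 addr0 -/g addrA.
  by apply: y_canc; rewrite -Df; apply: x_canc; rewrite -dE -d_o -dn -d3E.
have xg : N (x * g).
  by have := stablex Ns xf; rewrite mulrDr xx0 add0r.
(* Words of length [k] annihilate modulo [N] the elements that lie [k] steps
   below the top. *)
pose lift k := iter k (lifted x y) N.
have liftS k : stable x y (lift k).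
  by elim: k => [//|k IH]; exact: stable_lifted.
have liftN w k : N w -> lift k w.
  by move=> Nw; elim: k => [//|k IH]; exact: lifted_sub.
have zero k : lift k 0 by exact: liftN.
have neg k w v : N (w + v) -> lift k v -> lift k w.
  move=> wv kv; rewrite -(addrK v w); apply: (stableB (liftS k)) => //; exact: liftN.
have step k w : lift k (x * w) -> lift k (y * w) -> lift k.+1 w.
  by move=> kx ky; split.
have g1 : lift 1 g by apply: step; [exact: xg | rewrite yyy0].
have f2 : lift 2 f by apply: step => //; exact: neg xf g1.
have o3 : lift 3 o by apply: step => //; rewrite xx0.
have n4 : lift 4 n by apply: step => //; rewrite yyy0.
have m5 : lift 5 m by apply: step => //; exact: liftN xm.
have a6 : lift 6 a by apply: step => //; rewrite xx0.
have b6 : lift 6 b by apply: step; [exact: neg xb m5 | rewrite yyy0].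
have t7 : lift 7 t by exact: step.
have s8 : lift 8 s by apply: step => //; rewrite xx0.
have r9 : lift 9 r by apply: step => //; exact: liftN yr.
have q10 : lift 10 q by apply: step => //; rewrite xx0.
by apply: (step 10%N p) => //; apply: (neg _ _ q) => //; rewrite addrC.
Qed.

End BranchWords.

(** * The relation at a vertex *)

Lemma perm_eq2 (T : eqType) (t : seq T) (a b : T) : perm_eq t [:: a; b] ->
  t = [:: a; b] \/ t = [:: b; a].
Proof.
move=> p; have := perm_size p; case: t p => [|c [|d [|? ?]]] // p _.
have : c \in [:: a; b] by rewrite -(perm_mem p) mem_head.
rewrite !inE => /orP[/eqP ca|/eqP cb]; [left|right]; subst c.
  by move: p; rewrite perm_cons => /perm_mem/(_ d); rewrite !inE eqxx => /esym/eqP->.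
have : perm_eq [:: b; d] [:: b; a].
  by apply: perm_trans p _; rewrite -[[:: a; b]]/([:: a] ++ [:: b]) perm_catC.
by rewrite perm_cons => /perm_mem/(_ d); rewrite !inE eqxx => /esym/eqP->.
Qed.

Section Inverses.
Variable R : pzRingType.
Implicit Types a b z : R.

Definition mutual_inverse a b := (1 + a) * (1 + b) = 1 /\ (1 + b) * (1 + a) = 1.

Lemma mutual_inverse_sym a b : mutual_inverse a b -> mutual_inverse b a.
Proof. by case. Qed.

Lemma mutual_inverseE a b : mutual_inverse a b ->
  b = - (1 + b) * a /\ b = - (a * (1 + b)).
Proof.
have E c d : c + d = 0 -> c = - d :> R by move/eqP; rewrite addr_eq0 => /eqP.
move=> [ab ba]; split; rewrite ?mulNr; apply: E; apply: (addrI 1); rewrite addr0.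
  by rewrite -[in RHS]ba mulrDr mulr1 addrA.
by rewrite -[in RHS]ab mulrDl mul1r addrA.
Qed.

Lemma mutual_inverse_dominates a b : mutual_inverse a b -> dominates a b.
Proof.
move=> ab; have [b1 b2] := mutual_inverseE ab.
by apply: (dominates_comm b1); rewrite -b1 mulrN -b2.
Qed.

Lemma mutual_inverse_uniq a b c :
  mutual_inverse a b -> (1 + a) * (1 + c) = 1 -> c = b.
Proof.
move=> [ab ba] ac; apply: (addrI 1); apply: esym.
exact: invl_uniq ba ac.
Qed.

Lemma dominatesNN a : dominates a (- a) /\ dominates (- a) a.
Proof.
have H c : dominates c (- c).
  by apply: (@dominates_comm _ _ _ (- 1)); rewrite ?mulN1r ?mulrN1.
by split=> //; rewrite -{2}[a]opprK; exact: H.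
Qed.

Lemma dominates_refl a : dominates a a.
Proof. by apply: (@dominates_comm _ _ _ 1); rewrite ?mul1r ?mulr1. Qed.

(** The two alternatives are the two cyclic orders of three factors with product
    [1]; passing to the inverses reverses the order of the first two. *)
Lemma three_factors a1 a2 a3 b1 b2 b3 :
    mutual_inverse a1 b1 -> mutual_inverse a2 b2 -> mutual_inverse a3 b3 ->
    (1 + a1) * ((1 + a2) * (1 + a3)) = 1 \/ (1 + a1) * ((1 + a3) * (1 + a2)) = 1 ->
  (1 + a1) * (1 + a2) = 1 + b3 \/ (1 + b1) * (1 + b2) = 1 + a3.
Proof.
move=> [i1 j1] [i2 j2] [i3 j3] [E|E]; [left|right].
  transitivity ((1 + a1) * (1 + a2) * ((1 + a3) * (1 + b3))).
    by rewrite i3 mulr1.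
  by rewrite mulrA -(mulrA (1 + a1)) E mul1r.
have E1 : (1 + a3) * (1 + a2) = 1 + b1 by exact/esym/(invl_uniq j1 E).
by rewrite -E1 -mulrA i2 mulr1.
Qed.

End Inverses.

Section VertexRelations.
Variables (k : fieldType) (Q : quiver) (P : pzAlgType k).
Variables (G : path_grading (double_quiver Q) P).
Variables (A : pzAlgType k) (h : {rmorphism P -> A}).
Local Notation darrow := (arrow (double_quiver Q)).
Local Notation e i := (h (gidem G i)).
Variables (s : seq darrow) (z : darrow -> A).
Hypothesis ez : forall b, e (qhead b) * z b = z b.
Hypothesis ze : forall b, z b * e (qhead b) = z b.

Let ezN i b : i != qhead b -> e i * z b = 0.
Proof. by move=> ib; rewrite -ez mulrA himM (negPf ib) mul0r. Qed.

Lemma vertex_sum v : \sum_(b <- s) z b = 0 -> \sum_(b <- s | qhead b == v) z b = 0.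
Proof.
move=> s0; transitivity (e v * \sum_(b <- s) z b); last by rewrite s0 mulr0.
rewrite mulr_sumr big_mkcond; apply: eq_bigr => b _.
by case: (qhead b =P v) => [<-|/eqP]; rewrite ?ez // eq_sym => /ezN->.
Qed.

(** The factors at other vertices act as the identity at [v]. *)
Lemma vertex_prod v : \prod_(b <- s) (1 + z b) = 1 ->
  \prod_(b <- s | qhead b == v) (1 + z b) = 1.
Proof.
move=> s1; set M := \prod_(b <- s | _) _.
have inner : e v * M = e v.
  rewrite -[RHS]mulr1 -[in RHS]s1 /M {M s1}; elim: s => [|b t IH]; first by rewrite !big_nil.
  rewrite !big_cons; case: (qhead b =P v) => [bv|/eqP bv].
    have C : e v * (1 + z b) = (1 + z b) * e v.
      by rewrite mulrDr mulrDl mulr1 mul1r -bv ez ze.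
    by rewrite !mulrA C -!mulrA IH.
  by rewrite mulrA mulrDr mulr1 ezN ?addr0 // eq_sym.
have outer : (1 - e v) * M = 1 - e v.
  rewrite /M {M s1 inner}; elim: s => [|b t IH]; first by rewrite big_nil mulr1.
  rewrite big_cons; case: (qhead b =P v) => // bv.
  by rewrite mulrA mulrDr mulr1 mulrBl mul1r -bv ez subrr addr0 bv.
by rewrite -[LHS]mul1r -[X in X * _](subrK (e v) 1) mulrDl outer inner subrK.
Qed.

End VertexRelations.

Section TreeRelations.
Variables (k : fieldType) (Q : quiver) (P : pzAlgType k).
Variables (G : path_grading (double_quiver Q) P).
Variables (A : pzAlgType k) (h : {rmorphism P -> A}).
Local Notation darrow := (arrow (double_quiver Q)).
Local Notation V := (vertex (double_quiver Q)).
Local Notation e i := (h (gidem G i)).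
Local Notation loop b := (loop_at (harr G h) b).

Variables (r : V) (par : V -> V) (ht : V -> nat).
Hypothesis T : star_tree r par ht.
Local Notation upward := (upward r par).

(** The shape at the root: at most one branch, or three branches of lengths
    [1, 1, n] (type D) or [1, 2, n] with [n <= 4] (type E). *)
Definition root_shape :=
  (forall b c, upward b -> upward c -> qhead b = r -> qhead c = r -> b = c) \/
  exists c1 c2 c3, [/\ uniq [:: c1; c2; c3],
    forall c, (upward c && (qhead c == r)) = (c \in [:: c1; c2; c3]),
    ht (qtail c1) = 1%N
  & ht (qtail c2) = 1%N \/ ht (qtail c2) = 2 /\ (ht (qtail c3) <= 4)%N].

Hypothesis shape : root_shape.
Variable s : seq darrow.
Hypothesis s_enum : perm_eq s (enum darrow).
Variable z : darrow -> A.
Hypothesis ez : forall b, e (qhead b) * z b = z b.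
Hypothesis ze : forall b, z b * e (qhead b) = z b.
Hypothesis z_loop : forall b, dominates (z b) (loop b).
Hypothesis loop_z : forall b, dominates (loop b) (z b).
Hypothesis rel : \sum_(b <- s) z b = 0 \/
  \prod_(b <- s) (1 + z b) = 1 /\ forall b, exists z', mutual_inverse (z b) z'.

Let starK (b : darrow) : qstar (qstar b) = b. Proof. by case: b. Qed.
Let head_star (b : darrow) : qhead (qstar b) = qtail b. Proof. by case: b. Qed.
Let tail_star (b : darrow) : qtail (qstar b) = qhead b. Proof. by case: b. Qed.

Lemma at_vertex v (t : seq darrow) : uniq t -> (forall b, (b \in t) = (qhead b == v)) ->
  perm_eq [seq b <- s | qhead b == v] t.
Proof.
move=> ut tv; apply: uniq_perm => // [|b].
  by rewrite filter_uniq // (perm_uniq s_enum) enum_uniq.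
by rewrite mem_filter tv (perm_mem s_enum) mem_enum andbT.
Qed.

Lemma upward_at b c : upward b -> qhead c = qtail b -> c = qstar b \/ upward c.
Proof.
move=> ub cb; have [uc|uc] := orP (upward_total T c); first by right.
left; rewrite -[c]starK; congr qstar.
by apply: (upward_uniq T uc ub); rewrite tail_star.
Qed.

Lemma leaf_rel b : upward b -> (forall c, upward c -> qhead c != qtail b) ->
  z (qstar b) = 0.
Proof.
move=> ub leaf; have p : perm_eq [seq c <- s | qhead c == qtail b] [:: qstar b].
  apply: at_vertex => // c; rewrite inE; apply/eqP/eqP => [->|]; first exact: head_star.
  by move=> cb; have [//|/leaf] := upward_at ub cb; rewrite cb eqxx.
case: rel => [s0|[s1 _]].
  have := vertex_sum ez (qtail b) s0.
  by rewrite -big_filter (perm_big _ p) big_seq1.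
have := vertex_prod ez ze (qtail b) s1.
rewrite -big_filter; have -> : [seq c <- s | qhead c == qtail b] = [:: qstar b].
  exact: perm_small_eq p.
by rewrite big_seq1 -[RHS]addr0 => /addrI.
Qed.

Lemma arm_rel b c : upward b -> upward c -> qhead c = qtail b ->
  dominates (z c) (z (qstar b)) /\ dominates (z (qstar b)) (z c).
Proof.
move=> ub uc cb.
have cNb : qstar b != c.
  apply/eqP => bc; have := ht_par T uc; rewrite cb -bc tail_star.
  by have := ht_par T ub => /ltnW; rewrite leqNgt => /negPf->.
have p : perm_eq [seq d <- s | qhead d == qtail b] [:: qstar b; c].
  apply: at_vertex => [|d]; first by rewrite /= inE cNb.
  rewrite !inE; apply/orP/eqP => [[/eqP->|/eqP->]|db]; rewrite ?head_star //.
  have [->|ud] := upward_at ub db; first by left.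
  by right; apply/eqP; exact: (upward_arm T ub ud uc db cb).
case: rel => [s0|[s1 zV]].
  have := vertex_sum ez (qtail b) s0.
  rewrite -big_filter (perm_big _ p) big_cons big_seq1 => /eqP.
  rewrite addr_eq0 => /eqP->; split; last by case: (dominatesNN (z c)).
  by case: (dominatesNN (z c)).
have [zb zbV] := zV (qstar b); have [zc zcV] := zV c.
have := vertex_prod ez ze (qtail b) s1; rewrite -big_filter.
have E : mutual_inverse (z (qstar b)) (z c) -> dominates (z c) (z (qstar b)) /\
    dominates (z (qstar b)) (z c).
  move=> m; split; last exact: mutual_inverse_dominates.
  exact/mutual_inverse_dominates/mutual_inverse_sym.
have [->|->] := perm_eq2 p; rewrite big_cons big_seq1 => m; apply: E.
  by rewrite (mutual_inverse_uniq zbV m).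
by apply: mutual_inverse_sym; rewrite (mutual_inverse_uniq zcV m).
Qed.

Lemma tree_loop_nilp b : loop b ^+ (ht r).+1 = 0.
Proof. exact: (loop_nilp T z_loop loop_z leaf_rel arm_rel). Qed.

Section Branching.
Variables c1 c2 c3 : darrow.
Hypothesis uc : uniq [:: c1; c2; c3].
Hypothesis cP : forall c, (upward c && (qhead c == r)) = (c \in [:: c1; c2; c3]).
Variables p2 p3 : nat.
Hypotheses (z1 : z c1 ^+ 2 = 0) (z2 : z c2 ^+ p2 = 0) (z3 : z c3 ^+ p3 = 0).

Let head_c c : c \in [:: c1; c2; c3] -> qhead c = r.
Proof. by rewrite -cP => /andP[_ /eqP]. Qed.

Let root_perm : perm_eq [seq b <- s | qhead b == r] [:: c1; c2; c3].
Proof.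
apply: at_vertex => // b; rewrite -cP; case: eqP => [br|]; rewrite ?andbF // andbT.
have [//|/andP[]] := orP (upward_total T b); by rewrite tail_star br eqxx.
Qed.

(** In the additive case [x] and [y] are the first two root loops and
    [twist x y 0] is minus the third.  In the multiplicative case [1 + x] and
    [1 + y] are the first two factors, or both inverses, as the cyclic order
    dictates, and [1 + twist x y 1] is the third factor or its inverse. *)
Lemma root_normal_form : exists x y kappa,
  [/\ x ^+ 2 = 0, y ^+ p2 = 0 & twist x y kappa ^+ p3 = 0] /\
  [/\ e r * x = x, x * e r = x, e r * y = y & y * e r = y] /\
  [/\ exists w, z c1 = w * x, exists w, z c2 = w * y & exists w, z c3 = w * (x + y)].
Proof.
have h1 : qhead c1 = r by apply: head_c; rewrite !inE eqxx.
have h2 : qhead c2 = r by apply: head_c; rewrite !inE eqxx orbT.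
have e1 := ez c1; have f1 := ze c1; have e2 := ez c2; have f2 := ze c2.
rewrite h1 in e1 f1; rewrite h2 in e2 f2.
case: rel => [s0|[s1 zV]].
  have E : z c3 = - (z c1 + z c2).
    have := vertex_sum ez r s0; rewrite -big_filter (perm_big _ root_perm).
    rewrite !big_cons big_nil /= addr0 addrA => /eqP; rewrite addrC addr_eq0.
    by move/eqP.
  exists (z c1), (z c2), 0%N; split; first split=> //.
    by rewrite twistE // mulr0n addr0 -[_ + _]opprK -E exprNn z3 mulr0.
  split; first by [].
  split; [by exists 1; rewrite mul1r | by exists 1; rewrite mul1r |].
  by exists (- 1); rewrite mulN1r.
have [b1 i1] := zV c1; have [b2 i2] := zV c2; have [b3 i3] := zV c3.
have R : (1 + z c1) * ((1 + z c2) * (1 + z c3)) = 1 \/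
         (1 + z c1) * ((1 + z c3) * (1 + z c2)) = 1.
  have := vertex_prod ez ze r s1; rewrite -big_filter.
  have c1t : c1 \in [seq b <- s | qhead b == r] by rewrite (perm_mem root_perm) mem_head.
  (* The relation may be rotated, all factors being units. *)
  case/splitPr: c1t root_perm => t1 t2 pt.
  rewrite big_cat big_cons => M.
  have rot : (1 + z c1) * \prod_(b <- t2 ++ t1) (1 + z b) = 1.
    rewrite big_cat mulrA.
    have [V [Vl Vr]] : exists V, V * \prod_(b <- t1) (1 + z b) = 1 /\
        \prod_(b <- t1) (1 + z b) * V = 1.
      elim: t1 {pt M} => [|b t [V [Vl Vr]]].
        by exists 1; rewrite !big_nil mulr1.
      have [b' [bl br]] := zV b; exists (V * (1 + b')); rewrite !big_cons; split.
        by rewrite -mulrA (mulrA (1 + b')) br mul1r.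
      by rewrite -mulrA (mulrA _ V) Vr mul1r.
    by rewrite -(invl_uniq Vl M).
  have p' : perm_eq (t2 ++ t1) [:: c2; c3].
    rewrite perm_catC; move: pt; rewrite -cat1s perm_catCA /= perm_cons; exact.
  have [E|E] := perm_eq2 p'; move: rot; rewrite E !big_cons big_nil mulr1.
    by left.
  by right.
have [E|E] := three_factors i1 i2 i3 R.
  have tw : twist (z c1) (z c2) 1 = b3.
    apply: (addrI 1); rewrite -E twistE // mulr1n.
    by rewrite mulrDl mul1r mulrDr mulr1 [RHS](AC (2*2) (1*(3*2*4))).
  exists (z c1), (z c2), 1%N; split; first split=> //.
    by rewrite tw; have [_] := mutual_inverse_dominates i3; apply.
  split; first by [].
  split; [by exists 1; rewrite mul1r | by exists 1; rewrite mul1r |].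
  have [-> _] := mutual_inverseE (mutual_inverse_sym i3).
  by exists (- (1 + z c3) * (1 + z c1 *+ 1)); rewrite -mulrA -[_ * (_ + _)]/(twist _ _ _) tw.
have nil1 : b1 ^+ 2 = 0 by have [_] := mutual_inverse_dominates i1; apply.
have tw : twist b1 b2 1 = z c3.
  apply: (addrI 1); rewrite -E twistE // mulr1n.
  by rewrite mulrDl mul1r mulrDr mulr1 [RHS](AC (2*2) (1*(3*2*4))).
exists b1, b2, 1%N; split; first split=> //.
- by have [_] := mutual_inverse_dominates i2; apply.
- by rewrite tw.
have [l1 r1] := mutual_inverseE i1; have [l2 r2] := mutual_inverseE i2.
split; first split.
- by rewrite r1 mulrN mulrA e1.
- by rewrite l1 -mulrA f1.
- by rewrite r2 mulrN mulrA e2.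
- by rewrite l2 -mulrA f2.
split.
- by exists (- (1 + z c1)); exact: (mutual_inverseE (mutual_inverse_sym i1)).1.
- by exists (- (1 + z c2)); exact: (mutual_inverseE (mutual_inverse_sym i2)).1.
- by exists (1 + b1 *+ 1); rewrite -tw.
Qed.

End Branching.

Hypotheses (hk : alg_morphism h) (hsurj : forall u, exists x, h x = u).

Theorem star_nilp : exists n, forall m, (n <= m)%N -> forall u, Jf G h m u -> u = 0.
Proof.
have armf := arm_factor z_loop loop_z arm_rel.
have trunk b : upward b -> z b ^+ (ht (qtail b)).+1 = 0.
  move=> ub; have [_] := loop_z b; apply.
  exact: (arm_nilp T z_loop loop_z leaf_rel arm_rel ub).
have factor b u : (exists w, z b = w * u) -> exists w, loop b = w * u.
  by move=> [w zE]; have [[v lE] _] := z_loop b; exists (v * w); rewrite lE zE mulrA.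
case: shape => [one|[c1 [c2 [c3 [uc cP h1 h23]]]]].
  have words0 (w : seq bool) : size w = 1%N -> \prod_(t <- w) (if t then 0 else 0) = 0 :> A.
    by case: w => // t [|//] _; rewrite big_seq1; case: t.
  apply: (tree_nilp T hk hsurj armf words0); rewrite ?mulr0 ?mul0r // => c ucc cr.
  exists 0, 0; rewrite !mul0r addr0.
  have p : [seq b <- s | qhead b == r] = [:: c].
    apply: perm_small_eq => //; apply: at_vertex => // b.
    rewrite inE; apply/eqP/eqP => [->//|br].
    have [ub|/andP[]] := orP (upward_total T b); first exact: one.
    by rewrite tail_star br eqxx.
  have zc : z c = 0.
    case: rel => [s0|[s1 _]].
      by have := vertex_sum ez r s0; rewrite -big_filter p big_seq1.
    have := vertex_prod ez ze r s1; rewrite -big_filter p big_seq1.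
    by rewrite -[RHS]addr0 => /addrI.
  by have [[w ->] _] := z_loop c; rewrite zc mulr0.
have up c : c \in [:: c1; c2; c3] -> upward c by rewrite -cP => /andP[].
have u1 : upward c1 by apply: up; rewrite !inE eqxx.
have u2 : upward c2 by apply: up; rewrite !inE eqxx orbT.
have u3 : upward c3 by apply: up; rewrite !inE eqxx !orbT.
have n1 : z c1 ^+ 2 = 0 by have := trunk c1 u1; rewrite h1.
suff [p2 [p3 [n2 [n3 reach]]]] : exists p2 p3, z c2 ^+ p2 = 0 /\ z c3 ^+ p3 = 0 /\
    forall x y kappa, x ^+ 2 = 0 -> y ^+ p2 = 0 -> twist x y kappa ^+ p3 = 0 ->
      exists m, forall N, stable x y N -> forall p : A,
        N ((x + y) * p) -> iter m (lifted x y) N p.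
  have [x [y [kappa [[xx yy tw] [[ex xe ey ye] [d1 d2 d3]]]]]] :=
    root_normal_form uc cP n1 n2 n3.
  have [m mP] := reach _ _ _ xx yy tw.
  have words := words_vanish mP (@untwist _ x y kappa xx)
    (@preserving_untwist _ x y kappa) tw.
  apply: (tree_nilp T hk hsurj armf words) => // c ucc cr.
  have : c \in [:: c1; c2; c3] by rewrite -cP ucc cr eqxx.
  rewrite !inE => /or3P[] /eqP->.
  - by have [w ->] := factor _ _ d1; exists w, 0; rewrite mul0r addr0.
  - by have [w ->] := factor _ _ d2; exists 0, w; rewrite mul0r add0r.
  - by have [w ->] := factor _ _ d3; exists w, w; rewrite mulrDr.
case: h23 => [h2|[h2 h3]].
  exists 2, (ht (qtail c3)).+1; split; first by have := trunk c2 u2; rewrite h2.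
  split; first exact: trunk.
  by move=> x y kappa xx yy _; exists 2 => N Ns p; exact: dihedral_reach.
exists 3, 5; split; first by have := trunk c2 u2; rewrite h2.
split; first exact: expr0_le (trunk c3 u3).
by move=> x y kappa xx yy tw; exists 11 => N Ns p; exact: (icosahedral_reach xx yy tw).
Qed.

End TreeRelations.

(** * Dynkin diagrams as rooted trees *)

Section RootedGraph.
Variables (Q : quiver) (r : vertex Q) (par : vertex Q -> vertex Q) (ht : vertex Q -> nat).
Hypothesis edges : forall u v, edge_mult u v =
  ((u != r) && (par u == v) || (v != r) && (par v == u)) :> nat.
Hypothesis ht_lt : forall v, v != r -> (ht v < ht (par v))%N.
Hypothesis ht_pos : forall v, v != r -> (0 < ht v)%N.
Hypothesis ht_top : forall v, v != r -> (ht v < ht r)%N.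
Hypothesis branch : forall u v, u != r -> v != r -> par u = par v -> par u != r -> u = v.

Local Notation darrow := (arrow (double_quiver Q)).

Let between (a : arrow Q) u v :=
  (qtail a == u) && (qhead a == v) || (qtail a == v) && (qhead a == u).

Lemma graph_star_tree : @star_tree Q r par ht.
Proof.
have under (b : darrow) : exists a, (b = inl a \/ b = inr a) /\
    between a (qtail b) (qhead b).
  by case: b => a; exists a; rewrite /between /= !eqxx ?orbT; split; auto.
have edge_in a u v : between a u v -> (0 < edge_mult u v)%N.
  by move=> auv; apply/card_gt0P; exists a; rewrite inE.
have simple (b c : darrow) : upward r par b -> qtail b = qtail c ->
    qhead b = qhead c -> b = c.
  move=> /andP[br bp] bc bh.
  have [a [ba a1]] := under b; have [a' [ca a2]] := under c.
  rewrite -bc -bh in a2.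
  have E : edge_mult (qtail b : vertex Q) (qhead b) = 1%N.
    by rewrite edges br eq_sym bp.
  have aa : a = a'.
    move/eqP/cards1P: E => [a0 E].
    have : a \in [set a0] by rewrite -E inE.
    have : a' \in [set a0] by rewrite -E inE.
    by rewrite !inE => /eqP-> /eqP->.
  have loopless : qtail b <> qhead b.
    by move=> tb; have := ht_lt br; rewrite -(eqP bp) -tb ltnn.
  rewrite -aa in ca; move: bc bh loopless.
  by case: ba => ->; case: ca => -> //= tb hb; case.
split=> //.
- move=> b; have [a [ba /edge_in]] := under b.
  rewrite edges lt0b; case/orP=> /andP[ur pv]; apply/orP; [left|right].
    by rewrite /upward ur eq_sym.
  by case: b ba ur pv => a' _ /= ur pv; rewrite /upward /= ur eq_sym.
- move=> b c ub /andP[cr cp] bc; have /andP[br bp] := ub.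
  by apply: simple => //; rewrite (eqP bp) (eqP cp) bc.
- move=> v vr; have E : (0 < @edge_mult Q v (par v))%N by rewrite edges vr eqxx.
  have /card_gt0P[a] := E; rewrite inE.
  case/orP=> [/andP[/eqP av /eqP ap]|/andP[/eqP ap /eqP av]].
    by exists (inl a) => //; rewrite /upward /= av ap vr eqxx.
  by exists (inr a) => //; rewrite /upward /= av ap vr eqxx.
- by move=> b c _ /andP[cr /eqP cp] <-; rewrite cp; exact: ht_lt.
- move=> b c c' /andP[br _] uc /andP[c'r c'p] cb c'b; have /andP[cr cp] := uc.
  have tc : qtail c = qtail c'.
    by apply: branch => //; rewrite -(eqP cp) ?cb // -(eqP c'p).
  have cc : qhead c = qhead c' by rewrite cb c'b.
  exact: simple.
- by move=> b /andP[br /eqP ->]; exact: ht_lt.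
Qed.

End RootedGraph.

Section Labels.
Variables (Q : quiver) (n : nat) (adj : rel nat).
Variables (f : vertex Q -> 'I_n) (g : 'I_n -> vertex Q).
Hypotheses (fK : cancel f g) (gK : cancel g f).
Hypothesis f_adj : forall u v, edge_mult u v = adj (f u) (f v) :> nat.
Variables (r0 : nat) (pa hi : nat -> nat).
Hypothesis r0n : (r0 < n)%N.
Hypothesis pa_hi : forall i, (i < n)%N -> i != r0 ->
  [/\ (pa i < n)%N, (0 < hi i)%N, (hi i < hi (pa i))%N & (hi i < hi r0)%N].
Hypothesis adj_pa : forall i j, (i < n)%N -> (j < n)%N ->
  adj i j = (i != r0) && (pa i == j) || (j != r0) && (pa j == i).
Hypothesis pa_inj : forall i j, (i < n)%N -> (j < n)%N -> i != r0 -> j != r0 ->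
  pa i = pa j -> pa i != r0 -> i = j.

Definition label_root : vertex Q := g (Ordinal r0n).
Definition label_par (v : vertex Q) : vertex Q := g (insubd (f v) (pa (f v))).
Definition label_ht (v : vertex Q) : nat := hi (f v).

Local Notation r := label_root.
Local Notation par := label_par.
Local Notation upward := (upward (Q := Q) r par).

Let f_inj u v : f u = f v :> nat -> u = v.
Proof. by move/val_inj/(can_inj fK). Qed.

Lemma label_rootE v : (v == r) = (f v == r0 :> nat).
Proof.
apply/eqP/eqP => [->|vr]; first by rewrite /label_root gK.
by apply: f_inj; rewrite vr /label_root gK.
Qed.

Lemma label_parE v : v != r -> f (par v) = pa (f v) :> nat.
Proof.
rewrite label_rootE => vr; rewrite /label_par gK val_insubd.
by have [-> //] := pa_hi (ltn_ord _) vr.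
Qed.

Lemma label_star_tree : @star_tree Q r par label_ht.
Proof.
apply: graph_star_tree => [u v|v vr|v vr|v vr|u v ur vr uv pur].
- rewrite f_adj adj_pa // -!label_rootE.
  have E (a b : vertex Q) : (a != r) && (pa (f a) == f b) = (a != r) && (par a == b).
    case: (boolP (a != r)) => //= ar; rewrite -(label_parE ar).
    by apply/eqP/eqP => [/f_inj|->].
  by rewrite !E.
- have := vr; rewrite /label_ht label_parE // label_rootE => vr'.
  by have [] := pa_hi (ltn_ord _) vr'.
- by have := vr; rewrite label_rootE => vr'; have [] := pa_hi (ltn_ord _) vr'.
- have := vr; rewrite label_rootE /label_ht => vr'.
  by rewrite /label_root gK; have [] := pa_hi (ltn_ord _) vr'.
- apply: f_inj; apply: pa_inj; rewrite -?label_rootE //.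
    by rewrite -!label_parE // uv.
  by rewrite -label_parE // -label_rootE.
Qed.

Let up_tail b c : upward b -> upward c -> f (qtail b) = f (qtail c) :> nat -> b = c.
Proof. by move=> ub uc /f_inj; exact: (upward_uniq label_star_tree). Qed.

Let up_root b : upward b -> (qhead b == r) = (pa (f (qtail b)) == r0).
Proof.
by move=> /andP[br /eqP bp]; rewrite bp label_rootE label_parE.
Qed.

Lemma label_shape_one :
    (forall i j, (i < n)%N -> (j < n)%N -> i != r0 -> j != r0 ->
       pa i = r0 -> pa j = r0 -> i = j) ->
  @root_shape Q r par label_ht.
Proof.
move=> one; left=> b c ub uc /eqP br /eqP cr.
move: br cr; rewrite !up_root // => /eqP br /eqP cr; apply: up_tail => //.
have /andP[bt _] := ub; have /andP[ct _] := uc.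
by apply: one; rewrite -?label_rootE.
Qed.

Lemma label_shape_three i1 i2 i3 :
    uniq [:: i1; i2; i3] ->
    (forall i, (i < n)%N && (i != r0) && (pa i == r0) = (i \in [:: i1; i2; i3])) ->
    hi i1 = 1%N -> hi i2 = 1%N \/ hi i2 = 2 /\ (hi i3 <= 4)%N ->
  @root_shape Q r par label_ht.
Proof.
move=> ui iP h1 h23; right.
have ex i : i \in [:: i1; i2; i3] ->
    exists b, [/\ upward b, qhead b == r & f (qtail b) = i :> nat].
  rewrite -iP => /andP[/andP[ilt ir] pi].
  have vr : g (Ordinal ilt) != r by rewrite label_rootE gK.
  have [b ub bt] := upward_ex label_star_tree vr.
  have fb : f (qtail b) = i :> nat by rewrite bt gK.
  by exists b; rewrite up_root // fb.
have [|c1 [u1 r1 t1]] := ex i1; first by rewrite !inE eqxx.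
have [|c2 [u2 r2 t2]] := ex i2; first by rewrite !inE eqxx orbT.
have [|c3 [u3 r3 t3]] := ex i3; first by rewrite !inE eqxx !orbT.
exists c1, c2, c3; split.
- apply: (@map_uniq _ _ (fun b : arrow (double_quiver Q) => nat_of_ord (f (qtail b)))).
  by rewrite /= t1 t2 t3.
- move=> c; apply/andP/idP => [[uc cr]|]; last first.
    by rewrite !inE => /or3P[] /eqP->.
  have : nat_of_ord (f (qtail c)) \in [:: i1; i2; i3].
    by rewrite -iP ltn_ord -label_rootE -(up_root uc) cr; have /andP[->] := uc.
  rewrite !inE -t1 -t2 -t3 => /or3P[] /eqP/up_tail->; by rewrite ?eqxx ?orbT.
- by rewrite /label_ht t1.
- by rewrite /label_ht t2 t3.
Qed.

End Labels.

(** Type A is rooted at an end of the chain, the other types at the branching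
    vertex. *)
Lemma dynkin_star_tree (Q : quiver) : dynkin_ADE Q -> exists r par ht,
  @star_tree Q r par ht /\ @root_shape Q r par ht.
Proof.
have branched n b (f : vertex Q -> 'I_n) : (0 < b)%N -> (b.+2 < n)%N ->
    bijective f ->
    (forall i j : vertex Q, edge_mult i j = branched_adj n b (f i) (f j) :> nat) ->
    (n - b - 2 = 1 \/ b = 2 /\ n - b - 2 <= 4)%N ->
  exists r par ht, @star_tree Q r par ht /\ @root_shape Q r par ht.
  move=> b0 bn [g fK gK] f_adj shape.
  pose pa i := if (i < b)%N then i.+1 else if i == n.-1 then b else i.-1.
  (* The leaves are [0], [n - 2] and [n - 1]; the height [n + 1] of the root [b]
     only has to exceed the others. *)
  pose hi i := if (i < b)%N then i.+1 else if i == b then n.+1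
               else if i == n.-1 then 1%N else (n.-1 - i)%N.
  have bn' : (b < n)%N by lia.
  have H1 i : (i < n)%N -> i != b ->
      [/\ (pa i < n)%N, (0 < hi i)%N, (hi i < hi (pa i))%N & (hi i < hi b)%N].
    by rewrite /pa /hi => ? ?; split; do !case: ifP; lia.
  have H2 i j : (i < n)%N -> (j < n)%N ->
      branched_adj n b i j = (i != b) && (pa i == j) || (j != b) && (pa j == i).
    by rewrite /pa /branched_adj /chain_adj => ? ?; do !case: ifP; lia.
  have H3 i j : (i < n)%N -> (j < n)%N -> i != b -> j != b -> pa i = pa j ->
      pa i != b -> i = j.
    by rewrite /pa => ? ? ? ?; do !case: ifP; lia.
  exists (label_root g bn'), (label_par f g pa), (label_ht f hi); split.
    exact: (label_star_tree fK gK f_adj).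
  have hi1 : hi n.-1 = 1%N by rewrite /hi; do !case: ifP; lia.
  have hi2 : hi b.-1 = b by rewrite /hi; do !case: ifP; lia.
  have hi3 : hi b.+1 = (n - b - 2)%N by rewrite /hi; do !case: ifP; lia.
  case: shape => [E|[b2 E]].
    apply: (@label_shape_three _ _ _ _ _ fK gK f_adj b pa hi bn' H1 H2 H3
      n.-1 b.+1 b.-1) => //.
    - by rewrite /= !inE; lia.
    - by move=> i; rewrite !inE /pa; do !case: ifP; lia.
    - by left; rewrite hi3.
  apply: (@label_shape_three _ _ _ _ _ fK gK f_adj b pa hi bn' H1 H2 H3
    n.-1 b.-1 b.+1) => //.
  - by rewrite /= !inE; lia.
  - by move=> i; rewrite !inE /pa; do !case: ifP; lia.
  - by right; rewrite hi3 hi2.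
case=> [[n n0 [f [g fK gK] f_adj]]|[n n3 [f fb f_adj]]|[n n678 [f fb f_adj]]].
- pose hi i := (n - i)%N.
  have H1 i : (i < n)%N -> i != 0%N ->
      [/\ (i.-1 < n)%N, (0 < hi i)%N, (hi i < hi i.-1)%N & (hi i < hi 0)%N].
    by rewrite /hi => ? ?; split; lia.
  have H2 i j : (i < n)%N -> (j < n)%N ->
      chain_adj i j = (i != 0%N) && (i.-1 == j) || (j != 0%N) && (j.-1 == i).
    by rewrite /chain_adj; lia.
  have H3 i j : (i < n)%N -> (j < n)%N -> i != 0%N -> j != 0%N -> i.-1 = j.-1 ->
      i.-1 != 0%N -> i = j.
    by lia.
  exists (label_root g n0), (label_par f g predn), (label_ht f hi); split.
    exact: (label_star_tree fK gK f_adj).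
  by apply: (label_shape_one fK gK f_adj) => // i j; lia.
- by apply: (branched n (n - 3)%N f) => //; lia.
- have {n678} : (5 < n <= 8)%N by move: n678; rewrite !inE => /or3P[] /eqP->.
  by move=> n58; apply: (branched n 2 f) => //; lia.
Qed.

(** * Dynkin quivers *)

Section StarAlgebras.
Variables (k : fieldType) (Q : quiver) (P : pzAlgType k).
Variables (G : path_grading (double_quiver Q) P).
Variables (A : pzAlgType k) (h : {rmorphism P -> A}).
Hypothesis hk : alg_morphism h.
Variable s : seq (arrow (double_quiver Q)).
Hypothesis s_enum : perm_eq s (enum (arrow (double_quiver Q))).
Local Notation darrow := (arrow (double_quiver Q)).
Local Notation e i := (h (gidem G i)).
Local Notation loop b := (loop_at (harr G h) b).

Variables (r : vertex Q) (par : vertex Q -> vertex Q) (ht : vertex Q -> nat).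
Hypotheses (T : @star_tree Q r par ht) (shape : @root_shape Q r par ht).

Lemma loop_idem b : e (qhead b) * loop b = loop b /\ loop b * e (qhead b) = loop b.
Proof.
rewrite /loop_at /harr; split; first by rewrite mulrA him_arr.
have -> : qhead b = qtail (qstar b) by case: b.
by rewrite -mulrA harr_im.
Qed.

Lemma additive_nilp : h (additive_rel G) = 0 -> (forall u, exists y, h y = u) ->
  exists n, forall m, (n <= m)%N -> forall u, Jf G h m u -> u = 0.
Proof.
move=> rel0 hsurj; pose z b := signed b (loop b).
have zl b : dominates (z b) (loop b) /\ dominates (loop b) (z b).
  case: b => a; first by split; exact: dominates_refl.
  by split; [exact: (dominatesNN _).2 | exact: (dominatesNN _).1].
have z_idem b : e (qhead b) * z b = z b /\ z b * e (qhead b) = z b.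
  by have [l l'] := loop_idem b; case: b l l' => a l l'; rewrite /z /= ?mulrN ?mulNr l l'.
apply: (star_nilp T shape s_enum _ _ _ _ _ hk hsurj) => [b|b|b|b|].
- exact: (z_idem b).1.
- exact: (z_idem b).2.
- exact: (zl b).1.
- exact: (zl b).2.
left; rewrite /z signed_sum // -[RHS]rel0 /additive_rel rmorph_sum.
by apply: eq_bigr => a _; rewrite rmorphB !rmorphM.
Qed.

Section Multiplicative.
Variable v : darrow -> A.
Hypothesis vV : forall b, (1 + loop b) * v b = 1 /\ v b * (1 + loop b) = 1.
Let fac (b : darrow) : A := match b with inl _ => 1 + loop b | inr _ => v b end.
Hypothesis fac1 : \prod_(b <- s) fac b = 1.
Let z b := fac b - 1.

Let z_inv (a : arrow Q) : mutual_inverse (loop (inr a)) (z (inr a)).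
Proof. by rewrite /mutual_inverse /z [1 + (_ - _)]addrC subrK; exact: vV. Qed.

Let z_inl (a : arrow Q) : z (inl a) = loop (inl a).
Proof. by rewrite /z /= addrC addKr. Qed.

Let zl b : dominates (z b) (loop b) /\ dominates (loop b) (z b).
Proof.
case: b => a; first by rewrite z_inl; split; exact: dominates_refl.
split; last exact: mutual_inverse_dominates.
exact/mutual_inverse_dominates/mutual_inverse_sym.
Qed.

Let z_idem b : e (qhead b) * z b = z b /\ z b * e (qhead b) = z b.
Proof.
have [l r'] := loop_idem b; case: b l r' => a l r'; first by rewrite z_inl.
have [zl' zr'] := mutual_inverseE (z_inv a); split.
  by rewrite {1}zr' mulrN mulrA l -zr'.
by rewrite {1}zl' -mulrA r' -zl'.
Qed.

Let z_rel : \prod_(b <- s) (1 + z b) = 1 /\ forall b, exists z', mutual_inverse (z b) z'.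
Proof.
split; last case=> a.
- by rewrite -[RHS]fac1; apply: eq_bigr => b _; rewrite /z addrC subrK.
- exists (v (inl a) - 1); rewrite /mutual_inverse z_inl.
  by rewrite [1 + (_ - 1)]addrC subrK; exact: vV.
- by exists (loop (inr a)); exact/mutual_inverse_sym/z_inv.
Qed.

Lemma mult_loop_nilp b : loop b ^+ (ht r).+1 = 0.
Proof.
apply: (@tree_loop_nilp _ _ _ G _ h r par ht T s s_enum z) => [c|c|c|c|].
- exact: (z_idem c).1.
- exact: (z_idem c).2.
- exact: (zl c).1.
- exact: (zl c).2.
- by right.
Qed.

(** Loops being nilpotent, inverting [1 + b b^star] adds nothing new. *)
Lemma inverse_in_image b : exists y, h y = v b.
Proof.
exists (geo (ht r).+1 (garr G b * garr G (qstar b))).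
have geoE n y : h (geo n y) = geo n (h y).
  by rewrite /geo rmorph_sum; apply: eq_bigr => i _; rewrite rmorphXn rmorphN.
rewrite geoE rmorphM -/(loop b).
have [l _] := geoV (mult_loop_nilp b); have [_ l'] := vV b.
exact/esym/(invl_uniq l' l).
Qed.

Lemma mult_nilp : (forall u, exists y, h y = u) ->
  exists n, forall m, (n <= m)%N -> forall u, Jf G h m u -> u = 0.
Proof.
move=> hsurj; apply: (@star_nilp _ _ _ G _ h r par ht T shape s s_enum z
  _ _ _ _ _ hk hsurj) => [c|c|c|c|].
- exact: (z_idem c).1.
- exact: (z_idem c).2.
- exact: (zl c).1.
- exact: (zl c).2.
- by right.
Qed.

End Multiplicative.
End StarAlgebras.

Section Dynkin.
Variables (k : fieldType) (Q : quiver) (s : seq (arrow (double_quiver Q))).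
Hypothesis s_enum : perm_eq s (enum (arrow (double_quiver Q))).
Local Notation G := (path_alg_grading k (double_quiver Q)).

Theorem dynkin_isomorphic : (forall n, n.+1%:R != 0 :> k) -> dynkin_ADE Q ->
  alg_isomorphic (mult_preproj (fun=> 1 : k) s) (preproj k Q).
Proof.
move=> char0 /dynkin_star_tree[r [par [ht [T shape]]]].
have rel0 : add_proj k Q (additive_rel G) = 0.
  by apply/add_proj_ker; exact: ideal_gen_in.
have [n1 nil1] := additive_nilp (h := add_proj k Q) (fun=> erefl) s_enum T shape
  rel0 (@add_proj_surj k Q).
have vV := minvV k s; have fac1 := mult_fac_prod k s.
have surj := mult_proj_surj_inv
  (inverse_in_image (G := G) (h := mult_proj k s) s_enum T vV fac1).
have [n2 nil2] := mult_nilp (h := mult_proj k s) (@mult_proj_scalar k Q s) s_enum T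
  shape vV fac1 surj.
apply: (nilpotent_isomorphic (N := maxn n1 n2) char0 s_enum surj).
- by apply: nil1; exact: leq_trans (leq_maxl n1 n2) (leqnSn _).
- by apply: nil2; exact: leq_trans (leq_maxr n1 n2) (leqnSn _).
Qed.

End Dynkin.

Theorem corollary1 (R : realType) (Q : quiver) (hQ : dynkin_ADE Q)
    (s : seq (arrow (double_quiver Q))) (hs : perm_eq s (enum (arrow (double_quiver Q)))) :
  alg_isomorphic (mult_preproj (fun _ : vertex Q => (1 : R[i])) s)
                 (preproj R[i] Q).
Proof.
by apply: dynkin_isomorphic => // n; rewrite Num.Theory.pnatr_eq0.
Qed.
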